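(* Let $M^3$ be an indefinite improper affine hypersphere of $\mathbb{R}^4$ which admits a pointwise $S_3$-symmetry, and assume that the invariant functions satisfy $(\alpha_{22},\alpha_{23})\neq(0,0)$ everywhere. Then $M^3$ admits coordinates $(t,v,w)$ and there are functions $\eta,k$ of $(v,w)$ such that $$\alpha_{22}=\frac{t}{t^2+\eta^2},\quad \alpha_{23}=-\frac{\eta}{t^2+\eta^2},\quad a_6=\frac{e^k}{\sqrt{t^2+\eta^2}},$$ where $\eta,k$ satisfy $$\Big(\tfrac{\partial^2}{\partial v^2}+\tfrac{\partial^2}{\partial w^2}\Big)\eta=2e^{-\frac23k}\eta,\qquad \Big(\tfrac{\partial^2}{\partial v^2}+\tfrac{\partial^2}{\partial w^2}\Big)k=3e^{-\frac23k}\big(2e^{2k}-1\big).$$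
   Context: Setting: $\varphi:M^3\to\mathbb{R}^4$ nondegenerate hypersurface with Blaschke normal $\xi$, $D_X\varphi_*Y=\varphi_*(\nabla_XY)+h(X,Y)\xi$, $D_X\xi=-\varphi_*(SX)$; $h$ affine metric (Lorentzian), $K=\nabla-\hat\nabla$ the difference tensor, $\hat\nabla$ the Levi-Civita connection of $h$. Affine hypersphere: $S=H\,\mathrm{Id}$, $H$ constant; improper if $H=0$. Pointwise $G$-symmetry: for every $p$ the group of $h_p$-isometries $L$ of $T_pM$ with $\det L=1$ and $K_p(LX,LY)=LK_p(X,Y)$ is isomorphic to $G$. Under pointwise $S_3$-symmetry there is locally an $h$-orthonormal frame $\{T,V,W\}$ ($h(T,T)=-1$, $h(V,V)=h(W,W)=1$) and a function $a_6>0$ with $K(T,X)=0$ for all $X$, $K(V,V)=a_6V$, $K(V,W)=-a_6W$, $K(W,W)=-a_6V$; the invariant functions are $\alpha_{22}:=h(\hat\nabla_VT,V)$ and $\alpha_{23}:=h(\hat\nabla_VT,W)$. (The paper denotes the function $\eta$ by $h$; renamed to avoid clash with the metric.) *)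

(* Defs.v *)
From HB Require Import structures.
From mathcomp Require Import all_boot all_order all_algebra.
From mathcomp Require Import fingroup perm.
From mathcomp Require Import boolp classical_sets functions reals topology.
From mathcomp Require Import normedtype sequences derive exp.
Set Implicit Arguments. Unset Strict Implicit. Unset Printing Implicit Defensive.
Import Order.TTheory GRing.Theory Num.Theory.
Import numFieldNormedType.Exports.
Local Open Scope classical_set_scope.
Local Open Scope ring_scope.

Section AffineDefs.
Variable R : realType.

Definition evec (n : nat) (i : 'I_n) : 'rV[R]_n := delta_mx 0 i.

Definition pd (n : nat) (W : normedModType R) (i : 'I_n)
  (f : 'rV[R]_n -> W) : 'rV[R]_n -> W := 'D_(evec i) f.

Definition iter_pd (n : nat) (W : normedModType R) (s : seq 'I_n)
  (f : 'rV[R]_n -> W) : 'rV[R]_n -> W := foldr (fun i g => pd i g) f s.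

Definition Cinf_on (n : nat) (W : normedModType R) (U : set 'rV[R]_n)
  (f : 'rV[R]_n -> W) : Prop :=
  forall (s : seq 'I_n) (x : 'rV[R]_n), U x ->
    {for x, continuous (iter_pd s f)} /\
    forall i : 'I_n, derivable (iter_pd s f) x (evec i).

Definition i0 : 'I_3 := @Ordinal 3 0 isT.
Definition i1 : 'I_3 := @Ordinal 3 1 isT.
Definition i2 : 'I_3 := @Ordinal 3 2 isT.

Variables (phi xi : 'rV[R]_3 -> 'rV[R]_4).

Definition frameM (x : 'rV[R]_3) : 'M[R]_(3 + 1, 4) :=
  col_mx (\matrix_(i < 3) pd i phi x) (xi x).

Definition coefs (x : 'rV[R]_3) (y : 'rV[R]_4) : 'rV[R]_(3 + 1) :=
  y *m invmx (frameM x).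

(* Gauss formula  d_i d_j phi = sum_k Gam^k_ij phi_k + h_ij xi *)
Definition hf (i j : 'I_3) (x : 'rV[R]_3) : R :=
  coefs x (pd i (pd j phi) x) 0 (rshift 3 ord0).
Definition Gam (k i j : 'I_3) (x : 'rV[R]_3) : R :=
  coefs x (pd i (pd j phi) x) 0 (lshift 1 k).

Definition Hmat (x : 'rV[R]_3) : 'M[R]_3 := \matrix_(i, j) hf i j x.

Definition LC (k i j : 'I_3) (x : 'rV[R]_3) : R :=
  2^-1 * \sum_(l < 3) (invmx (Hmat x)) k l *
    (pd i (hf j l) x + pd j (hf i l) x - pd l (hf i j) x).

Definition Kt (k i j : 'I_3) (x : 'rV[R]_3) : R := Gam k i j x - LC k i j x.

Definition happ (x : 'rV[R]_3) (X Y : 'rV[R]_3) : R :=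
  \sum_(i < 3) \sum_(j < 3) hf i j x * X 0 i * Y 0 j.
Definition Kapp (x : 'rV[R]_3) (X Y : 'rV[R]_3) : 'rV[R]_3 :=
  \row_k \sum_(i < 3) \sum_(j < 3) Kt k i j x * X 0 i * Y 0 j.

Definition nablahat (X Y : 'rV[R]_3 -> 'rV[R]_3) (x : 'rV[R]_3) : 'rV[R]_3 :=
  \row_k (\sum_(i < 3) X x 0 i * pd i (fun y => Y y 0 k) x +
          \sum_(i < 3) \sum_(j < 3) LC k i j x * X x 0 i * Y x 0 j).

Definition symL (x : 'rV[R]_3) (L : 'M[R]_3) : Prop :=
  L *m Hmat x *m L^T = Hmat x /\ \det L = 1 /\
  forall X Y : 'rV[R]_3, Kapp x (X *m L) (Y *m L) = Kapp x X Y *m L.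

Definition S3_symmetric_at (x : 'rV[R]_3) : Prop :=
  exists f : {perm 'I_3} -> 'M[R]_3,
    injective f /\
    (forall s t : {perm 'I_3}, f (s * t)%g = f s *m f t) /\
    (forall L : 'M[R]_3, symL x L <-> exists s, L = f s).

Definition improper_affine_hypersphere (U : set 'rV[R]_3) : Prop :=
  open U /\ Cinf_on U phi /\ Cinf_on U xi /\
  (forall x, U x -> \det (frameM x) != 0) /\
  (forall x, U x -> \det (Hmat x) != 0) /\
  (forall x, U x -> `|\det (frameM x)| = Num.sqrt `|\det (Hmat x)|)
                                                     (* volume condition *) /\
  (forall i x, U x -> pd i xi x = 0).                 (* D xi = 0, i.e. S = 0 *)

Definition indefinite_on (U : set 'rV[R]_3) : Prop :=
  forall x, U x -> (exists X, happ x X X < 0) /\ (exists Y, happ x Y Y > 0).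

(* T,V,W an h-orthonormal frame and a6 > 0 with the S_3 normal form of K *)
Definition S3_frame (U : set 'rV[R]_3) (T V W : 'rV[R]_3 -> 'rV[R]_3)
  (a6 : 'rV[R]_3 -> R) : Prop :=
  Cinf_on U T /\ Cinf_on U V /\ Cinf_on U W /\ Cinf_on U a6 /\
  forall x, U x ->
    (happ x (T x) (T x) = -1 /\ happ x (V x) (V x) = 1 /\
     happ x (W x) (W x) = 1 /\ happ x (T x) (V x) = 0 /\
     happ x (T x) (W x) = 0 /\ happ x (V x) (W x) = 0) /\
    0 < a6 x /\
    (forall X, Kapp x (T x) X = 0) /\
    Kapp x (V x) (V x) = a6 x *: V x /\
    Kapp x (V x) (W x) = - a6 x *: W x /\
    Kapp x (W x) (W x) = - a6 x *: V x.

Definition alpha22 (T V : 'rV[R]_3 -> 'rV[R]_3) (x : 'rV[R]_3) : R :=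
  happ x (nablahat V T x) (V x).
Definition alpha23 (T V W : 'rV[R]_3 -> 'rV[R]_3) (x : 'rV[R]_3) : R :=
  happ x (nablahat V T x) (W x).

End AffineDefs.

(* Main.v *)
Require Import Defs.
From HB Require Import structures.
From mathcomp Require Import all_boot all_order all_algebra.
From mathcomp Require Import fingroup perm.
From mathcomp Require Import boolp classical_sets functions reals topology.
From mathcomp Require Import normedtype sequences landau derive exp.
From mathcomp Require Import ring lra.
From mathcomp Require Import trigo interval_inference.
From mathcomp Require Import constructive_ereal measure lebesgue_measure lebesgue_integral ftc.
Import Order.TTheory GRing.Theory Num.Theory.
Import numFieldNormedType.Exports.
Local Open Scope classical_set_scope.
Local Open Scope ring_scope.
Set Implicit Arguments. Unset Strict Implicit. Unset Printing Implicit Defensive.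

(** Since [xi] is constant, [nabla] is a flat torsion-free connection.  Written in
the frame [T, V, W], its connection matrices are skew matrices of [hat nabla]
plus the normal form of [K], and flatness expresses all the coefficients through
[p = alpha22], [q = alpha23] and two further functions [z1], [z2]:
  [T, V] = - p V - 2/3 q W,   [T, W] = 2/3 q V - p W,   [V, W] = 2 q T - z1 V - z2 W,
  T (p + i q) = - (p + i q)^2,   (V + i W) (p + i q) = 0,
  T a6 = - p a6,   (V + i W) log a6 = 3 i (z1 + i z2),
together with a Gauss equation for [V z2 - W z1].  Hence
[t + i eta := 1 / (p + i q)] satisfies [T t = 1] and [T eta = 0].  With
[m := m1 + i m2] the cube root of [a6 (p + i q)^2] (up to a constant phase), the
1-forms taking the values [(0, m1, - m2)] and [(0, m2, m1)] on [(T, V, W)] are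
closed, and their primitives [v], [w] complete [t] to a chart, in which
[V] and [W] are, modulo [d/dt], a rotation and dilation of [d/dv] and
[d/dw], so that [V V + W W + z2 V - z1 W] is [|m|^2] times the Laplacian in
[(v, w)] on functions killed by [T]. *)

(** * Smooth functions *)

(** Flatness comes from the Gauss equation: the curvature of [nabla] is [h(Y,Z) S X - h(X,Z) S Y],
    and [S = 0]. Its h-symmetric part is the Codazzi equation for [K], free of derivatives of the
    connection coefficients; dividing it by [a6] leaves only four real coefficients. The h-skew part
    carries the remaining curvature identities. The exponents in [m = a6^(1/3) (p + i q)^(2/3)] are
    forced: closedness of the two forms means [T m = - (p + 2/3 i q) m] and
    [(V + i W) m = i (z1 + i z2) m]. Setting [e^k = a6 / |p + i q|] gives
    [|m|^2 = e^(2k/3) |p + i q|^2], the origin of the factor [e^(-2k/3)]. The bracket [[V, W]],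
    applied to [t] and to the argument of [p + i q], produces [- 2 q] and [6 a6^2 - 3 |p + i q|^2]
    as rescaled Laplacians of [eta] and [k]. A fractional power needs a branch of the argument, and
    closed forms need a domain without holes; a small ball around the given point meets both
    demands, whence the local chart. Smoothness means existence and continuity of all iterated
    partial derivatives, so the calculus up to the inverse function theorem is developed in these
    terms. *)

Lemma rV_continuousP (R : realType) (V : topologicalType) (m : nat)
  (F : V -> 'rV[R]_m) (x : V) :
  {for x, continuous F} <-> forall j, {for x, continuous (fun y => F y 0 j)}.
Proof.
split=> [cF j|cF].
  apply: (@continuous_comp _ _ _ F (fun M : 'rV[R]_m => M 0 j) x cF).
  exact: coord_continuous.
apply/cvgrPdist_lt => e e0.
have : \forall y \near x, forall j, `|F x 0 j - F y 0 j| < e.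
  by apply: filter_forall => j; have /cvgrPdist_lt/(_ e e0) := cF j.
apply: filterS => y Hy.
rewrite [X in X < _]/Num.Def.normr/= mx_normrE; apply/bigmax_ltP; split=> //.
by move=> [i j] _; rewrite !mxE ord1 /=.
Qed.

Section Calculus.
Variables (R : realType) (n : nat).
Implicit Types (U : set 'rV[R]_n) (f g : 'rV[R]_n -> R) (x v : 'rV[R]_n).

Definition cont_at (W : normedModType R) (f : 'rV[R]_n -> W) (x : 'rV[R]_n) :=
  {for x, continuous f}.

Lemma continuous_coordP (m : nat) (F : 'rV[R]_n -> 'rV[R]_m) x :
  cont_at F x <-> forall j, cont_at (fun y => F y 0 j) x.
Proof. exact: rV_continuousP. Qed.

Lemma pd_near_eq i (W : normedModType R) (f g : 'rV[R]_n -> W) x :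
  (\near x, f x = g x) -> pd i f x = pd i g x.
Proof. exact: near_eq_derive. Qed.

Lemma pd_open_eq U i (W : normedModType R) (f g : 'rV[R]_n -> W) :
  open U -> (forall x, U x -> f x = g x) ->
  forall x, U x -> pd i f x = pd i g x.
Proof.
move=> oU fg x Ux; apply: pd_near_eq.
by apply: filterS fg _; exact: open_nbhs_nbhs.
Qed.

Lemma iter_pd_rcons (W : normedModType R) s i (f : 'rV[R]_n -> W) :
  iter_pd (rcons s i) f = iter_pd s (pd i f).
Proof. by rewrite /iter_pd foldr_rcons. Qed.

Lemma iter_pd_open_eq U s (W : normedModType R) (f g : 'rV[R]_n -> W) :
  open U -> (forall x, U x -> f x = g x) ->
  forall x, U x -> iter_pd s f x = iter_pd s g x.
Proof.
move=> oU fg; elim: s => [//|i s IH] x Ux.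
exact: (pd_open_eq i oU IH Ux).
Qed.

Lemma open_eq_near U (T : Type) (f g : 'rV[R]_n -> T) : open U ->
  (forall x, U x -> f x = g x) -> forall x, U x -> \near x, f x = g x.
Proof.
move=> oU fg x Ux.
by apply: filterS fg _; exact: open_nbhs_nbhs.
Qed.

Lemma continuous_open_eq U (W : normedModType R) (f g : 'rV[R]_n -> W) :
  open U -> (forall x, U x -> f x = g x) ->
  forall x, U x -> {for x, continuous f} -> {for x, continuous g}.
Proof.
move=> oU fg x Ux; rewrite /prop_for /continuous_at -(fg x Ux) => cf.
exact: (cvg_trans (near_eq_cvg (open_eq_near oU fg Ux)) cf).
Qed.

Lemma Cinf_on_eq U (W : normedModType R) (f g : 'rV[R]_n -> W) :
  open U -> (forall x, U x -> f x = g x) -> Cinf_on U f -> Cinf_on U g.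
Proof.
move=> oU fg Cf s x Ux; have [cf df] := Cf s x Ux.
have e := iter_pd_open_eq s oU fg.
split; first exact: (continuous_open_eq oU e Ux cf).
by move=> i; apply: near_eq_derivable (df i); exact: (open_eq_near oU e Ux).
Qed.

Lemma Cinf_on_sub U U' (W : normedModType R) (f : 'rV[R]_n -> W) :
  U' `<=` U -> Cinf_on U f -> Cinf_on U' f.
Proof. by move=> sU Cf s x /sU; exact: Cf. Qed.

Lemma Cinf_continuous U (W : normedModType R) (f : 'rV[R]_n -> W) x :
  Cinf_on U f -> U x -> {for x, continuous f}.
Proof. by move=> Cf Ux; exact: (Cf [::] x Ux).1. Qed.

Lemma Cinf_on_pd U (W : normedModType R) i (f : 'rV[R]_n -> W) :
  Cinf_on U f -> Cinf_on U (pd i f).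
Proof. by move=> Cf s x Ux; rewrite -iter_pd_rcons; exact: Cf. Qed.

(** The last index of [s] is differentiated first, so the induction runs from the right and replaces
    [f] by another member of [P], up to equality on [U]. The class [P] may contain functions whose
    smoothness is not yet known. *)
Lemma Cinf_on_coind U (P : ('rV[R]_n -> R) -> Prop) : open U ->
  (forall f, P f -> forall x, U x -> {for x, continuous f}) ->
  (forall f, P f -> forall x i, U x -> derivable f x (evec R i)) ->
  (forall f, P f -> forall i, exists2 g, P g & forall x, U x -> pd i f x = g x) ->
  forall f, P f -> Cinf_on U f.
Proof.
move=> oU Pc Pd Pp f Pf s; elim/last_ind: s f Pf => [|s i IH] f Pf x Ux.
  by split; [exact: Pc | move=> i; exact: Pd].
rewrite iter_pd_rcons.
have [g Pg fg] := Pp f Pf i.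
have [cg dg] := IH g Pg x Ux.
have e : forall x, U x -> iter_pd s g x = iter_pd s (pd i f) x.
  by apply: iter_pd_open_eq => // y Uy; rewrite fg.
split; first exact: (continuous_open_eq oU e Ux cg).
by move=> j; apply: near_eq_derivable (dg j); exact: (open_eq_near oU e Ux).
Qed.

(** A partial derivative commutes with a coordinate projection only where [iter_pd s F] is
    derivable. Hence [main] assumes derivability along shorter sequences, and the direction from
    coordinates to [F] supplies it by strong induction on the length of [s]. *)
Lemma Cinf_on_coordP U (m : nat) (F : 'rV[R]_n -> 'rV[R]_m) : open U ->
  Cinf_on U F <-> forall j, Cinf_on U (fun y => F y 0 j).
Proof.
move=> oU.
have main : forall s : seq 'I_n,
    (forall s' x, (size s' < size s)%N -> U x ->
       forall i, derivable (iter_pd s' F) x (evec R i)) ->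
    forall x, U x -> forall j, iter_pd s F x 0 j = iter_pd s (fun y => F y 0 j) x.
  elim=> [//|i s IH] H x Ux j /=.
  have ds := H s x (leqnn _) Ux i.
  rewrite {1}/pd derive_mx// mxE.
  have IH' y : U y -> iter_pd s F y 0 j = iter_pd s (fun y => F y 0 j) y.
    move=> Uy; refine (IH _ y Uy j) => s' z ss Uz i'.
    exact: (H s' z (ltn_trans ss (leqnn _)) Uz i').
  exact: (pd_open_eq i oU IH' Ux).
split=> [CF j s x Ux|CF s].
  have e : forall x, U x -> iter_pd s F x 0 j = iter_pd s (fun y => F y 0 j) x.
    by move=> y Uy; apply: main => // s' z _ Uz i; exact: (CF s' z Uz).2.
  have [cF dF] := CF s x Ux.
  split.
    exact: (continuous_open_eq oU e Ux ((continuous_coordP _ _).1 cF j)).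
  move=> i; apply: near_eq_derivable (open_eq_near oU e Ux) _.
  by have /derivable_mxP := dF i; apply.
have [k] := ubnP (size s); elim: k s => // k IH s sk x Ux.
have e j : forall x, U x -> iter_pd s (fun y => F y 0 j) x = iter_pd s F x 0 j.
  move=> y Uy; apply/esym; apply: main => // s' z ss Uz i.
  by have [] := IH s' (leq_trans ss sk) z Uz.
split.
  apply: (continuous_coordP _ _).2 => j.
  exact: (continuous_open_eq oU (e j) Ux (CF j s x Ux).1).
move=> i; apply/derivable_mxP => a j; rewrite ord1.
apply: near_eq_derivable (open_eq_near oU (e j) Ux) _.
by have [_] := CF j s x Ux; apply.
Qed.

Lemma pd_coord i (m : nat) (F : 'rV[R]_n -> 'rV[R]_m) x j :
  derivable F x (evec R i) -> pd i F x 0 j = pd i (fun y => F y 0 j) x.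
Proof. by move=> dF; rewrite /pd derive_mx// mxE. Qed.

End Calculus.

(** * Epsilon-delta criteria in normed spaces *)

Section EpsDelta.
Variables (R : realType) (V W : normedModType R).
Implicit Types (x y : V) (P : set V).

Lemma nbhs_normE x P :
  nbhs x P <-> exists2 d : R, 0 < d & forall y, `|y - x| < d -> P y.
Proof.
split=> [/nbhs_ballP[d /= d0 H]|[d d0 H]].
  by exists d => // y yx; apply: H; rewrite -ball_normE /= distrC.
by apply/nbhs_ballP; exists d => //= y; rewrite -ball_normE /= distrC => /H.
Qed.

Lemma open_normP (U : set V) :
  open U <-> forall x, U x -> exists2 d : R, 0 < d & forall y, `|y - x| < d -> U y.
Proof.
rewrite openE; split=> H x Ux; first by apply/nbhs_normE; exact: H.
by apply: (nbhs_normE _ _).2; exact: H.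
Qed.

Lemma continuous_normP (f : V -> W) x : {for x, continuous f} <->
  forall e : R, 0 < e -> exists2 d : R, 0 < d & forall y, `|y - x| < d -> `|f y - f x| < e.
Proof.
split=> [/cvgrPdist_lt H e e0|H].
  have /nbhs_normE[d d0 Hd] := H e e0.
  by exists d => // y yx; rewrite distrC; exact: Hd.
apply/cvgrPdist_lt => e e0; apply/nbhs_normE.
by have [d d0 Hd] := H e e0; exists d => // y yx; rewrite distrC; exact: Hd.
Qed.

Lemma near_forall (I : finType) (Q : I -> set V) x :
  (forall i, exists2 d : R, 0 < d & forall y, `|y - x| < d -> Q i y) ->
  exists2 d : R, 0 < d & forall y, `|y - x| < d -> forall i, Q i y.
Proof.
move=> H; apply/nbhs_normE; apply: filter_forall => i; exact/nbhs_normE.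
Qed.

Lemma linear_bound_continuous (L : {linear V -> W}) (M : R) : 0 <= M ->
  (forall h, `|L h| <= M * `|h|) -> continuous L.
Proof.
move=> M0 H x; apply/continuous_normP => e e0.
exists (e / (M + 1)); first by rewrite divr_gt0// ltr_wpDl.
move=> y; rewrite ltr_pdivlMr ?ltr_wpDl// => yx.
rewrite -linearB; apply: (le_lt_trans (H _)); apply: le_lt_trans yx.
by rewrite mulrC ler_wpM2l// lerDl.
Qed.

(** The estimate is the little-o expansion that characterises the differential; its uniqueness
    identifies ['d f x] with [L]. *)
Lemma estimate_differentiable (f : V -> W) (L : {linear V -> W}) x :
  continuous L ->
  (forall e : R, 0 < e -> exists2 d : R, 0 < d & forall h, `|h| < d ->
    `|f (x + h) - f x - L h| <= e * `|h|) ->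
  differentiable f x /\ 'd f x = L :> (V -> W).
Proof.
move=> cL H.
have E : f \o shift x = cst (f x) + L +o_ 0 id.
  apply/eqaddoP => e e0; have [d d0 Hd] := H _ e0.
  apply/nbhs_normE; exists d => // h; rewrite subr0 => /Hd /=.
  by rewrite !fctE /= opprD addrA [h + x]addrC.
have D := diff_unique cL E.
split=> //; apply/diff_locallyP.
by rewrite D.
Qed.

End EpsDelta.

Section RowNorm.
Variables (R : realType) (n : nat).
Implicit Types v : 'rV[R]_n.

Lemma rV_norm_le v c : 0 <= c -> (forall i, `|v 0 i| <= c) -> `|v| <= c.
Proof.
move=> c0 H; rewrite [leLHS]/Num.Def.normr/= mx_normrE; apply/bigmax_leP; split=> //.
by move=> [i j] _ /=; rewrite ord1; exact: H.
Qed.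

Lemma rV_coord_le v i : `|v 0 i| <= `|v|.
Proof.
rewrite [leRHS]/Num.Def.normr/= mx_normrE.
exact: (le_bigmax _ (fun ij : 'I_1 * 'I_n => `|v ij.1 ij.2|) (0, i)).
Qed.

Lemma rV_norm_lt v c : 0 < c -> (forall i, `|v 0 i| < c) -> `|v| < c.
Proof.
move=> c0 H; rewrite [ltLHS]/Num.Def.normr/= mx_normrE; apply/bigmax_ltP; split=> //.
by move=> [i j] _ /=; rewrite ord1; exact: H.
Qed.

End RowNorm.

(** * Derivatives along lines and the mean value theorem *)

Section Lines.
Variables (R : realType) (V : normedModType R).
Implicit Types (f : V -> R) (y v : V).

Lemma is_derive_line f y v (s : R) : derivable f (y + s *: v) v ->
  is_derive s 1 (fun s : R => f (y + s *: v)) ('D_v f (y + s *: v)).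
Proof.
move=> df.
have e : (fun h : R => h^-1 *: (((fun s : R => f (y + s *: v)) \o shift s) (h *: (1 : R)) - f (y + s *: v)))
   = (fun h : R => h^-1 *: ((f \o shift (y + s *: v)) (h *: v) - f (y + s *: v))).
  apply/funext => h /=; congr (_ *: (f _ - _)).
  by rewrite scalerDl [h *: (1 : R)]mulr1 addrCA.
by apply: DeriveDef; rewrite ?/derivable ?/derive e.
Qed.

Lemma is_derive_along f (x v : V) (a : R) :
  is_derive (0 : R) 1 (fun h : R => f (x + h *: v)) a -> is_derive x v f a.
Proof.
move=> [D E].
have e : (fun h : R => h^-1 *: (((fun h : R => f (x + h *: v)) \o shift 0) (h *: (1 : R)) - f (x + 0 *: v)))
   = (fun h : R => h^-1 *: ((f \o shift x) (h *: v) - f x)).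
  apply/funext => h /=; rewrite scale0r !addr0 [h *: (1 : R)]mulr1.
  by rewrite [x + _]addrC.
by apply: DeriveDef; move: D E; rewrite /derivable /derive e.
Qed.

Lemma MVT_line f y v (h : R) :
  (forall s, `|s| <= `|h| -> derivable f (y + s *: v) v) ->
  exists2 c, `|c| <= `|h| & f (y + h *: v) - f y = h * 'D_v f (y + c *: v).
Proof.
move=> df; set g := fun s : R => f (y + s *: v).
have dg (s : R) : `|s| <= `|h| -> is_derive s 1 g ('D_v f (y + s *: v)).
  by move=> sh; apply: is_derive_line; exact: df.
have cg a b : (forall s : R, s \in `[a, b] -> `|s| <= `|h|) -> {within `[a, b], continuous g}.
  move=> H; apply: derivable_within_continuous => s sab.
  by have [] := dg s (H s sab).
have [h0|h0] := leP 0 h.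
  have H (s : R) : s \in `[0, h] -> `|s| <= `|h|.
    by rewrite in_itv/= => /andP[s0 sh]; rewrite !ger0_norm.
  have [|c cI E] := @MVT_segment R g (fun s => 'D_v f (y + s *: v)) 0 h h0 _ (cg _ _ H).
    by move=> s sI; apply: dg; apply: H; apply: subset_itv_oo_cc sI.
  exists c; first exact: H.
  by move: E; rewrite /g scale0r addr0 subr0 mulrC.
have H (s : R) : s \in `[h, 0] -> `|s| <= `|h|.
  by rewrite in_itv/= => /andP[s0 sh]; rewrite !ler0_norm ?lerN2// ltW.
have [|c cI E] := @MVT_segment R g (fun s => 'D_v f (y + s *: v)) h 0 (ltW h0) _ (cg _ _ H).
  by move=> s sI; apply: dg; apply: H; apply: subset_itv_oo_cc sI.
exists c; first exact: H.
move: E; rewrite /g scale0r addr0 sub0r => E.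
by rewrite -opprB E mulrN opprK mulrC.
Qed.

End Lines.

Lemma cont_atP (R : realType) (n : nat) (W : normedModType R)
    (f : 'rV[R]_n -> W) x : cont_at f x <->
  forall e : R, 0 < e -> exists2 d : R, 0 < d & forall y, `|y - x| < d -> `|f y - f x| < e.
Proof. exact: continuous_normP. Qed.

(** * Continuous partial derivatives imply differentiability *)

Section C1.
Variables (R : realType) (n : nat).
Implicit Types (U : set 'rV[R]_n) (f g : 'rV[R]_n -> R) (x v : 'rV[R]_n).

(** The increment is telescoped into steps along the axes. The mean value theorem turns each step
    into a partial derivative at an intermediate point, which the sup norm keeps within [|h|] of
    [x]; continuity of the partials at [x] bounds the error. *)
Lemma C1_estimate U f x : open U -> U x ->
  (forall y i, U y -> derivable f y (evec R i)) ->
  (forall i, cont_at (pd i f) x) ->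
  forall e, 0 < e -> exists2 d, 0 < d & forall h, `|h| < d ->
    `|f (x + h) - f x - \sum_i h 0 i * pd i f x| <= e * `|h|.
Proof.
move=> oU Ux df cf e e0.
(* Each of the [n] steps may cost [e' * |h|]; dividing by [n.+1] also covers dimension 0. *)
set e' := e / n.+1%:R.
have e'0 : 0 < e' by rewrite divr_gt0// ltr0Sn.
have [d /= d0 Hd] : exists2 d, 0 < d & forall y, `|y - x| < d ->
    U y /\ forall i, `|pd i f x - pd i f y| < e'.
  have [d1 d10 H1] := (open_normP _).1 oU x Ux.
  have [d2 d20 H2] := near_forall (fun i => (cont_atP _ _).1 (cf i) _ e'0).
  exists (Num.min d1 d2) => [|y]; first by rewrite lt_min d10.
  rewrite lt_min => /andP[y1 y2]; split; first exact: H1.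
  by move=> i; rewrite distrC; exact: H2.
exists d => // h hd.
(* [P k] keeps the first [k] coordinates of [h] and zeroes the others, so consecutive points differ
   along one axis. *)
pose P k : 'rV[R]_n := \row_j (if (j < k)%N then h 0 j else 0).
have PS (k : 'I_n) : P k.+1 = P k + h 0 k *: evec R k.
  apply/rowP => j; rewrite !mxE eqxx /= ltnS leq_eqVlt.
  have [->|jk] := eqVneq j k; first by rewrite eqxx ltnn mulr1 add0r.
  by rewrite (negbTE (jk : nat_of_ord j != k)) mulr0 addr0.
have Pn : P n = h by apply/rowP => j; rewrite mxE ltn_ord.
have P0 : P 0 = 0 by apply/rowP => j; rewrite !mxE.
have Hk (k : 'I_n) : exists2 y, `|y - x| <= `|h| & f (x + P k.+1) - f (x + P k) = h 0 k * pd k f y.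
  have bnd c : `|c| <= `|h 0 k| -> `|x + P k + c *: evec R k - x| <= `|h|.
    move=> ch; rewrite -addrA -addrA addrC addrA subrK; apply: rV_norm_le => // j.
    rewrite !mxE eqxx /=; have [->|jk] := eqVneq j k.
      by rewrite ltnn add0r mulr1 (le_trans ch)// rV_coord_le.
    rewrite mulr0 addr0; case: ifP => _; last by rewrite normr0.
    exact: rV_coord_le.
  have [|c ch E] := @MVT_line R _ f (x + P k) (evec R k) (h 0 k).
    move=> s sh; apply: df; apply: (Hd _ _).1; exact: le_lt_trans (bnd _ sh) hd.
  exists (x + P k + c *: evec R k); first exact: bnd.
  by rewrite PS addrA E.
have tel : f (x + h) - f x = \sum_(k < n) (f (x + P k.+1) - f (x + P k)).
  have := telescope_sumr (fun k => f (x + P k)) (leq0n n).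
  by rewrite big_mkord Pn P0 addr0 => ->.
rewrite tel -sumrB; apply: (le_trans (ler_norm_sum _ _ _)).
apply: (@le_trans _ _ (\sum_(k < n) `|h| * e')).
  apply: ler_sum => k _; have [y yx ->] := Hk k.
  rewrite -mulrBr normrM; apply: ler_pM => //; first exact: rV_coord_le.
  rewrite distrC; apply/ltW; apply: (Hd _ _).2; exact: le_lt_trans yx hd.
have -> : \sum_(k < n) `|h| * e' = e * `|h| * (n%:R / n.+1%:R).
  rewrite sumr_const card_ord -[LHS]mulr_natr /e'; field.
  by rewrite (_ : 1 + n%:R = n.+1%:R :> R) ?pnatr_eq0// -natr1 addrC.
rewrite ler_piMr// ?mulr_ge0// ?ltW//.
by rewrite ltr_pdivrMr ?ltr0Sn// mul1r ltr_nat.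
Qed.

Lemma C1_differentiable U f x : open U -> U x ->
  (forall y i, U y -> derivable f y (evec R i)) ->
  (forall i, cont_at (pd i f) x) ->
  differentiable f x /\ forall v, 'd f x v = \sum_i v 0 i * pd i f x.
Proof.
move=> oU Ux df cf.
have lin : linear (fun h : 'rV[R]_n => \sum_i h 0 i * pd i f x).
  move=> a u v; rewrite scaler_sumr -big_split /=; apply: eq_bigr => i _.
  by rewrite !mxE mulrDl scalerAl.
pose Lm := GRing.isLinear.Build _ _ _ _ _ lin.
pose L : {linear 'rV[R]_n -> R} := HB.pack (fun h : 'rV[R]_n => \sum_i h 0 i * pd i f x) Lm.
have cL : continuous L.
  apply: (@linear_bound_continuous _ _ _ L (\sum_i `|pd i f x|)).
    by apply: sumr_ge0.
  move=> h; rewrite mulr_suml; apply: (le_trans (ler_norm_sum _ _ _)).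
  apply: ler_sum => i _; rewrite normrM mulrC ler_wpM2l//; exact: rV_coord_le.
have [D E] := estimate_differentiable cL (C1_estimate oU Ux df cf).
by split=> // v; rewrite E.
Qed.

End C1.

(** * Rules for partial derivatives and stability of smoothness *)

Section PdRules.
Variables (R : realType) (n : nat).
Implicit Types (U : set 'rV[R]_n) (f g : 'rV[R]_n -> R) (x v : 'rV[R]_n).

Lemma Cinf_differentiable U f x : open U -> Cinf_on U f -> U x ->
  differentiable f x.
Proof.
move=> oU Cf Ux; apply: (C1_differentiable oU Ux _ _).1.
  by move=> y i Uy; exact: (Cf [::] y Uy).2.
by move=> i; exact: (Cf [:: i] x Ux).1.
Qed.

Lemma Cinf_diffE U f x v : open U -> Cinf_on U f -> U x ->
  'd f x v = \sum_i v 0 i * pd i f x.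
Proof.
move=> oU Cf Ux; apply: (C1_differentiable oU Ux _ _).2.
  by move=> y i Uy; exact: (Cf [::] y Uy).2.
by move=> i; exact: (Cf [:: i] x Ux).1.
Qed.

Lemma Cinf_deriveE U f x v : open U -> Cinf_on U f -> U x ->
  'D_v f x = \sum_i v 0 i * pd i f x.
Proof.
move=> oU Cf Ux; rewrite deriveE; first exact: Cinf_diffE Ux.
exact: Cinf_differentiable Ux.
Qed.

Lemma derive_pdE i f x : 'D_(evec R i) f x = pd i f x.
Proof. by []. Qed.

Lemma pd_diffE i f x : differentiable f x -> pd i f x = 'd f x (evec R i).
Proof. by move=> df; rewrite /pd deriveE. Qed.

Lemma pd_cst i (c : R) x : pd i (fun=> c) x = 0.
Proof. exact: derive_cst. Qed.

Lemma pdD i f g x : differentiable f x -> differentiable g x ->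
  pd i (fun y => f y + g y) x = pd i f x + pd i g x.
Proof. by move=> df dg; apply: deriveD; exact: diff_derivable. Qed.

Lemma pdN i f x : differentiable f x -> pd i (fun y => - f y) x = - pd i f x.
Proof. by move=> df; apply: deriveN; exact: diff_derivable. Qed.

Lemma pdM i f g x : differentiable f x -> differentiable g x ->
  pd i (fun y => f y * g y) x = pd i f x * g x + f x * pd i g x.
Proof.
move=> df dg; rewrite addrC [pd i f x * _]mulrC.
by apply: deriveM; exact: diff_derivable.
Qed.

Lemma pd_comp1 i (h : R -> R) (dh : R) f x : differentiable f x ->
  is_derive (f x) 1 h dh -> pd i (fun y => h (f y)) x = dh * pd i f x.
Proof.
move=> df [dhf hv].
have dh' : differentiable h (f x) by apply/derivable1_diffP.
have E u : 'd h (f x) u = dh * u.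
  have := congr1 (fun F : R -> R => F u) (deriv1E dhf).
  by rewrite derive1E hv => ->; rewrite mulrC.
rewrite /pd (@deriveE _ _ _ (h \o f)); last exact: differentiable_comp.
by rewrite diff_comp// [LHS]E deriveE.
Qed.

Lemma differentiable_comp1 (h : R -> R) (dh : R) f x : differentiable f x ->
  is_derive (f x) 1 h dh -> differentiable (fun y => h (f y)) x.
Proof.
move=> df [dhf _]; apply: (@differentiable_comp _ _ _ _ f h) => //.
exact/derivable1_diffP.
Qed.

Lemma pdV i f x : differentiable f x -> f x != 0 ->
  pd i (fun y => (f y)^-1) x = - pd i f x * ((f x)^-1 * (f x)^-1).
Proof.
move=> df f0; rewrite /pd deriveV//; last exact: diff_derivable.
have -> : (f x)^-1 * (f x)^-1 = (f x) ^- 2 by rewrite expr2 invfM.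
by rewrite mulNr mulrC -mulNr.
Qed.

Lemma differentiable_sumf (I : Type) (r : seq I) (F : I -> 'rV[R]_n -> R) x :
  (forall k, differentiable (F k) x) ->
  differentiable (fun y => \sum_(k <- r) F k y) x.
Proof.
move=> dF; elim: r => [|k r IH].
  rewrite (_ : (fun y => _) = cst 0); last by apply/funext => y; rewrite big_nil.
  exact: differentiable_cst.
rewrite (_ : (fun y => _) = (fun y => F k y + \sum_(k <- r) F k y)); last first.
  by apply/funext => y; rewrite big_cons.
exact: differentiableD.
Qed.

Lemma pd_sum i (I : Type) (r : seq I) (F : I -> 'rV[R]_n -> R) x :
  (forall k, differentiable (F k) x) ->
  pd i (fun y => \sum_(k <- r) F k y) x = \sum_(k <- r) pd i (F k) x.
Proof.
move=> dF; elim: r => [|k r IH].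
  rewrite big_nil (_ : (fun y => _) = cst 0); first exact: pd_cst.
  by apply/funext => y; rewrite big_nil.
rewrite big_cons (_ : (fun y => _) = (fun y => F k y + \sum_(k <- r) F k y)); last first.
  by apply/funext => y; rewrite big_cons.
by rewrite pdD// ?IH//; exact: differentiable_sumf.
Qed.

Lemma pd_coordE i j x : pd i (fun y : 'rV[R]_n => y 0 j) x = (i == j)%:R :> R.
Proof.
rewrite -(@pd_coord R n i n id x j); last exact: derivable_id.
by rewrite /pd derive_id mxE eqxx eq_sym.
Qed.

(* The set of expressions in smooth functions is stable under [pd], so that
[Cinf_on_coind] applies to it. *)
Inductive smooth_closure U : ('rV[R]_n -> R) -> Prop :=
| SC_base f of Cinf_on U f : smooth_closure U f
| SC_cst c : smooth_closure U (fun=> c)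
| SC_D f g of smooth_closure U f & smooth_closure U g :
    smooth_closure U (fun x => f x + g x)
| SC_N f of smooth_closure U f : smooth_closure U (fun x => - f x)
| SC_M f g of smooth_closure U f & smooth_closure U g :
    smooth_closure U (fun x => f x * g x)
| SC_V f of smooth_closure U f & (forall x, U x -> f x != 0) :
    smooth_closure U (fun x => (f x)^-1)
| SC_exp f of smooth_closure U f : smooth_closure U (fun x => expR (f x))
| SC_ln f of smooth_closure U f & (forall x, U x -> 0 < f x) :
    smooth_closure U (fun x => ln (f x))
| SC_sin f of smooth_closure U f : smooth_closure U (fun x => sin (f x))
| SC_cos f of smooth_closure U f : smooth_closure U (fun x => cos (f x))
| SC_atan f of smooth_closure U f : smooth_closure U (fun x => atan (f x)).

Lemma smooth_closure_differentiable U f x : open U -> smooth_closure U f ->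
  U x -> differentiable f x.
Proof.
move=> oU sf Ux; elim: sf.
- by move=> g Cg; exact: Cinf_differentiable Ux.
- by move=> c; exact: differentiable_cst.
- by move=> g h _ dg _ dh; exact: differentiableD.
- by move=> g _ dg; exact: differentiableN.
- by move=> g h _ dg _ dh; exact: differentiableM.
- by move=> g _ dg g0; apply: differentiableV => //; exact: g0.
- by move=> g _ dg; exact: (differentiable_comp1 dg (is_derive_expR _)).
- by move=> g _ dg g0; exact: (differentiable_comp1 dg (is_derive1_ln (g0 x Ux))).
- by move=> g _ dg; exact: (differentiable_comp1 dg (is_derive_sin _)).
- by move=> g _ dg; exact: (differentiable_comp1 dg (is_derive_cos _)).
- by move=> g _ dg; exact: (differentiable_comp1 dg (is_derive1_atan _)).
Qed.

Lemma smooth_closure_pd U f i : open U -> smooth_closure U f ->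
  exists2 g, smooth_closure U g & forall x, U x -> pd i f x = g x.
Proof.
move=> oU; have df := smooth_closure_differentiable oU.
elim.
- move=> g Cg; exists (pd i g) => //; apply: SC_base; exact: Cinf_on_pd.
- move=> c; exists (fun=> 0); first exact: SC_cst.
  by move=> x _; rewrite pd_cst.
- move=> g h Sg [dg Sdg eg] Sh [dh Sdh eh]; exists (fun x => dg x + dh x).
    exact: SC_D.
  by move=> x Ux; rewrite pdD ?eg ?eh//; exact: df.
- move=> g Sg [dg Sdg eg]; exists (fun x => - dg x); first exact: SC_N.
  by move=> x Ux; rewrite pdN ?eg//; exact: df.
- move=> g h Sg [dg Sdg eg] Sh [dh Sdh eh].
  exists (fun x => dg x * h x + g x * dh x).
    by apply: SC_D; apply: SC_M.
  by move=> x Ux; rewrite pdM ?eg ?eh//; exact: df.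
- move=> g Sg [dg Sdg eg] g0.
  exists (fun x => - dg x * ((g x)^-1 * (g x)^-1)).
    by apply: SC_M; [exact: SC_N|apply: SC_M; exact: SC_V].
  by move=> x Ux; rewrite pdV ?eg ?g0//; exact: df.
- move=> g Sg [dg Sdg eg]; exists (fun x => expR (g x) * dg x).
    by apply: SC_M => //; exact: SC_exp.
  by move=> x Ux; rewrite -eg//; apply: pd_comp1; exact: df.
- move=> g Sg [dg Sdg eg] g0; exists (fun x => (g x)^-1 * dg x).
    by apply: SC_M => //; apply: SC_V => // x /g0; rewrite lt_def => /andP[].
  move=> x Ux; rewrite -eg//; apply: pd_comp1; first exact: df.
  by apply: is_derive1_ln; exact: g0.
- move=> g Sg [dg Sdg eg]; exists (fun x => cos (g x) * dg x).
    by apply: SC_M => //; exact: SC_cos.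
  by move=> x Ux; rewrite -eg//; apply: pd_comp1; exact: df.
- move=> g Sg [dg Sdg eg]; exists (fun x => - sin (g x) * dg x).
    by apply: SC_M => //; apply: SC_N; exact: SC_sin.
  by move=> x Ux; rewrite -eg//; apply: pd_comp1; exact: df.
- move=> g Sg [dg Sdg eg]; exists (fun x => (1 + g x * g x)^-1 * dg x).
    apply: SC_M => //; apply: SC_V.
      by apply: SC_D; [exact: SC_cst|exact: SC_M].
    by move=> x _; rewrite lt0r_neq0// ltr_wpDr// -expr2 sqr_ge0.
  move=> x Ux; rewrite -eg// -expr2; apply: pd_comp1; exact: df.
Qed.

Lemma smooth_closureW U f : open U -> smooth_closure U f -> Cinf_on U f.
Proof.
move=> oU; move: f; apply: (Cinf_on_coind oU).
- move=> f Sf x Ux; apply: differentiable_continuous.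
  exact: (smooth_closure_differentiable oU Sf Ux).
- move=> f Sf x i Ux; apply: diff_derivable.
  exact: (smooth_closure_differentiable oU Sf Ux).
- by move=> f Sf i; exact: smooth_closure_pd.
Qed.

End PdRules.

(** * Symmetry of second partial derivatives *)

Section Schwarz.
Variables (R : realType) (n : nat).
Implicit Types (U : set 'rV[R]_n) (f g : 'rV[R]_n -> R) (x v : 'rV[R]_n).

Lemma is_derive_shiftv (V W : normedModType R) (f : V -> W) (a x v : V) :
  derivable f (x + a) v -> is_derive x v (fun z => f (z + a)) ('D_v f (x + a)).
Proof.
move=> df.
have e : (fun h : R => h^-1 *: (((fun z => f (z + a)) \o shift x) (h *: v) - f (x + a)))
  = (fun h : R => h^-1 *: ((f \o shift (x + a)) (h *: v) - f (x + a))).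
  by apply/funext => h /=; rewrite addrA.
by apply: DeriveDef; rewrite ?/derivable ?/derive e.
Qed.

(** The mean value theorem is used twice: in direction [i] on the increment [F], then in direction
    [j] on [pd i f]. The second difference itself is symmetric in [i] and [j], which is what
    [pd_comm] exploits. *)
Lemma second_difference U f x i j (h d : R) :
  Cinf_on U f -> 0 < h -> h + h < d -> (forall y, `|y - x| < d -> U y) ->
  exists2 y, `|y - x| < d &
    f (x + h *: evec R i + h *: evec R j) - f (x + h *: evec R i)
     - (f (x + h *: evec R j) - f x) = h * (h * pd j (pd i f) y).
Proof.
move=> Cf h0 hd Hd.
have ne k (s : R) : `|s| <= h -> `|s *: evec R k| <= h.
  move=> sh; apply: rV_norm_le; first exact: ltW.
  move=> l; rewrite !mxE eqxx /=; have [_|_] := eqVneq l k; first by rewrite mulr1.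
  by rewrite mulr0 normr0 ltW.
have nin (s t : R) : `|s| <= h -> `|t| <= h -> `|x + s *: evec R i + t *: evec R j - x| < d.
  move=> sh th; rewrite -addrA -addrA addrC addrA subrK.
  by apply: le_lt_trans hd; apply: (le_trans (ler_normD _ _)); apply: lerD; apply: ne.
have hh : `|h| <= h by rewrite (ger0_norm (ltW h0)).
have z0 : `|0 : R| <= h by rewrite normr0 ltW.
have e0 (y : 'rV[R]_n) k : y + 0 *: evec R k = y by rewrite scale0r addr0.
have Uin (s t : R) : `|s| <= h -> `|t| <= h -> U (x + s *: evec R i + t *: evec R j).
  by move=> sh th; apply: Hd; exact: nin.
set F := fun z => f (z + h *: evec R j) - f z.
have dF (s : R) : `|s| <= `|h| -> is_derive (x + s *: evec R i) (evec R i) F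
   (pd i f (x + s *: evec R i + h *: evec R j) - pd i f (x + s *: evec R i)).
  rewrite (ger0_norm (ltW h0)) => sh.
  apply: is_deriveB.
    by apply: is_derive_shiftv; exact: (Cf [::] _ (Uin _ _ sh hh)).2.
  apply: derivableP; rewrite -[x + _](e0 _ j).
  exact: (Cf [::] _ (Uin _ _ sh z0)).2.
have [|c ch E] := @MVT_line R _ F x (evec R i) h.
  by move=> s sh; have [] := dF s sh.
have ch' : `|c| <= h by rewrite -(ger0_norm (ltW h0)).
have [|t th E2] := @MVT_line R _ (pd i f) (x + c *: evec R i) (evec R j) h.
  move=> s sh; apply: (Cf [:: i] _ (Uin _ _ ch' _)).2.
  by rewrite -(ger0_norm (ltW h0)).
exists (x + c *: evec R i + t *: evec R j).
  by apply: nin => //; rewrite -(ger0_norm (ltW h0)).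
have [_ D] := dF c ch.
by move: E; rewrite D E2 /F addrAC => ->.
Qed.

Lemma pd_comm U f x i j : open U -> Cinf_on U f -> U x ->
  pd i (pd j f) x = pd j (pd i f) x.
Proof.
move=> oU Cf Ux; set A := LHS; set B := RHS.
apply/eqP; apply/negPn/negP => AB.
(* Both mixed derivatives come within half of their distance to one common value, the second
   difference quotient. *)
set e := `|A - B| / 2.
have e0 : 0 < e by rewrite divr_gt0// normr_gt0 subr_eq0.
have [d1 d10 H1] := (open_normP _).1 oU x Ux.
have [d2 d20 H2] := (cont_atP _ _).1 (Cf [:: i; j] x Ux).1 e e0.
have [d3 d30 H3] := (cont_atP _ _).1 (Cf [:: j; i] x Ux).1 e e0.
set d := Num.min d1 (Num.min d2 d3).
have d0 : 0 < d by rewrite !lt_min d10 d20.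
have h0 : 0 < d / 4 by rewrite divr_gt0.
have hd : d / 4 + d / 4 < d by lra.
have Hd y : `|y - x| < d -> U y by rewrite !lt_min => /andP[/H1].
have [y1 y1x E1] := second_difference i j Cf h0 hd Hd.
have [y2 y2x E2] := second_difference j i Cf h0 hd Hd.
have E : pd j (pd i f) y1 = pd i (pd j f) y2.
  have h1 : d / 4 != 0 by rewrite lt0r_neq0.
  have Exy : x + d / 4 *: evec R j + d / 4 *: evec R i =
             x + d / 4 *: evec R i + d / 4 *: evec R j by exact: addrAC.
  rewrite Exy in E2.
  have sw (a b c e1 : R) : a - b - (c - e1) = a - c - (b - e1) by ring.
  apply: (mulfI h1); apply: (mulfI h1).
  exact: (etrans (esym E1) (etrans (sw _ _ _ _) E2)).
have B1 : `|pd j (pd i f) y1 - B| < e.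
  by apply: H3; move: y1x; rewrite !lt_min => /and3P[].
have B2 : `|pd i (pd j f) y2 - A| < e.
  by apply: H2; move: y2x; rewrite !lt_min => /and3P[].
have key (a b c e' : R) : `|c - b| < e' -> `|c - a| < e' -> `|a - b| < e' + e'.
  move=> cb ca; have -> : a - b = (c - b) - (c - a) by ring.
  by apply: (le_lt_trans (ler_normB _ _)); exact: ltrD.
rewrite E in B1; have := key A B _ e B1 B2.
by rewrite -splitr ltxx.
Qed.

End Schwarz.

(** * The chain rule *)

Section Chain.
Variables (R : realType) (m n : nat).
Implicit Types (f g : 'rV[R]_n -> R).

Lemma rV_differentiable (V : normedModType R) (F : V -> 'rV[R]_n) x :
  (forall k, differentiable (fun y => F y 0 k) x) -> differentiable F x.
Proof.
move=> dF.
have -> : F = \sum_(k < n) (fun y => F y 0 k *: evec R k).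
  apply/funext => y; rewrite {1}[F y]row_sum_delta.
  by rewrite fct_sumE.
apply: differentiable_sum => k.
exact: differentiableZl.
Qed.

Lemma chain_differentiable (U : set 'rV[R]_n) g (chi : 'rV[R]_m -> 'rV[R]_n) y :
  open U -> Cinf_on U g -> U (chi y) ->
  (forall k, differentiable (fun y => chi y 0 k) y) ->
  differentiable (fun y => g (chi y)) y.
Proof.
move=> oU Cg Uy dchi.
have dc := rV_differentiable dchi.
have dg := Cinf_differentiable oU Cg Uy.
exact: differentiable_comp.
Qed.

Lemma pd_chain (U : set 'rV[R]_n) g (chi : 'rV[R]_m -> 'rV[R]_n) y i :
  open U -> Cinf_on U g -> U (chi y) ->
  (forall k, differentiable (fun y => chi y 0 k) y) ->
  pd i (fun y => g (chi y)) y =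
    \sum_k pd i (fun y => chi y 0 k) y * pd k g (chi y).
Proof.
move=> oU Cg Uy dchi.
have dc := rV_differentiable dchi.
have dg := Cinf_differentiable oU Cg Uy.
rewrite /pd (@deriveE _ _ _ (g \o chi)); last exact: differentiable_comp.
rewrite diff_comp// [LHS](Cinf_diffE _ oU Cg Uy).
apply: eq_bigr => k _; congr (_ * _); rewrite -deriveE//.
by rewrite derive_mx ?mxE//; exact: diff_derivable.
Qed.

(** Bootstraps smoothness from first derivatives: if the partials of [chi] are smooth functions
    evaluated at [chi] itself, as happens for an inverse function, then the class of all [g]
    composed with [chi] is stable under [pd], and [Cinf_on_coind] applies without smoothness of
    [chi] being known. *)
Lemma Cinf_comp_pd (O : set 'rV[R]_m) (U : set 'rV[R]_n)
    (chi : 'rV[R]_m -> 'rV[R]_n) (J : 'I_m -> 'I_n -> 'rV[R]_n -> R) :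
  open O -> open U -> (forall y, O y -> U (chi y)) ->
  (forall i k, Cinf_on U (J i k)) ->
  (forall y k, O y -> differentiable (fun y => chi y 0 k) y) ->
  (forall y i k, O y -> pd i (fun y => chi y 0 k) y = J i k (chi y)) ->
  forall g, Cinf_on U g -> Cinf_on O (fun y => g (chi y)).
Proof.
move=> oO oU cU CJ dchi pchi g Cg.
pose P := fun F : 'rV[R]_m -> R => exists2 g, Cinf_on U g & F = fun y => g (chi y).
have dP F y : P F -> O y -> differentiable F y.
  move=> [h Ch ->] Oy.
  exact: (chain_differentiable oU Ch (cU y Oy) (fun k => dchi y k Oy)).
apply: (Cinf_on_coind oO (P := P)); last by exists g.
- by move=> F PF y Oy; apply: differentiable_continuous; exact: dP.
- by move=> F PF y i Oy; apply: diff_derivable; exact: dP.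
move=> F [h Ch ->] i.
exists (fun y => \sum_k J i k (chi y) * pd k h (chi y)).
  exists (fun x => \sum_k J i k x * pd k h x); last reflexivity.
  apply: (smooth_closureW oU); elim: (index_enum _) => [|k r IH].
    rewrite (_ : (fun x => _) = fun=> 0); first exact: SC_cst.
    by apply/funext => x; rewrite big_nil.
  rewrite (_ : (fun x => _) = fun x => J i k x * pd k h x + \sum_(k <- r) J i k x * pd k h x).
    apply: SC_D; last exact: IH.
    apply: SC_M; apply: SC_base; first exact: CJ.
    exact: Cinf_on_pd.
  by apply/funext => x; rewrite big_cons.
move=> y Oy; rewrite (pd_chain i oU Ch (cU y Oy) (fun k => dchi y k Oy)).
by apply: eq_bigr => k _; rewrite pchi.
Qed.

End Chain.

#[local] Opaque Cinf_on pd.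

(** * Smooth functions and derivations along vector fields *)

Section CinfRules.
Variables (R : realType) (n : nat) (U : set 'rV[R]_n).
Hypothesis oU : open U.
Implicit Types (f g : 'rV[R]_n -> R) (x : 'rV[R]_n) (X : 'rV[R]_n -> 'rV[R]_n).

Lemma Cinf_cst c : Cinf_on U (fun=> c : R).
Proof. by apply: smooth_closureW => //; exact: SC_cst. Qed.

Lemma CinfD f g : Cinf_on U f -> Cinf_on U g -> Cinf_on U (fun x => f x + g x).
Proof. by move=> Cf Cg; apply: smooth_closureW => //; apply: SC_D; exact: SC_base. Qed.

Lemma CinfN f : Cinf_on U f -> Cinf_on U (fun x => - f x).
Proof. by move=> Cf; apply: smooth_closureW => //; apply: SC_N; exact: SC_base. Qed.

Lemma CinfM f g : Cinf_on U f -> Cinf_on U g -> Cinf_on U (fun x => f x * g x).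
Proof. by move=> Cf Cg; apply: smooth_closureW => //; apply: SC_M; exact: SC_base. Qed.

Lemma CinfV f : Cinf_on U f -> (forall x, U x -> f x != 0) ->
  Cinf_on U (fun x => (f x)^-1).
Proof. by move=> Cf f0; apply: smooth_closureW => //; apply: SC_V => //; exact: SC_base. Qed.

Lemma Cinf_expR f : Cinf_on U f -> Cinf_on U (fun x => expR (f x)).
Proof. by move=> Cf; apply: smooth_closureW => //; apply: SC_exp; exact: SC_base. Qed.

Lemma Cinf_ln f : Cinf_on U f -> (forall x, U x -> 0 < f x) ->
  Cinf_on U (fun x => ln (f x)).
Proof. by move=> Cf f0; apply: smooth_closureW => //; apply: SC_ln => //; exact: SC_base. Qed.

Lemma Cinf_sin f : Cinf_on U f -> Cinf_on U (fun x => sin (f x)).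
Proof. by move=> Cf; apply: smooth_closureW => //; apply: SC_sin; exact: SC_base. Qed.

Lemma Cinf_cos f : Cinf_on U f -> Cinf_on U (fun x => cos (f x)).
Proof. by move=> Cf; apply: smooth_closureW => //; apply: SC_cos; exact: SC_base. Qed.

Lemma Cinf_atan f : Cinf_on U f -> Cinf_on U (fun x => atan (f x)).
Proof. by move=> Cf; apply: smooth_closureW => //; apply: SC_atan; exact: SC_base. Qed.

Lemma Cinf_sum (I : Type) (r : seq I) (P : pred I) (F : I -> 'rV[R]_n -> R) :
  (forall i, Cinf_on U (F i)) -> Cinf_on U (fun x => \sum_(i <- r | P i) F i x).
Proof.
move=> CF; elim: r => [|k r IH].
  rewrite (_ : (fun x => _) = fun=> 0); first exact: Cinf_cst.
  by apply/funext => x; rewrite big_nil.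
case Pk : (P k).
  rewrite (_ : (fun x => _) = fun x => F k x + \sum_(k <- r | P k) F k x).
    exact (CinfD (CF k) IH).
  by apply/funext => x; rewrite big_cons Pk.
rewrite (_ : (fun x => _) = fun x => \sum_(k <- r | P k) F k x); first exact IH.
by apply/funext => x; rewrite big_cons Pk.
Qed.

Lemma Cinf_prod (I : Type) (r : seq I) (P : pred I) (F : I -> 'rV[R]_n -> R) :
  (forall i, Cinf_on U (F i)) -> Cinf_on U (fun x => \prod_(i <- r | P i) F i x).
Proof.
move=> CF; elim: r => [|k r IH].
  rewrite (_ : (fun x => _) = fun=> 1); first exact: Cinf_cst.
  by apply/funext => x; rewrite big_nil.
case Pk : (P k).
  rewrite (_ : (fun x => _) = fun x => F k x * \prod_(k <- r | P k) F k x).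
    exact (CinfM (CF k) IH).
  by apply/funext => x; rewrite big_cons Pk.
rewrite (_ : (fun x => _) = fun x => \prod_(k <- r | P k) F k x); first exact IH.
by apply/funext => x; rewrite big_cons Pk.
Qed.

Lemma Cinf_det k (A : 'rV[R]_n -> 'M[R]_k) : (forall i j, Cinf_on U (fun x => A x i j)) ->
  Cinf_on U (fun x => \det (A x)).
Proof.
move=> CA; apply: Cinf_sum => s; apply: CinfM; first exact: Cinf_cst.
exact: Cinf_prod.
Qed.

Lemma Cinf_invmx k (A : 'rV[R]_n -> 'M[R]_k) i j :
  (forall i j, Cinf_on U (fun x => A x i j)) ->
  (forall x, U x -> \det (A x) != 0) ->
  Cinf_on U (fun x => invmx (A x) i j).
Proof.
move=> CA dA.
apply: (@Cinf_on_eq _ _ U _ (fun x => (\det (A x))^-1 * cofactor (A x) j i)) => //.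
  by move=> x Ux; rewrite /invmx unitmxE unitfE (dA x Ux) !mxE.
apply: CinfM; first by apply: CinfV dA; exact: Cinf_det.
apply: CinfM; first exact: Cinf_cst.
apply: Cinf_det => a b.
by under eq_fun do rewrite !mxE; exact: CA.
Qed.

Lemma Cinf_coord j : Cinf_on U (fun y => y 0 j : R).
Proof.
pose P := fun f : 'rV[R]_n -> R => f = (fun y => y 0 j) \/ exists c, f = fun=> c.
have dP f x : P f -> differentiable f x.
  by case=> [->|[c ->]]; [exact: differentiable_coord|exact: differentiable_cst].
apply: (Cinf_on_coind oU (P := P)).
- by move=> f Pf x _; apply: differentiable_continuous; exact: dP.
- by move=> f Pf x i _; apply: diff_derivable; exact: dP.
- move=> f [->|[c ->]] i.
    exists (fun=> (i == j)%:R); first by right; exists (i == j)%:R.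
    by move=> x _; exact: pd_coordE.
  exists (fun=> 0); first by right; exists 0.
  by move=> x _; exact: pd_cst.
- by left.
Qed.

(** The coordinate sum replaces ['D_(X x) f], so that the derivation rules follow from those of [pd]
    term by term. *)
Definition Dvec X f x : R := \sum_i X x 0 i * pd i f x.

Lemma Cinf_Dvec X f : Cinf_on U X -> Cinf_on U f -> Cinf_on U (Dvec X f).
Proof.
move=> CX Cf; apply: Cinf_sum => i; apply: CinfM; last exact: Cinf_on_pd.
exact: (Cinf_on_coordP _ oU).1.
Qed.

Lemma Dvec_eq X f g x : (forall x, U x -> f x = g x) -> U x -> Dvec X f x = Dvec X g x.
Proof.
by move=> fg Ux; apply: eq_bigr => i _; congr (_ * _); exact: (pd_open_eq i oU fg).
Qed.

Lemma Dvec_cst X c x : Dvec X (fun=> c) x = 0.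
Proof. by rewrite /Dvec big1// => i _; rewrite pd_cst mulr0. Qed.

Lemma DvecD X f g x : Cinf_on U f -> Cinf_on U g -> U x ->
  Dvec X (fun y => f y + g y) x = Dvec X f x + Dvec X g x.
Proof.
move=> Cf Cg Ux; rewrite /Dvec -big_split /=; apply: eq_bigr => i _.
by rewrite pdD ?mulrDr//; exact: (Cinf_differentiable oU).
Qed.

Lemma DvecN X f x : Cinf_on U f -> U x -> Dvec X (fun y => - f y) x = - Dvec X f x.
Proof.
move=> Cf Ux; rewrite /Dvec -sumrN; apply: eq_bigr => i _.
by rewrite pdN ?mulrN//; exact: (Cinf_differentiable oU).
Qed.

Lemma DvecB X f g x : Cinf_on U f -> Cinf_on U g -> U x ->
  Dvec X (fun y => f y - g y) x = Dvec X f x - Dvec X g x.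
Proof.
move=> Cf Cg Ux.
exact (etrans (DvecD X Cf (CinfN Cg) Ux) (congr1 _ (DvecN X Cg Ux))).
Qed.

Lemma DvecM X f g x : Cinf_on U f -> Cinf_on U g -> U x ->
  Dvec X (fun y => f y * g y) x = Dvec X f x * g x + f x * Dvec X g x.
Proof.
move=> Cf Cg Ux; rewrite /Dvec mulr_suml mulr_sumr -big_split /=.
apply: eq_bigr => i _.
rewrite pdM; [ring | exact: (Cinf_differentiable oU) | exact: (Cinf_differentiable oU)].
Qed.

Lemma Dvec_comp1 (h : R -> R) (dh : R) X f x : Cinf_on U f -> U x ->
  is_derive (f x) 1 h dh -> Dvec X (fun y => h (f y)) x = dh * Dvec X f x.
Proof.
move=> Cf Ux hd; rewrite /Dvec mulr_sumr; apply: eq_bigr => i _.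
rewrite (pd_comp1 i _ hd); first by rewrite mulrCA.
exact: (Cinf_differentiable oU).
Qed.

Lemma DvecV X f x : Cinf_on U f -> (forall x, U x -> f x != 0) -> U x ->
  Dvec X (fun y => (f y)^-1) x = - Dvec X f x * ((f x)^-1 * (f x)^-1).
Proof.
move=> Cf f0 Ux; rewrite /Dvec -sumrN mulr_suml; apply: eq_bigr => i _.
rewrite pdV ?f0//; first by rewrite !mulNr mulrN mulrA.
exact: (Cinf_differentiable oU).
Qed.

Lemma Dvec_sum X (I : Type) (r : seq I) (F : I -> 'rV[R]_n -> R) x :
  (forall i, Cinf_on U (F i)) -> U x ->
  Dvec X (fun y => \sum_(i <- r) F i y) x = \sum_(i <- r) Dvec X (F i) x.
Proof.
move=> CF Ux; rewrite /Dvec exchange_big /=; apply: eq_bigr => i _.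
rewrite (pd_sum _ _ _) ?mulr_sumr// => k.
exact: (Cinf_differentiable oU).
Qed.

(** The second-order terms of the two iterated derivatives agree by [pd_comm]; what survives has the
    components of the Lie bracket as coefficients. *)
Lemma Dvec_commutator X Y f x : Cinf_on U X -> Cinf_on U Y -> Cinf_on U f -> U x ->
  Dvec X (Dvec Y f) x - Dvec Y (Dvec X f) x =
  \sum_k (Dvec X (fun y => Y y 0 k) x - Dvec Y (fun y => X y 0 k) x) * pd k f x.
Proof.
move=> CX CY Cf Ux.
have CX' k : Cinf_on U (fun y => X y 0 k) by exact: (Cinf_on_coordP _ oU).1.
have CY' k : Cinf_on U (fun y => Y y 0 k) by exact: (Cinf_on_coordP _ oU).1.
have E (Z Z' : 'rV[R]_n -> 'rV[R]_n) : (forall k, Cinf_on U (fun y => Z' y 0 k)) ->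
    Dvec Z (Dvec Z' f) x = \sum_k Dvec Z (fun y => Z' y 0 k) x * pd k f x
     + \sum_i \sum_k Z x 0 i * Z' x 0 k * pd i (pd k f) x.
  move=> CZ'; rewrite [Dvec Z' f]/Dvec.
  rewrite (Dvec_sum _ _ (fun i => CinfM (CZ' i) (Cinf_on_pd i Cf)) Ux).
  rewrite [X in _ = _ + X]exchange_big -big_split /=; apply: eq_bigr => k _.
  rewrite (DvecM Z (CZ' k) (Cinf_on_pd k Cf) Ux).
  congr (_ + _); rewrite /Dvec mulr_sumr; apply: eq_bigr => i _.
  by rewrite mulrA [Z' _ _ _ * _]mulrC.
rewrite (E X Y CY') (E Y X CX').
have cancel (a b c d : R) : b = d -> (a + b) - (c + d) = a - c.
  by move=> ->; rewrite opprD addrACA subrr addr0.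
apply: (etrans (cancel _ _ _ _ _)).
  rewrite exchange_big /=; apply: eq_bigr => i _; apply: eq_bigr => k _.
  by rewrite (pd_comm k i oU Cf Ux); congr (_ * _); exact: mulrC.
by rewrite -sumrB; apply: eq_bigr => k _; rewrite mulrBl.
Qed.

End CinfRules.

(** * The inverse function theorem *)

Lemma contraction_rV_fixpoint (R : realType) (n : nat) (K : set 'rV[R]_n) (G : 'rV[R]_n -> 'rV[R]_n) :
  closed K -> K !=set0 -> (forall x, K x -> K (G x)) ->
  (forall x y, K x -> K y -> `|G x - G y| <= 2^-1 * `|x - y|) -> exists2 x, K x & G x = x.
Proof.
move=> cK K0 KG lG.
pose X : completeNormedModType R := HB.pack 'rV[R]_n.
pose Gm := @isFun.Build X X K K G KG.
pose Gf : {fun (K : set X) >-> (K : set X)} := HB.pack (G : X -> X) Gm.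
have ct : is_contraction Gf.
  have h0 : 0 <= 2^-1 :> R by rewrite invr_ge0.
  exists (NngNum h0); split; first by rewrite /= invf_lt1// ltr1n.
  by move=> [x y] [/= Kx Ky]; exact: lG.
have [x Kx E] := @banach_fixed_point R X K Gf ct cK K0.
by exists x.
Qed.

Lemma mulmx_bound (R : realType) (n k : nat) (A : 'M[R]_(n, k)) :
  exists2 M : R, 0 < M & forall v : 'rV[R]_n, `|v *m A| <= M * `|v|.
Proof.
set M := \sum_i \sum_j `|A i j|.
have M0 : 0 <= M by apply: sumr_ge0 => i _; apply: sumr_ge0.
exists (M + 1); first by rewrite ltr_wpDl.
move=> v; apply: rV_norm_le; first by rewrite mulr_ge0// addr_ge0.
move=> j; rewrite mxE; apply: (le_trans (ler_norm_sum _ _ _)).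
apply: (@le_trans _ _ (M * `|v|)); last by rewrite ler_wpM2r// lerDl.
rewrite mulr_suml; apply: ler_sum => i _.
rewrite normrM mulrC; apply: ler_pM => //; last exact: rV_coord_le.
rewrite (bigD1 j)//= lerDl; exact: sumr_ge0.
Qed.

Lemma ball_segment (R : realType) (V : normedModType R) (p x y : V) (r s : R) :
  `|x - p| < r -> `|y - p| < r -> 0 <= s <= 1 -> `|x + s *: (y - x) - p| < r.
Proof.
move=> xr yr /andP[s0 s1].
have -> : x + s *: (y - x) - p = (1 - s) *: (x - p) + s *: (y - p).
  have -> : y - x = (y - p) - (x - p) by rewrite opprB addrA subrK.
  rewrite addrAC scalerBr scalerBl scale1r.
  by rewrite -[RHS]addrA [- _ + _]addrC.
have m0 : `|x - p| <= Num.max `|x - p| `|y - p| by rewrite le_max lexx.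
have m1 : `|y - p| <= Num.max `|x - p| `|y - p| by rewrite le_max lexx orbT.
apply: (@le_lt_trans _ _ (Num.max `|x - p| `|y - p|)); last by rewrite gt_max xr.
apply: (le_trans (ler_normD _ _)); rewrite !normrZ ger0_norm ?subr_ge0// (ger0_norm s0).
have : (1 - s) * `|x - p| <= (1 - s) * Num.max `|x - p| `|y - p|.
  by rewrite ler_wpM2l// subr_ge0.
have : s * `|y - p| <= s * Num.max `|x - p| `|y - p| by rewrite ler_wpM2l.
lra.
Qed.

Lemma MVT_segment_unit (R : realType) (V : normedModType R) (f : V -> R) (x v : V) :
  (forall s : R, 0 <= s <= 1 -> derivable f (x + s *: v) v) ->
  exists2 s : R, 0 <= s <= 1 & f (x + v) - f x = 'D_v f (x + s *: v).
Proof.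
move=> df.
have dg (s : R) : 0 <= s <= 1 -> is_derive s 1 (fun s : R => f (x + s *: v)) ('D_v f (x + s *: v)).
  by move=> s01; apply: is_derive_line; exact: df.
have [|||c c01 E] := @MVT_segment R (fun s => f (x + s *: v)) (fun s => 'D_v f (x + s *: v)) 0 1.
- by [].
- by move=> s s01; apply: dg; move: s01; rewrite in_itv/= => /andP[/ltW-> /ltW->].
- apply: derivable_within_continuous => s; rewrite in_itv/= => s01.
  by have [] := dg s s01.
exists c; first by move: c01; rewrite in_itv.
by move: E; rewrite scale1r scale0r addr0 subr0 mulr1.
Qed.

Section InverseFunction.
Variables (R : realType) (n : nat) (B : set 'rV[R]_n) (psi : 'rV[R]_n -> 'rV[R]_n).
Variable p : 'rV[R]_n.
Hypotheses (oB : open B) (Bp : B p) (Cpsi : Cinf_on B psi).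

(** Rows are directions and columns are components, the transpose of the usual convention, so that
    the differential acts on row vectors by right multiplication. *)
Definition Jac x : 'M[R]_n := \matrix_(i, k) pd i (fun y => psi y 0 k) x.

Hypothesis detJ : forall x, B x -> \det (Jac x) != 0.

Let psik k := fun y => psi y 0 k.
Let Cpsik k : Cinf_on B (psik k) := (Cinf_on_coordP psi oB).1 Cpsi k.

Let CJ i j : Cinf_on B (fun x => Jac x i j).
Proof.
under eq_fun do rewrite mxE.
exact (Cinf_on_pd i (Cpsik j)).
Qed.

Let uJ x : B x -> Jac x \in unitmx.
Proof. by move=> Bx; rewrite unitmxE unitfE detJ. Qed.

Let A := invmx (Jac p).
(* Near [p], [F] is a contraction, and the fixed points of [x |-> F x + y *m A]
are the solutions of [psi x = y]. *)
Let F x := x - psi x *m A.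

(** The choice of [A] makes all partial derivatives of [F] vanish at [p]; they stay small nearby,
    and the mean value theorem along a segment turns this into a Lipschitz bound. *)
Let near_identity : exists2 r, 0 < r & forall x y, `|x - p| < r -> `|y - p| < r ->
  B x /\ `|F x - F y| <= 2^-1 * `|x - y|.
Proof.
pose Fj j := fun x : 'rV[R]_n => x 0 j - \sum_k psi x 0 k * A k j.
have Cu j k : Cinf_on B (fun x => psi x 0 k * A k j).
  exact (CinfM oB (Cpsik k) (Cinf_cst oB _)).
have CF j : Cinf_on B (Fj j).
  apply: (CinfD oB (Cinf_coord oB j)); apply: (CinfN oB).
  exact (Cinf_sum oB _ _ (Cu j)).
have dF0 i j : pd i (Fj j) p = 0.
  rewrite /Fj pdD; first last.
  - apply: (Cinf_differentiable oB _ Bp); apply: (CinfN oB).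
    exact (Cinf_sum oB _ _ (Cu j)).
  - exact (Cinf_differentiable oB (Cinf_coord oB j) Bp).
  rewrite pd_coordE pdN; last first.
    exact (Cinf_differentiable oB (Cinf_sum oB _ _ (Cu j)) Bp).
  have dC k := Cinf_differentiable oB (Cu j k) Bp.
  rewrite (pd_sum _ _ dC).
  have -> : (i == j)%:R = (Jac p *m A) i j by rewrite mulmxV ?uJ// mxE.
  rewrite mxE; apply/eqP; rewrite subr_eq0; apply/eqP; apply: eq_bigr => k _.
  rewrite pdM; [|exact (Cinf_differentiable oB (Cpsik k) Bp)|exact: differentiable_cst].
  by rewrite pd_cst mulr0 addr0 mxE.
(* The [n] partial derivatives, each of size at most [e], add up to a Lipschitz constant of at most
   [1/2]. *)
set e : R := (2 * n.+1%:R)^-1.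
have e0 : 0 < e by rewrite invr_gt0 mulr_gt0// ltr0Sn.
have [d1 d10 H1] := (open_normP _).1 oB p Bp.
have [d2 d20 H2] := near_forall (fun ij : 'I_n * 'I_n =>
   (cont_atP _ _).1 (CF ij.2 [:: ij.1] p Bp).1 e e0).
exists (Num.min d1 d2) => [|x y]; first by rewrite lt_min d10.
rewrite !lt_min => /andP[x1 x2] /andP[y1 y2]; split; first exact: H1.
apply: rV_norm_le => [|j]; first by rewrite mulr_ge0.
have FE z : F z 0 j = Fj j z by rewrite !mxE.
have -> : (F x - F y) 0 j = Fj j x - Fj j y by rewrite -!FE [LHS]mxE [X in _ + X]mxE.
have [s s01 E] : exists2 s : R, 0 <= s <= 1 &
    Fj j (y + (x - y)) - Fj j y = 'D_(x - y) (Fj j) (y + s *: (x - y)).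
  apply: MVT_segment_unit => s s01; apply: diff_derivable.
  apply: (Cinf_differentiable oB (CF j)).
  exact (H1 _ (ball_segment y1 x1 s01)).
rewrite subrKC in E; rewrite E.
rewrite (Cinf_deriveE _ oB (CF j) (H1 _ (ball_segment y1 x1 s01))).
apply: (le_trans (ler_norm_sum _ _ _)).
apply: (@le_trans _ _ (\sum_(i < n) `|x - y| * e)).
  apply: ler_sum => i _; rewrite normrM; apply: ler_pM => //; first exact: rV_coord_le.
  have := H2 _ (ball_segment y2 x2 s01) (i, j).
  by rewrite [X in `|_ - X|]dF0 subr0 => /ltW.
rewrite sumr_const card_ord -[leLHS]mulr_natr -mulrA mulrC ler_wpM2r//.
rewrite /e invfM -mulrA ger_pMr ?invr_gt0//.
by rewrite mulrC ler_pdivrMr ?ltr0Sn// mul1r ler_nat.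
Qed.

(** The contraction estimate that produces solutions of [psi x = y] also makes them unique and
    Lipschitz in [y]; inverting the first-order expansion of [psi] then differentiates [chi]. The
    partials are stated in the shape that [Cinf_comp_pd] needs to reach smoothness. *)
Theorem inverse_function : exists (r : R) (chi : 'rV[R]_n -> 'rV[R]_n),
  let O := [set y | `|y - psi p| < r] in
  [/\ 0 < r, open (chi @` O) & chi (psi p) = p] /\
  [/\
      (forall y, O y -> B (chi y) /\ psi (chi y) = y),
      (forall y k, O y -> differentiable (fun y => chi y 0 k) y) &
      (forall y i k, O y -> pd i (fun y => chi y 0 k) y = invmx (Jac (chi y)) i k)].
Proof.
have [r1 r10 Hr] := near_identity.
set rho := r1 / 2.
have rho0 : 0 < rho by rewrite divr_gt0.
have rhor : rho < r1 by rewrite /rho; lra.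
have [MA MA0 HA] := mulmx_bound A.
(* For [y] in this ball the shift by [y - psi p] moves points by less than [rho / 2]; the
   contraction contributes at most another [rho / 2], so the closed [rho]-ball is mapped into
   itself. *)
set r := rho / (2 * MA).
have r0 : 0 < r by rewrite divr_gt0// mulr_gt0.
have pp (e : R) : 0 < e -> `|p - p| < e by rewrite subrr normr0.
(* Away from the ball around [psi p] the value is the dummy [p], which makes the statement total for
   [choice]. *)
have sol y : exists x, `|y - psi p| < r -> `|x - p| < rho /\ psi x = y.
  have [yr|] := boolP (`|y - psi p| < r); last by exists p.
  pose G x := F x + y *m A.
  pose K := closed_ball_ (fun x : 'rV[R]_n => `|x|) p rho.
  have KE x : K x = (`|x - p| <= rho) :> Prop by rewrite /K /closed_ball_ /= distrC.
  have rE : MA^-1 * (rho / 2) = r by rewrite /r; field; rewrite lt0r_neq0.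
  have yA : `|(y - psi p) *m A| < rho / 2.
    by apply: (le_lt_trans (HA _)); rewrite -ltr_pdivlMl// rE.
  have Gp x : K x -> `|G x - p| < rho.
    rewrite KE => Kx.
    have -> : G x - p = F x - F p + (y - psi p) *m A.
      by rewrite mulmxBl opprB -[RHS]addrA -[LHS]addrA; congr (_ + _);
        rewrite [RHS]addrC addrA subrK.
    apply: (le_lt_trans (ler_normD _ _)).
    rewrite [ltRHS]splitr; apply: ler_ltD => //.
    apply: (le_trans (Hr _ _ (le_lt_trans Kx rhor) (pp _ r10)).2).
    by rewrite mulrC ler_wpM2r// invr_ge0.
  have cK : closed K by exact: closed_closed_ball_.
  have K0 : K !=set0 by exists p; rewrite KE subrr normr0 ltW.
  have KG z : K z -> K (G z) by move=> /Gp /ltW; rewrite KE.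
  have lG (a b : 'rV[R]_n) : K a -> K b -> `|G a - G b| <= 2^-1 * `|a - b|.
    rewrite !KE => Ka Kb.
    have -> : G a - G b = F a - F b by rewrite /G opprD addrACA subrr addr0.
    by apply: (Hr _ _ _ _).2; apply: le_lt_trans rhor.
  have [x Kx Gx] := contraction_rV_fixpoint cK K0 KG lG.
  exists x => _; split; first by rewrite -Gx; exact: Gp.
  apply/eqP; rewrite -subr_eq0.
  have : (y - psi x) *m A = 0.
    move: Gx; rewrite /G /F -addrA => /eqP; rewrite addrC -subr_eq0 addrK.
    by rewrite addrC -mulmxBl => /eqP.
  move/(congr1 (mulmx ^~ (Jac p))); rewrite mul0mx mulmxKV ?uJ//.
  by move=> /subr0_eq ->; rewrite subrr.
have [chi Hchi] := choice sol.
(* As [x = F x + psi x *m A] and [F] has Lipschitz constant [1/2], half of [|x - x'|] is absorbed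
   into the left-hand side. *)
have inj (x x' : 'rV[R]_n) : `|x - p| < rho -> `|x' - p| < rho ->
    `|x - x'| <= 2 * (MA * `|psi x - psi x'|).
  move=> xr xr'.
  have [_ H] := Hr _ _ (lt_trans xr rhor) (lt_trans xr' rhor).
  have := HA (psi x - psi x').
  have : `|x - x'| <= `|F x - F x'| + `|(psi x - psi x') *m A|.
    have -> : x - x' = (F x - F x') + (psi x - psi x') *m A.
      by rewrite /F mulmxBl opprB -addrA [_ - x' + _]addrC [_ - psi x' *m A + _]addrA subrK addrA subrK.
    exact: ler_normD.
  lra.
have pO : `|psi p - psi p| < r by rewrite subrr normr0.
exists r, chi => O.
have OB y : O y -> B (chi y).
  move=> Oy; have [cy _] := Hchi y Oy.
  exact: (Hr _ _ (lt_trans cy rhor) (pp _ r10)).1.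
have chipsi x : `|x - p| < rho -> O (psi x) -> chi (psi x) = x.
  move=> xr Ox; have [cy E] := Hchi _ Ox.
  have := inj _ _ cy xr; rewrite E subrr normr0 !mulr0 normr_le0 subr_eq0.
  by move/eqP.
have rB x : `|x - p| < rho -> B x.
  by move=> xr; exact: (Hr _ _ (lt_trans xr rhor) (pp _ r10)).1.
(* The image is cut out by open conditions on [x], so its openness reduces to continuity of
   [psi]. *)
have imE : chi @` O = [set x | `|x - p| < rho /\ O (psi x)].
  apply/seteqP; split=> [_ [y Oy <-]|x /= [xr Ox]].
    by have [cy E] := Hchi y Oy; rewrite /= E.
  by exists (psi x) => //; exact: chipsi.
have cpsi x : B x -> forall e : R, 0 < e ->
    exists2 d : R, 0 < d & forall y, `|y - x| < d -> `|psi y - psi x| < e.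
  by move=> Bx; exact ((cont_atP psi x).1 (Cpsi [::] Bx).1).
have oim : open (chi @` O).
  rewrite imE; apply/open_normP => x /= [xr Ox].
  have rx : 0 < r - `|psi x - psi p| by rewrite subr_gt0.
  have [d d0 Hd] := cpsi x (rB x xr) _ rx.
  exists (Num.min d (rho - `|x - p|)); first by rewrite lt_min d0 subr_gt0.
  move=> z; rewrite lt_min => /andP[/Hd zd zr]; split.
    rewrite -(subrKA x) addrC; apply: (le_lt_trans (ler_normD _ _)); lra.
  rewrite /O /= -(subrKA (psi x)) addrC; apply: (le_lt_trans (ler_normD _ _)); lra.
have oO : open O.
  apply/open_normP => y /= yr; exists (r - `|y - psi p|); first by rewrite subr_gt0.
  move=> z zr; rewrite /O /= -(subrKA y) addrC; apply: (le_lt_trans (ler_normD _ _)); lra.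
have lip y y' : O y -> O y' -> `|chi y - chi y'| <= 2 * (MA * `|y - y'|).
  move=> Oy Oy'; have [cy E] := Hchi y Oy; have [cy' E'] := Hchi y' Oy'.
  by have := inj _ _ cy cy'; rewrite E E'.
have dchi y k : O y -> differentiable (fun y => chi y 0 k) y /\
    forall v, 'd (fun y => chi y 0 k) y v = (v *m invmx (Jac (chi y))) 0 k.
  move=> Oy; have Bc := OB y Oy; set x := chi y in Bc *.
  set Q := invmx (Jac x).
  have [MQ MQ0 HQ] := mulmx_bound Q.
  have lin : linear (fun h : 'rV[R]_n => (h *m Q) 0 k).
    by move=> a u v; rewrite mulmxDl -scalemxAl !mxE.
  pose Lm := GRing.isLinear.Build _ _ _ _ _ lin.
  pose L : {linear 'rV[R]_n -> R} := HB.pack (fun h : 'rV[R]_n => (h *m Q) 0 k) Lm.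
  have cL : continuous L.
    apply: (@linear_bound_continuous _ _ _ L MQ); first exact: ltW.
    by move=> h; apply: (le_trans _ (HQ h)); exact: rV_coord_le.
  have est (e : R) : 0 < e -> exists2 d : R, 0 < d & forall h, `|h| < d ->
      `|chi (y + h) 0 k - chi y 0 k - L h| <= e * `|h|.
    (* Scaled so that the bound [MQ] on the inverse Jacobian and the Lipschitz constant [2 * MA] of
       [chi] restore exactly [e]. *)
    move=> e0; set e1 := e / (MQ * (2 * MA)).
    have e10 : 0 < e1 by rewrite divr_gt0// mulr_gt0// mulr_gt0.
    have C1 j : exists2 d : R, 0 < d & forall h, `|h - 0| < d ->
       `|psi (x + h) 0 j - psi x 0 j - (h *m Jac x) 0 j| <= e1 * `|h|.
      have [d d0 Hd] := C1_estimate oB Bc (fun z i Bz => (Cpsik j [::] Bz).2 i)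
        (fun i => (Cpsik j [:: i] Bc).1) e10.
      exists d => // h; rewrite subr0 => /Hd; congr (`|_ - _| <= _).
      by rewrite mxE; apply: eq_bigr => i _; rewrite mxE.
    have [d1 d10 H1] := near_forall C1.
    have [d2 d20 H2] := (open_normP _).1 oO y Oy.
    exists (Num.min d2 (d1 / (2 * MA))) => [|h].
      by rewrite lt_min d20 divr_gt0// mulr_gt0.
    rewrite lt_min => /andP[h2]; rewrite ltr_pdivlMr ?mulr_gt0// => h1.
    have Oh : O (y + h) by apply: H2; rewrite addrAC subrr add0r.
    set dl := chi (y + h) - x.
    have dlh : `|dl| <= 2 * MA * `|h|.
      by have := lip _ _ Oh Oy; rewrite (_ : y + h - y = h) ?mulrA// addrAC subrr add0r.
    have {H1}H1 : `|h - dl *m Jac x| <= e1 * `|dl|.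
      apply: rV_norm_le; first by rewrite mulr_ge0// ltW.
      have dld : `|dl - 0| < d1 by rewrite subr0; apply: (le_lt_trans dlh); rewrite mulrC.
      move=> j; have := H1 dl dld j.
      have -> : x + dl = chi (y + h) by rewrite /dl addrC subrK.
      rewrite (Hchi _ Oh).2 (Hchi _ Oy).2 => H.
      have -> : (h - dl *m Jac x) 0 j = (y + h) 0 j - y 0 j - (dl *m Jac x) 0 j.
        by rewrite [LHS]mxE [X in _ + X]mxE [(y + h) 0 j]mxE [y 0 j + _]addrC addrK.
      exact: H.
    have -> : chi (y + h) 0 k - chi y 0 k - L h = - ((h - dl *m Jac x) *m Q) 0 k.
      rewrite mulmxBl mulmxK ?uJ//.
      have -> : (h *m Q - dl) 0 k = (h *m Q) 0 k - dl 0 k.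
        by rewrite [LHS]mxE [X in _ + X]mxE.
      have -> : dl 0 k = chi (y + h) 0 k - chi y 0 k by rewrite [LHS]mxE [X in _ + X]mxE.
      have ab (a b c : R) : a - b - c = - (c - (a - b)) by ring.
      exact: ab.
    rewrite normrN; apply: (le_trans (rV_coord_le _ _)); apply: (le_trans (HQ _)).
    have -> : e * `|h| = MQ * (e1 * (2 * MA * `|h|)).
      rewrite /e1; field; by rewrite !lt0r_neq0.
    apply: ler_wpM2l; first exact: ltW.
    apply: (le_trans H1); apply: ler_wpM2l => //; exact: ltW.
  have [D E] := @estimate_differentiable R 'rV[R]_n R (fun y => chi y 0 k) L y cL est.
  by split=> // v; rewrite E.
split.
  by split=> //; exact: (chipsi p (pp _ rho0) pO).
split.
- by move=> y Oy; split; [exact: OB|exact: (Hchi y Oy).2].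
- by move=> y k Oy; exact: (dchi y k Oy).1.
- move=> y i k Oy; rewrite pd_diffE; last exact: (dchi y k Oy).1.
  by rewrite (dchi y k Oy).2 -rowE mxE.
Qed.

End InverseFunction.

(** * The Poincare lemma *)

Definition integral01 (R : realType) (f : R -> R) : R :=
  Rintegral (@lebesgue_measure R) `[0%R, 1%R] f.

(** Domination by the constant [C] permits differentiation under the integral sign; as [df 0] has
    the primitive [P], the fundamental theorem of calculus evaluates the outcome. *)
Lemma is_derive_integral01 (R : realType) (f df : R -> R -> R) (P : R -> R) (d C : R) :
  0 < d -> 0 <= C ->
  (forall h s : R, `|h| < d -> 0 <= s <= 1 -> is_derive h 1 (f ^~ s) (df h s)) ->
  (forall h s : R, `|h| < d -> 0 <= s <= 1 -> derivable (f h) s 1) ->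
  (forall h s : R, `|h| < d -> 0 <= s <= 1 -> `|df h s| <= C) ->
  (forall s : R, 0 <= s <= 1 -> is_derive s 1 P (df 0 s)) ->
  (forall s : R, 0 <= s <= 1 -> derivable (df 0) s 1) ->
  is_derive (0 : R) 1 (fun h => integral01 (f h)) (P 1 - P 0).
Proof.
move=> d0 C0 Hdf Hf HC HP Hdf0.
have cmp : compact (`[0%R, 1%R] : set R) by exact: segment_compact.
have mB : measurable (`[0%R, 1%R]%classic : set (measurableTypeR R)) by [].
have I0 : `]-d, d[%classic 0 by rewrite /= in_itv /= oppr_lt0 d0.
have Id (h : R) : `]-d, d[%classic h -> `|h| < d by rewrite /= in_itv /= ltr_norml.
have Is (s : R) : `[0%R, 1%R]%classic s -> 0 <= s <= 1 by rewrite /= in_itv.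
have cont (g : R -> R) : (forall s : R, 0 <= s <= 1 -> derivable g s 1) ->
    {within `[0%R, 1%R], continuous g}.
  by move=> Hg; apply: derivable_within_continuous => s; rewrite in_itv => /Hg.
have intf h : `]-d, d[%classic h ->
    (@lebesgue_measure R).-integrable `[0%R, 1%R] (EFin \o f h).
  move=> /Id hd; apply: continuous_compact_integrable => //.
  by apply: cont => s; exact: Hf.
have intC : (@lebesgue_measure R).-integrable `[0%R, 1%R] (EFin \o (fun=> C)).
  apply: continuous_compact_integrable => //; apply: cont => s _.
  exact: derivable_cst.
have derf h s : `]-d, d[%classic h -> `[0%R, 1%R]%classic s -> derivable (f ^~ s) h 1.
  by move=> /Id hd /Is s01; have [] := Hdf h s hd s01.
have d1E h s : `|h| < d -> 0 <= s <= 1 -> partial1of2 f h s = df h s.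
  by move=> hd s01; rewrite partial1of2E; have [_ ->] := Hdf h s hd s01.
have bd h s : `]-d, d[%classic h -> `[0%R, 1%R]%classic s -> `|partial1of2 f h s| <= C.
  by move=> /Id hd /Is s01; rewrite d1E//; exact: HC.
have D := @derivable_under_integral R _ _ (@lebesgue_measure R) f _ mB 0 (-d) d I0 intf derf
  (fun=> C) (fun=> C0) intC bd.
have E := @differentiation_under_integral R _ _ (@lebesgue_measure R) f _ mB 0 (-d) d I0 intf derf
  (fun=> C) (fun=> C0) intC bd.
apply: DeriveDef; first exact: D.
rewrite -derive1E; apply: (etrans E).
have d00 : `|0 : R| < d by rewrite normr0.
rewrite /Rintegral.
have P1 (s : R) : 0 <= s <= 1 -> {for s, continuous P}.
  move=> s01; apply: differentiable_continuous; apply/derivable1_diffP.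
  by have [] := HP s s01.
have F2 := @continuous_FTC2 R (df 0) P 0 1 ltr01 (cont _ Hdf0).
rewrite (_ : integral _ _ _ = ((P 1)%:E - (P 0)%:E)%E) ?fineB//.
rewrite -F2.
- apply: eq_integral => s; rewrite inE => /Is s01; by rewrite d1E.
- split.
  + move=> s; rewrite in_itv => /andP[s0 s1]; have [] := HP s _ => //.
    by rewrite !ltW.
  + by apply: cvg_at_right_filter; apply: P1; rewrite lexx ler01.
  + by apply: cvg_at_left_filter; apply: P1; rewrite lexx ler01.
- move=> s; rewrite in_itv => /andP[s0 s1]; rewrite derive1E.
  by have [|_ ->] := HP s _; rewrite ?ltW.
Qed.

Section Poincare.
Variables (R : realType) (n : nat) (p : 'rV[R]_n) (r : R).
Let B := [set x | `|x - p| < r].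

Lemma open_normball : open B.
Proof.
apply/open_normP => y /= yr; exists (r - `|y - p|); first by rewrite subr_gt0.
move=> z zr; rewrite /B /= -(subrKA y) addrC.
apply: (le_lt_trans (ler_normD _ _)); lra.
Qed.

Let oB := open_normball.

(** Closed balls are compact in finite dimension. The bound serves as dominating constant for
    differentiation under the integral. *)
Lemma Cinf_bounded (f : 'rV[R]_n -> R) r' : Cinf_on B f -> 0 <= r' < r ->
  exists2 M : R, 0 <= M & forall y, `|y - p| <= r' -> `|f y| <= M.
Proof.
move=> Cf /andP[r'0 r'r].
pose K := closed_ball_ (fun x : 'rV[R]_n => `|x|) p r'.
have KE x : K x = (`|x - p| <= r') :> Prop by rewrite /K /closed_ball_ /= distrC.
have cK : compact K.
  apply: bounded_closed_compact; last exact: closed_closed_ball_.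
  exists (`|p| + r'); split; first by rewrite realE addr_ge0.
  move=> M HM y; rewrite KE => Ky.
  have -> : y = (y - p) + p by rewrite subrK.
  by apply: (le_trans (ler_normD _ _)); lra.
have K0 : K !=set0 by exists p; rewrite KE subrr normr0.
have cf : {within K, continuous (fun y => `|f y|)}.
  apply: continuous_in_subspaceT => y; rewrite inE KE => Ky.
  have By : B y by rewrite /B /=; exact: le_lt_trans r'r.
  apply: (@continuous_comp _ _ _ f (fun z : R => `|z|)).
    exact: (differentiable_continuous (Cinf_differentiable oB Cf By)).
  exact: norm_continuous.
have [c _ Hc] := EVT_max_rV K0 cK cf.
exists `|f c| => // y yr; apply: Hc.
by rewrite inE KE.
Qed.

Lemma derivable_sumf (I : finType) (F : I -> R -> R) (s : R) :
  (forall i, derivable (F i) s 1) -> derivable (fun s => \sum_i F i s) s 1.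
Proof.
move=> dF; apply/derivable1_diffP.
elim: (index_enum I) => [|i l IH].
  rewrite (_ : (fun s => _) = cst 0); first exact: differentiable_cst.
  by apply/funext => y; rewrite big_nil.
rewrite (_ : (fun s => _) = fun s => F i s + \sum_(i <- l) F i s).
  apply: differentiableD IH; exact/derivable1_diffP.
by apply/funext => y; rewrite big_cons.
Qed.

(* The primitive is the integral of the form along the segment from [p] to [z]. *)
Theorem poincare (th : 'I_n -> 'rV[R]_n -> R) :
  (forall i, Cinf_on B (th i)) ->
  (forall x i j, B x -> pd i (th j) x = pd j (th i) x) ->
  exists2 F : 'rV[R]_n -> R, Cinf_on B F & forall x i, B x -> pd i F x = th i x.
Proof.
move=> Cth cl.
pose c (s : R) (z : 'rV[R]_n) := p + s *: (z - p).
pose q s z := \sum_i th i (c s z) * (z 0 i - p 0 i).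
pose F z := integral01 (fun s => q s z).
(* The derivative of the integrand [q s] in direction [j]; the leading factor [s] is the derivative
   of [c s z] in [z]. *)
pose dq j s z := s * \sum_i pd j (th i) (c s z) * (z 0 i - p 0 i) + th j (c s z).
have cB s z r' : 0 <= s <= 1 -> `|z - p| <= r' -> `|c s z - p| <= r'.
  move=> /andP[s0 s1] zr; rewrite /c addrAC subrr add0r normrZ ger0_norm//.
  by apply: (le_trans _ zr); rewrite ler_piMl.
have Bc s z : 0 <= s <= 1 -> B z -> B (c s z).
  by move=> s01 Bz; apply: (le_lt_trans (cB s z _ s01 (lexx _))).
have dc s k y : differentiable (fun y => c s y 0 k) y /\
    forall i, pd i (fun y => c s y 0 k) y = s * (i == k)%:R.
  have -> : (fun y => c s y 0 k) = (fun y => p 0 k + s * (y 0 k - p 0 k)).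
    by apply/funext => z; rewrite !mxE.
  have d1 : differentiable (fun y : 'rV[R]_n => y 0 k - p 0 k) y.
    by apply: differentiableB; [exact: differentiable_coord|exact: differentiable_cst].
  have d2 : differentiable (fun y : 'rV[R]_n => s * (y 0 k - p 0 k)) y.
    by apply: differentiableM => //; exact: differentiable_cst.
  have d3 : differentiable (fun y : 'rV[R]_n => p 0 k + s * (y 0 k - p 0 k)) y.
    by apply: differentiableD => //; exact: differentiable_cst.
  split=> // i.
  have dk (a : R) : differentiable (fun _ : 'rV[R]_n => a) y by exact: differentiable_cst.
  rewrite (pdD i (dk _) d2) (pdM i (dk s) d1).
  rewrite (pdD i (differentiable_coord y 0 k : differentiable (fun y : 'rV[R]_n => y 0 k) y) (dk (- p 0 k))).
  by rewrite !pd_cst pd_coordE add0r mul0r add0r addr0.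
have dth s z i : 0 <= s <= 1 -> B z ->
    differentiable (fun z => th i (c s z)) z /\
    forall j, pd j (fun z => th i (c s z)) z = s * pd j (th i) (c s z).
  move=> s01 Bz; split.
    exact: (chain_differentiable oB (Cth i) (Bc s z s01 Bz) (fun k => (dc s k z).1)).
  move=> j; rewrite (pd_chain j oB (Cth i) (Bc s z s01 Bz) (fun k => (dc s k z).1)).
  rewrite (bigD1 j)//= (dc s j z).2 eqxx mulr1 big1 ?addr0// => k kj.
  by rewrite (dc s k z).2 eq_sym (negbTE kj) mulr0 mul0r.
have dzp i z : differentiable (fun z : 'rV[R]_n => z 0 i - p 0 i) z /\
    forall j, pd j (fun z : 'rV[R]_n => z 0 i - p 0 i) z = (j == i)%:R.
  split; first by apply: differentiableB; [exact: differentiable_coord|exact: differentiable_cst].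
  move=> j; rewrite (@pdD _ _ j (fun y => y 0 i) (fun=> - p 0 i)).
  - by rewrite pd_cst addr0 pd_coordE.
  - exact: differentiable_coord.
  - exact: differentiable_cst.
have dqs s z : 0 <= s <= 1 -> B z -> differentiable (q s) z /\
    forall j, pd j (q s) z = dq j s z.
  move=> s01 Bz.
  have dt i : differentiable (fun z => th i (c s z) * (z 0 i - p 0 i)) z.
    by apply: differentiableM; [exact: (dth s z i s01 Bz).1|exact: (dzp i z).1].
  have [D E] : differentiable (q s) z /\ forall j, pd j (q s) z =
      \sum_i pd j (fun z => th i (c s z) * (z 0 i - p 0 i)) z.
    split=> [|j]; rewrite /q; [exact: differentiable_sumf|exact: pd_sum].
  split=> // j; rewrite E /dq mulr_sumr.
  have -> : th j (c s z) = \sum_i th i (c s z) * (j == i)%:R.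
    rewrite (bigD1 j)//= eqxx mulr1 big1 ?addr0// => k kj.
    by rewrite eq_sym (negbTE kj) mulr0.
  rewrite -big_split /=; apply: eq_bigr => i _.
  rewrite pdM; [|exact: (dth s z i s01 Bz).1|exact: (dzp i z).1].
  by rewrite (dth s z i s01 Bz).2 (dzp i z).2 mulrA.
have dFx x j : B x -> is_derive x (evec R j) F (th j x).
  move=> Bx.
  (* Half the distance to the boundary: displacements below [d] stay in a closed ball of radius
     [r' < r], on which the form and its derivatives are bounded. *)
  set d := (r - `|x - p|) / 2; set r' := `|x - p| + d.
  have xr : `|x - p| < r by [].
  have d0 : 0 < d by rewrite divr_gt0// subr_gt0.
  have r'r : 0 <= r' < r.
    by rewrite addr_ge0//= ?ltW// /r' /d; lra.
  have zr (h : R) : `|h| < d -> `|x + h *: evec R j - p| <= r'.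
    move=> hd; rewrite addrAC; apply: (le_trans (ler_normD _ _)).
    rewrite lerD2l; apply: le_trans (ltW hd).
    apply: rV_norm_le => // k; rewrite !mxE eqxx /=.
    by case: eqVneq => _; rewrite ?mulr1// mulr0 normr0.
  have zB (h : R) : `|h| < d -> B (x + h *: evec R j).
    by move=> /zr H; rewrite /B /=; apply: (le_lt_trans H); case/andP: r'r.
  have bM i : exists M : R, 0 <= M /\ forall y, `|y - p| <= r' -> `|th i y| <= M.
    by have [M M0 H] := Cinf_bounded (Cth i) r'r; exists M.
  have [M HM] := choice bM.
  have bN i : exists M : R, 0 <= M /\ forall y, `|y - p| <= r' -> `|pd j (th i) y| <= M.
    by have [N N0 H] := Cinf_bounded (Cinf_on_pd j (Cth i)) r'r; exists N.
  have [N HN] := choice bN.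
  set C := \sum_i N i * r' + M j.
  have r'0 : 0 <= r' by case/andP: r'r.
  have C0 : 0 <= C.
    apply: addr_ge0; last exact: (HM j).1.
    by apply: sumr_ge0 => i _; rewrite mulr_ge0//; exact: (HN i).1.
  have line (g : 'rV[R]_n -> R) (s : R) z : Cinf_on B g -> 0 <= s <= 1 -> B z ->
      is_derive s 1 (fun s => g (c s z)) ('D_(z - p) g (c s z)).
    move=> Cg s01 Bz; apply: is_derive_line; apply: diff_derivable.
    exact (Cinf_differentiable oB Cg (Bc s z s01 Bz)).
  have linet (h s : R) i : `|h| < d -> 0 <= s <= 1 ->
      derivable (fun s => th i (c s (x + h *: evec R j))) s 1.
    by move=> hd s01; have [] := line _ s _ (Cth i) s01 (zB h hd).
  (* Closedness swaps the two indices in [dq], which thereby becomes the derivative of [P] in [s];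
     the values at 1 and 0 differ by [th j x]. *)
  pose P (s : R) := s * th j (c s x).
  have -> : th j x = P 1 - P 0 by rewrite /P mul0r subr0 mul1r /c scale1r addrC subrK.
  apply: is_derive_along; apply: (@is_derive_integral01 R (fun h s => q s (x + h *: evec R j))
      (fun h s => dq j s (x + h *: evec R j)) P d C d0 C0).
  - move=> h s hd s01; have [D E] := dqs s _ s01 (zB h hd).
    rewrite -E -derive_pdE; apply: is_derive_line; exact: diff_derivable.
  - move=> h s hd s01; apply: derivable_sumf => i.
    by apply: derivableM; [exact: linet|exact: derivable_cst].
  - move=> h s hd s01; have cz := cB s _ _ s01 (zr h hd).
    rewrite /dq; apply: (le_trans (ler_normD _ _)); apply: lerD; last exact: (HM j).2.
    have /andP[s0 s1] := s01.
    rewrite normrM ger0_norm//; apply: (@le_trans _ _ (1 * \sum_i N i * r')); last by rewrite mul1r.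
    apply: ler_pM => //; apply: (le_trans (ler_norm_sum _ _ _)).
    apply: ler_sum => i _; rewrite normrM; apply: ler_pM => //; first exact: (HN i).2.
    apply: le_trans (zr h hd).
    rewrite (_ : _ - _ = (x + h *: evec R j - p) 0 i); first exact: rV_coord_le.
    by rewrite [RHS]mxE [X in _ = _ + X]mxE.
  - move=> s s01; rewrite scale0r addr0.
    apply: (is_derive_eq (is_deriveM (is_derive_id s 1) (line _ s x (Cth j) s01 Bx))).
    rewrite (Cinf_deriveE _ oB (Cth j) (Bc s x s01 Bx)) /dq.
    congr (_ + _); last by rewrite [LHS]mulr1.
    congr (_ * _); apply: eq_bigr => i _.
    by rewrite (cl _ _ _ (Bc s x s01 Bx)) mulrC [(x - p) 0 i]mxE [X in _ * (_ + X)]mxE.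
  - move=> s s01; rewrite scale0r addr0.
    apply: derivableD; last by have [] := line _ s x (Cth j) s01 Bx.
    apply: derivableM; first exact: derivable_id.
    apply: derivable_sumf => i.
    apply: derivableM; last exact: derivable_cst.
    by have [] := line _ s x (Cinf_on_pd j (Cth i)) s01 Bx.
have cF y : B y -> {for y, continuous F}.
  move=> By; apply: differentiable_continuous; apply: (C1_differentiable oB By _ _).1.
    by move=> z i Bz; have [] := dFx z i Bz.
  move=> i; apply: (continuous_open_eq (f := th i) oB _ By (Cth i [::] y By).1).
  by move=> z Bz; rewrite -derive_pdE; have [_ ->] := dFx z i Bz.
exists F; last by move=> x i Bx; rewrite -derive_pdE; have [_ ->] := dFx x i Bx.
(* The partials of [F] are the smooth functions [th i], so [F] together with all smooth functions
   forms a class stable under [pd]. *)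
apply: (Cinf_on_coind oB (P := fun f => f = F \/ Cinf_on B f)); last by left.
- by move=> f [->|Cf] y By; [exact: cF|exact: (Cf [::] y By).1].
- by move=> f [->|Cf] y i By; [have [] := dFx y i By|exact: (Cf [::] y By).2].
- move=> f [->|Cf] i; last by exists (pd i f) => //; right; exact: Cinf_on_pd.
  exists (th i); first by right; exact: Cth.
  by move=> y By; rewrite -derive_pdE; have [_ ->] := dFx y i By.
Qed.

End Poincare.

(** * Moving frames *)

Section MatrixDerivative.
Variables (R : realType) (n : nat) (U : set 'rV[R]_n).
Hypothesis oU : open U.
Implicit Types X : 'rV[R]_n -> 'rV[R]_n.

Definition Cmx m k (A : 'rV[R]_n -> 'M[R]_(m, k)) : Prop :=
  forall i j, Cinf_on U (fun x => A x i j).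

Definition Dmx m k X (A : 'rV[R]_n -> 'M[R]_(m, k)) x : 'M[R]_(m, k) :=
  \matrix_(i, j) Dvec X (fun y => A y i j) x.

Lemma Cmx_mul m k l (A : 'rV[R]_n -> 'M[R]_(m, k)) (B : 'rV[R]_n -> 'M[R]_(k, l)) :
  Cmx A -> Cmx B -> Cmx (fun x => A x *m B x).
Proof.
move=> CA CB i j; under eq_fun do rewrite mxE.
exact (Cinf_sum oU _ _ (fun k => CinfM oU (CA i k) (CB k j))).
Qed.

Lemma Cmx_add m k (A B : 'rV[R]_n -> 'M[R]_(m, k)) :
  Cmx A -> Cmx B -> Cmx (fun x => A x + B x).
Proof.
move=> CA CB i j; under eq_fun do rewrite mxE.
exact (CinfD oU (CA i j) (CB i j)).
Qed.

Lemma Cmx_D m k X (A : 'rV[R]_n -> 'M[R]_(m, k)) :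
  Cinf_on U X -> Cmx A -> Cmx (Dmx X A).
Proof.
move=> CX CA i j; under eq_fun do rewrite mxE.
exact (Cinf_Dvec oU CX (CA i j)).
Qed.

Lemma Dmx_mul m k l X (A : 'rV[R]_n -> 'M[R]_(m, k)) (B : 'rV[R]_n -> 'M[R]_(k, l)) x :
  Cmx A -> Cmx B -> U x ->
  Dmx X (fun x => A x *m B x) x = Dmx X A x *m B x + A x *m Dmx X B x.
Proof.
move=> CA CB Ux; apply/matrixP => i j.
rewrite !mxE; under eq_fun do rewrite mxE.
rewrite (Dvec_sum oU _ _ (fun k => CinfM oU (CA i k) (CB k j)) Ux) -big_split /=.
apply: eq_bigr => a _.
by rewrite (DvecM oU _ (CA i a) (CB a j) Ux) !mxE.
Qed.

Lemma Dmx_add m k X (A B : 'rV[R]_n -> 'M[R]_(m, k)) x :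
  Cmx A -> Cmx B -> U x ->
  Dmx X (fun x => A x + B x) x = Dmx X A x + Dmx X B x.
Proof.
move=> CA CB Ux; apply/matrixP => i j.
rewrite !mxE; under eq_fun do rewrite mxE.
exact (DvecD oU X (CA i j) (CB i j) Ux).
Qed.

Lemma Dmx_eq m k X (A B : 'rV[R]_n -> 'M[R]_(m, k)) x :
  (forall x, U x -> A x = B x) -> U x -> Dmx X A x = Dmx X B x.
Proof.
move=> AB Ux; apply/matrixP => i j; rewrite !mxE.
by apply: (Dvec_eq oU X _ Ux) => y Uy; rewrite AB.
Qed.

Lemma Dmx_cst m k X (A : 'M[R]_(m, k)) x : Dmx X (fun=> A) x = 0.
Proof. by apply/matrixP => i j; rewrite !mxE Dvec_cst. Qed.

Lemma Dmx_tr m k X (A : 'rV[R]_n -> 'M[R]_(m, k)) x :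
  Dmx X (fun x => (A x)^T) x = (Dmx X A x)^T.
Proof.
by apply/matrixP => i j; rewrite !mxE; congr (Dvec _ _ _); apply/funext => y; rewrite mxE.
Qed.

End MatrixDerivative.

Lemma mul_invmx_apply (F : fieldType) n (A : 'M[F]_n) (B : 'I_n -> F) (c : F) j :
  A \in unitmx ->
  \sum_k A j k * (c * \sum_l invmx A k l * B l) = c * B j.
Proof.
move=> uA; pose v : 'cV[F]_n := \col_l B l.
have -> : c * B j = c * (A *m (invmx A *m v)) j 0 by rewrite mulKVmx// mxE.
rewrite mxE mulr_sumr; apply: eq_bigr => k _; rewrite mulrCA; congr (_ * (_ * _)).
by rewrite mxE; apply: eq_bigr => l _; rewrite mxE.
Qed.

(** * Gauss formula and Levi-Civita connection in coordinates *)

Section Gauss.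
Variables (R : realType) (U : set 'rV[R]_3) (phi xi : 'rV[R]_3 -> 'rV[R]_4).
Hypotheses (oU : open U) (Cphi : Cinf_on U phi) (Cxi : Cinf_on U xi).
Hypothesis detF : forall x, U x -> \det (frameM phi xi x) != 0.
Hypothesis detH : forall x, U x -> \det (Hmat phi xi x) != 0.
Hypothesis dxi : forall i x, U x -> pd i xi x = 0.

Local Notation hf := (hf phi xi).
Local Notation Gam := (Gam phi xi).
Local Notation LC := (LC phi xi).
Local Notation Kt := (Kt phi xi).

Definition dphi x : 'M[R]_(3, 4) := \matrix_(i < 3) pd i phi x.

Let unitF x : U x -> frameM phi xi x \in unitmx.
Proof. by move=> Ux; rewrite unitmxE unitfE detF. Qed.

Let Cdphi : Cmx U dphi.
Proof.
move=> i l; under eq_fun do rewrite mxE.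
exact ((Cinf_on_coordP _ oU).1 (Cinf_on_pd i Cphi) l).
Qed.

Let Cxi' : Cmx U xi.
Proof. by move=> i l; rewrite ord1; exact ((Cinf_on_coordP _ oU).1 Cxi l). Qed.

Let CF : Cmx U (frameM phi xi).
Proof.
move=> i l; rewrite /frameM; case: (split_ordP i) => k ->.
  under eq_fun do rewrite col_mxEu.
  exact: Cdphi.
under eq_fun do rewrite col_mxEd.
exact: Cxi'.
Qed.

Let Ccoef i j m : Cinf_on U (fun x => coefs phi xi x (pd i (pd j phi) x) 0 m).
Proof.
rewrite /coefs; under eq_fun do rewrite mxE.
apply: (Cinf_sum oU) => l; apply: (CinfM oU).
  exact ((Cinf_on_coordP _ oU).1 (Cinf_on_pd i (Cinf_on_pd j Cphi)) l).
exact (Cinf_invmx oU l m CF detF).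
Qed.

Lemma Cinf_hf i j : Cinf_on U (hf i j).
Proof. exact: Ccoef. Qed.

Lemma Cinf_Gam k i j : Cinf_on U (Gam k i j).
Proof. exact: Ccoef. Qed.

Lemma gauss_formula i j x : U x ->
  pd i (pd j phi) x = \sum_k Gam k i j x *: pd k phi x + hf i j x *: xi x.
Proof.
move=> Ux; rewrite -[LHS](mulmxKV (unitF Ux)) -/(coefs phi xi x _).
apply/rowP => l; rewrite [LHS]mxE big_split_ord /= big_ord1 [RHS]mxE; congr (_ + _).
  rewrite summxE; apply: eq_bigr => k _.
  by rewrite [RHS]mxE; congr (_ * _); rewrite /frameM col_mxEu mxE.
by rewrite [RHS]mxE; congr (_ * _); rewrite /frameM col_mxEd.
Qed.

Let pd_phi_sym i j x : U x -> pd i (pd j phi) x = pd j (pd i phi) x.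
Proof.
move=> Ux; apply/rowP => l.
have E a b : pd a (pd b phi) x 0 l = pd a (pd b (fun y => phi y 0 l)) x.
  rewrite pd_coord; last exact ((Cphi [:: b] Ux).2 a).
  apply: (pd_open_eq a oU _ Ux) => y Uy; apply: pd_coord.
  exact ((Cphi [::] Uy).2 b).
have Cl := (Cinf_on_coordP _ oU).1 Cphi l.
exact (etrans (E i j) (etrans (pd_comm i j oU Cl Ux) (esym (E j i)))).
Qed.

Lemma hf_sym i j x : U x -> hf i j x = hf j i x.
Proof. by move=> Ux; rewrite /hf (pd_phi_sym i j Ux). Qed.

Lemma Gam_sym k i j x : U x -> Gam k i j x = Gam k j i x.
Proof. by move=> Ux; rewrite /Gam (pd_phi_sym i j Ux). Qed.

#[local] Opaque Defs.hf Defs.Gam coefs.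

Let pd_hf_sym l i j x : U x -> pd l (hf i j) x = pd l (hf j i) x.
Proof. by move=> Ux; apply: (pd_open_eq l oU _ Ux) => y Uy; exact: hf_sym. Qed.

Lemma LC_sym k i j x : U x -> LC k i j x = LC k j i x.
Proof.
move=> Ux; rewrite /LC.
have E l : pd i (hf j l) x + pd j (hf i l) x - pd l (hf i j) x =
   pd j (hf i l) x + pd i (hf j l) x - pd l (hf j i) x.
  have key (a b c d : R) : c = d -> a + b - c = b + a - d by move=> ->; rewrite [a + b]addrC.
  exact (key _ _ _ _ (pd_hf_sym l i j Ux)).
exact (congr1 _ (eq_bigr _ (fun l _ => congr1 _ (E l)))).
Qed.

Lemma Kt_sym k i j x : U x -> Kt k i j x = Kt k j i x.
Proof. by move=> Ux; rewrite /Kt (Gam_sym k i j Ux) (LC_sym k i j Ux). Qed.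

Lemma Cinf_LC k i j : Cinf_on U (LC k i j).
Proof.
have CH : Cmx U (Hmat phi xi).
  by move=> a b; under eq_fun do rewrite mxE; exact: Cinf_hf.
apply: (CinfM oU (Cinf_cst oU _)); apply: (Cinf_sum oU) => l.
apply: (CinfM oU (Cinf_invmx oU k l CH detH)).
apply: (CinfD oU); last exact (CinfN oU (Cinf_on_pd l (Cinf_hf i j))).
exact (CinfD oU (Cinf_on_pd i (Cinf_hf j l)) (Cinf_on_pd j (Cinf_hf i l))).
Qed.

(** Contraction with the metric cancels the inverse metric inside [LC] and leaves the Koszul
    formula. *)
Let LC_lower j l i x : U x -> \sum_k hf j k x * LC k l i x =
  2^-1 * (pd l (hf i j) x + pd i (hf l j) x - pd j (hf l i) x).
Proof.
move=> Ux.
have uH : Hmat phi xi x \in unitmx by rewrite unitmxE unitfE detH.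
pose Bl m := pd l (hf i m) x + pd i (hf l m) x - pd m (hf l i) x.
have E k : hf j k x * LC k l i x =
    Hmat phi xi x j k * (2^-1 * \sum_m invmx (Hmat phi xi x) k m * Bl m).
  by rewrite /Hmat mxE.
exact (etrans (eq_bigr _ (fun k _ => E k)) (mul_invmx_apply Bl _ j uH)).
Qed.

#[local] Opaque Defs.LC.

(** Two lowered Koszul formulas are added: the derivative of [hf i j] occurs twice with factor
    [1/2], and all other terms cancel in pairs. *)
Lemma metric_compat l i j x : U x ->
  pd l (hf i j) x = \sum_k LC k l i x * hf k j x + \sum_k hf i k x * LC k l j x.
Proof.
move=> Ux.
have S1 : \sum_k LC k l i x * hf k j x = \sum_k hf j k x * LC k l i x.
  apply: eq_bigr => k _.
  exact (etrans (mulrC _ _) (congr1 (fun a => a * LC k l i x) (hf_sym k j Ux))).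
have key (a a' b c : R) : a' = a -> 2^-1 * (a + b - c) + 2^-1 * (a' + c - b) = a.
  by move=> ->; field.
have S2 := congr2 +%R (etrans S1 (LC_lower j l i Ux)) (LC_lower i l j Ux).
exact (esym (etrans S2 (key _ _ _ _ (pd_hf_sym l j i Ux)))).
Qed.

End Gauss.

(** * Connection matrices in a frame *)

Section MovingFrame.
Variables (R : realType) (n N : nat) (U : set 'rV[R]_n).
Hypothesis oU : open U.
Variables (E : 'rV[R]_n -> 'M[R]_n) (Q : 'rV[R]_n -> 'M[R]_(n, N)).
Variables (xi : 'rV[R]_n -> 'rV[R]_N) (H : 'rV[R]_n -> 'M[R]_n).
Variables (lc kk : 'I_n -> 'rV[R]_n -> 'M[R]_n) (hh : 'I_n -> 'rV[R]_n -> 'cV[R]_n).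
Variable Dg : 'M[R]_n.
Let e a x := row a (E x).
Let D m k a := @Dmx R n m k (e a).
Hypotheses (CE : Cmx U E) (CQ : Cmx U Q) (Cxi : Cmx U xi) (CH : Cmx U H).
Hypotheses (Clc : forall a, Cmx U (lc a)) (Ckk : forall a, Cmx U (kk a)).
Hypothesis uE : forall x, U x -> E x \in unitmx.
Hypothesis DQ : forall a x, U x ->
  D a Q x = (lc a x + kk a x) *m Q x + hh a x *m xi x.
Hypothesis Dxi : forall a x, U x -> D a xi x = 0.
Hypothesis DH : forall a x, U x -> D a H x = lc a x *m H x + H x *m (lc a x)^T.
Hypothesis torsion_free : forall a b x, U x -> e b x *m lc a x = e a x *m lc b x.
Hypothesis indep : forall m (Z : 'M[R]_(m, n)) (y : 'cV[R]_m) x, U x ->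
  Z *m Q x + y *m xi x = 0 -> Z = 0.
Hypothesis ortho : forall x, U x -> E x *m H x *m (E x)^T = Dg.
Hypothesis hhE : forall a x, U x -> E x *m hh a x = col a Dg.

(** The change of frame applied to [lc a]: row [b] lists the frame components of the [hat nabla]
    derivative of [e b] along [e a]. *)
Definition frame_om a x : 'M[R]_n := (D a E x + E x *m lc a x) *m invmx (E x).
Definition frame_K a x : 'M[R]_n := E x *m kk a x *m invmx (E x).
Let om := frame_om.
Let C a x := om a x + frame_K a x.

Let Ce a : Cinf_on U (e a).
Proof.
apply: (Cinf_on_coordP _ oU).2 => j.
by under eq_fun do rewrite mxE; exact: CE.
Qed.

Let CV : Cmx U (fun x => invmx (E x)).
Proof.
move=> i j; apply: (Cinf_invmx oU i j CE) => x Ux.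
by have := uE Ux; rewrite unitmxE unitfE.
Qed.

Lemma Cmx_frame_om a : Cmx U (frame_om a).
Proof.
exact (Cmx_mul oU (Cmx_add oU (Cmx_D oU (Ce a) CE) (Cmx_mul oU CE (Clc a))) CV).
Qed.

Lemma Cmx_frame_K a : Cmx U (frame_K a).
Proof. exact (Cmx_mul oU (Cmx_mul oU CE (Ckk a)) CV). Qed.

Let CC a : Cmx U (C a).
Proof. exact (Cmx_add oU (Cmx_frame_om a) (Cmx_frame_K a)). Qed.

Lemma frame_omE a x : U x -> frame_om a x *m E x = D a E x + E x *m lc a x.
Proof. by move=> Ux; rewrite /frame_om mulmxKV ?uE. Qed.

Lemma frame_KE a x M : U x -> E x *m kk a x = M *m E x -> frame_K a x = M.
Proof. by move=> Ux h; rewrite /frame_K h mulmxK ?uE. Qed.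

#[local] Opaque frame_om.

(** Obtained by differentiating the constant Gram matrix [E H E^T = Dg] along [e a], with [DH]
    expressing that the connection is metric. *)
Lemma frame_om_skew a x : U x ->
  frame_om a x *m Dg + Dg *m (frame_om a x)^T = 0.
Proof.
move=> Ux.
have CEt : Cmx U (fun x => (E x)^T) by move=> i j; under eq_fun do rewrite mxE; exact: CE.
have E0 : D a (fun x => E x *m H x *m (E x)^T) x = 0.
  rewrite -[RHS](Dmx_cst (e a) Dg x).
  exact (Dmx_eq oU (e a) ortho Ux).
move: E0; rewrite /D (Dmx_mul oU (e a) (Cmx_mul oU CE CH) CEt Ux).
rewrite (Dmx_mul oU (e a) CE CH Ux) Dmx_tr -/(D a E x) -/(D a H x) (DH a Ux) => E0.
have -> : frame_om a x *m Dg = (D a E x + E x *m lc a x) *m H x *m (E x)^T.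
  by rewrite -(frame_omE a Ux) -(ortho Ux) !mulmxA.
have -> : Dg *m (frame_om a x)^T = E x *m H x *m (D a E x + E x *m lc a x)^T.
  by rewrite -(frame_omE a Ux) -(ortho Ux) [(frame_om a x *m E x)^T]trmx_mul !mulmxA.
have -> : (D a E x + E x *m lc a x)^T = (D a E x)^T + (lc a x)^T *m (E x)^T.
  by rewrite linearD /= trmx_mul.
rewrite -[RHS]E0 !(mulmxDl, mulmxDr, mulmxA) -!addrA.
by congr (_ + (_ + _)); rewrite addrC.
Qed.

(* Torsion-freeness of [hat nabla] expresses brackets through [frame_om]. *)
Definition struct_const a b x d := frame_om a x b d - frame_om b x a d.

(** By [frame_omE] the derivative of a frame field is a [frame_om] term minus an [lc] term; in the
    bracket the [lc] terms cancel by [torsion_free]. *)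
Lemma frame_commutator a b f x : Cinf_on U f -> U x ->
  Dvec (e a) (Dvec (e b) f) x - Dvec (e b) (Dvec (e a) f) x =
  \sum_d struct_const a b x d * Dvec (e d) f x.
Proof.
move=> Cf Ux; rewrite (Dvec_commutator oU (Ce a) (Ce b) Cf Ux).
have De c d k : Dvec (e c) (fun y => e d y 0 k) x = (D c E x) d k.
  by rewrite mxE; congr (Dvec _ _ _); apply/funext => y; rewrite mxE.
have R1 c d : row d (D c E x) = row d (frame_om c x) *m E x - e d x *m lc c x.
  rewrite -row_mul (frame_omE c Ux) linearD /= [row d (E x *m _)]row_mul.
  by rewrite addrK.
have R2 c d k : (D c E x) d k = (row d (frame_om c x) *m E x) 0 k - (e d x *m lc c x) 0 k.
  have := congr1 (fun v : 'rV_n => v 0 k) (R1 c d).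
  by rewrite [LHS]mxE [RHS]mxE [X in _ = _ + X]mxE.
have bE k : Dvec (e a) (fun y => e b y 0 k) x - Dvec (e b) (fun y => e a y 0 k) x =
    \sum_d struct_const a b x d * E x d k.
  rewrite !De !R2 (torsion_free a b Ux) opprB addrA subrK.
  rewrite ![in LHS]mxE -sumrB; apply: eq_bigr => d _.
  by rewrite -mulrBl /struct_const !mxE.
under eq_bigr do rewrite bE mulr_suml.
rewrite exchange_big /=; apply: eq_bigr => d _; rewrite /Dvec mulr_sumr.
by apply: eq_bigr => k _; rewrite mxE mulrA.
Qed.

Let S x := E x *m Q x.
Let CS : Cmx U S := Cmx_mul oU CE CQ.

(** The Gauss formula in the frame: the rows of [S] are the images of the frame vectors, the
    tangential part is governed by [C a], and the coefficients of [xi] are constants from the Gram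
    matrix. *)
Let DS a x : U x -> D a S x = C a x *m S x + col a Dg *m xi x.
Proof.
move=> Ux; rewrite /D /S (Dmx_mul oU (e a) CE CQ Ux) -/(D a E x) -/(D a Q x) (DQ a Ux).
rewrite mulmxDr [E x *m (hh a x *m _)]mulmxA (hhE a Ux) addrA; congr (_ + _).
have -> : C a x *m S x = (C a x *m E x) *m Q x by rewrite /S mulmxA.
rewrite [E x *m (_ *m Q x)]mulmxA -mulmxDl; congr (_ *m _).
rewrite [C a x *m _]mulmxDl (frame_omE a Ux) /frame_K mulmxKV ?uE//.
by rewrite mulmxDr addrA.
Qed.

Let regroup (V : zmodType) (a b c a' b' c' m l : V) :
  (a + b) + c - ((a' + b') + c') = m + l ->
  (a - a' + b - b' - m) + (c - c' - l) = 0.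
Proof.
move=> h; rewrite addrACA -opprD -h [X in X - _](AC (4*2) ((1*3*5)*(2*4*6))).
rewrite /=; have -> : - a' - b' - c' = - (a' + b' + c') by rewrite !opprD.
by rewrite subrr.
Qed.

(** The commutator of second derivatives of the vector-valued [S] is computed from [DS] and from the
    bracket. Since [xi] and [Dg] are constant, the transversal term creates no tangential one, and
    comparing tangential parts shows that the curvature vanishes. The products come in the order
    [C b *m C a] because frame vectors are rows. *)
Lemma frame_flat a b x : U x ->
  D a (C b) x - D b (C a) x + C b x *m C a x - C a x *m C b x =
  \sum_d struct_const a b x d *: C d x.
Proof.
move=> Ux.
have DDS c d : D c (D d S) x = (D c (C d) x + C d x *m C c x) *m S x
    + C d x *m col c Dg *m xi x.
  have Ccst : Cmx U (fun _ : 'rV[R]_n => col d Dg).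
    by move=> i j; exact (Cinf_cst oU _).
  rewrite /D (Dmx_eq oU (e c) (fun y Uy => DS d Uy) Ux).
  rewrite (Dmx_add oU (e c) (Cmx_mul oU (CC d) CS) (Cmx_mul oU Ccst Cxi) Ux).
  rewrite (Dmx_mul oU (e c) (CC d) CS Ux) (Dmx_mul oU (e c) Ccst Cxi Ux).
  rewrite Dmx_cst mul0mx add0r -/(D c xi x) (Dxi c Ux) mulmx0 addr0.
  rewrite -/(D c S x) (DS c Ux) [C d x *m (_ + _)]mulmxDr (mulmxDl (D c (C d) x)) addrA.
  by rewrite [C d x *m (C c x *m _)]mulmxA [C d x *m (col c Dg *m _)]mulmxA.
have comm : D a (D b S) x - D b (D a S) x = \sum_d struct_const a b x d *: D d S x.
  apply/matrixP => i j; rewrite [LHS]mxE [X in _ + X = _]mxE summxE.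
  have DE c (A : 'rV[R]_n -> 'M[R]_(n, N)) : D c A x i j = Dvec (e c) (fun y => A y i j) x.
    by rewrite mxE.
  have DDE c d : D c (D d S) x i j = Dvec (e c) (Dvec (e d) (fun y => S y i j)) x.
    by rewrite DE; congr (Dvec _ _ _); apply/funext => y; rewrite mxE.
  rewrite !DDE (frame_commutator a b (CS i j) Ux).
  by apply: eq_bigr => d _; rewrite [RHS]mxE DE.
have key : (D a (C b) x - D b (C a) x + C b x *m C a x - C a x *m C b x
    - \sum_d struct_const a b x d *: C d x) *m E x = 0.
  (* The column [y] gathers the coefficients of [xi], so [indep] isolates the tangential part. *)
  apply: (indep (y := C b x *m col a Dg - C a x *m col b Dg
     - \sum_d struct_const a b x d *: col d Dg) Ux).
  rewrite -mulmxA -/(S x).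
  have sumE : \sum_d struct_const a b x d *: D d S x =
      (\sum_d struct_const a b x d *: C d x) *m S x
      + (\sum_d struct_const a b x d *: col d Dg) *m xi x.
    rewrite !mulmx_suml -big_split /=; apply: eq_bigr => d _.
    by rewrite (DS _ Ux) scalerDr !scalemxAl.
  have := comm; rewrite sumE !DDS.
  move=> comm'.
  have dist1 (A1 A2 B1 B2 M : 'M[R]_n) (Y : 'M[R]_(n, N)) :
      (A1 - A2 + B1 - B2 - M) *m Y = A1 *m Y - A2 *m Y + B1 *m Y - B2 *m Y - M *m Y.
    by rewrite !mulmxBl mulmxDl mulmxBl.
  have dist2 (c1 c2 c3 : 'cV[R]_n) (y : 'rV[R]_N) :
      (c1 - c2 - c3) *m y = c1 *m y - c2 *m y - c3 *m y by rewrite !mulmxBl.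
  rewrite dist1 dist2; apply: regroup.
  have dist3 (A1 B1 A2 B2 : 'M[R]_n) (Y c1 c2 : 'M[R]_(n, N)) :
      A1 *m Y + B1 *m Y + c1 - (A2 *m Y + B2 *m Y + c2) =
      (A1 + B1) *m Y + c1 - ((A2 + B2) *m Y + c2) by rewrite !mulmxDl.
  exact (etrans (dist3 _ _ _ _ _ _ _) comm').
apply/eqP; rewrite -subr_eq0; apply/eqP.
by rewrite -[LHS](mulmxK (uE Ux)) key mul0mx.
Qed.

End MovingFrame.

(** * Consequences of flatness *)

(* Entry [(i, j)] of the connection matrix in the [b]-th direction of an
orthonormal frame of signature (-,+,+): [x], [y], [z] are the entries (0,1),
(0,2), (1,2) of the metric part, and [a] is the coefficient of the difference
tensor. *)
Definition cent (R : realType) (x y z a : R) (b i j : nat) : R :=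
  match i, j with
  | 0%N, 1%N | 1%N, 0%N => x
  | 0%N, 2%N | 2%N, 0%N => y
  | 1%N, 2%N => z - (if b == 2%N then a else 0)
  | 2%N, 1%N => - z - (if b == 2%N then a else 0)
  | 1%N, 1%N => if b == 1%N then a else 0
  | 2%N, 2%N => if b == 1%N then - a else 0
  | _, _ => 0
  end.

Definition sum3 (R : realType) (F : nat -> R) : R := F 0%N + F 1%N + F 2%N.

Section FlatTable.
Variable R : realType.
Variables (x y z Da : nat -> R) (X Y Z : nat -> nat -> R) (a : R).
Hypothesis a0 : a != 0.
Hypothesis flat : forall b c i j, (b < 3)%N -> (c < 3)%N -> (i < 3)%N -> (j < 3)%N ->
  cent (X b c) (Y b c) (Z b c) (Da b) c i j - cent (X c b) (Y c b) (Z c b) (Da c) b i j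
  + sum3 (fun m => cent (x c) (y c) (z c) a c i m * cent (x b) (y b) (z b) a b m j)
  - sum3 (fun m => cent (x b) (y b) (z b) a b i m * cent (x c) (y c) (z c) a c m j)
  = sum3 (fun d => (cent (x b) (y b) (z b) 0 b c d - cent (x c) (y c) (z c) 0 c b d)
       * cent (x d) (y d) (z d) a d i j).

(** Everything is taken at one point: [X b c], [Y b c], [Z b c] play the derivatives of [x c],
    [y c], [z c] in direction [b], and [Da] those of [a]. Metric parts are skew and difference
    tensors symmetric with respect to [h], so combining transposed entries eliminates [X], [Y], [Z].
    What remains is the Codazzi equation for [K], linear in [Da] and in the products of [a] with the
    connection coefficients. *)
Lemma flat_cent_first_order : (x 0%N = 0 /\ y 0%N = 0 /\ x 2%N = - y 1%N /\ y 2%N = x 1%N) /\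
  (z 0%N = y 1%N / 3 /\ Da 0%N = - x 1%N * a /\ Da 1%N = - 3 * a * z 2%N /\ Da 2%N = 3 * a * z 1%N).
Proof.
have F01_01 := @flat 0%N 1%N 0%N 1%N isT isT isT isT.
have F01_02 := @flat 0%N 1%N 0%N 2%N isT isT isT isT.
have F01_10 := @flat 0%N 1%N 1%N 0%N isT isT isT isT.
have F01_11 := @flat 0%N 1%N 1%N 1%N isT isT isT isT.
have F01_12 := @flat 0%N 1%N 1%N 2%N isT isT isT isT.
have F01_20 := @flat 0%N 1%N 2%N 0%N isT isT isT isT.
have F01_21 := @flat 0%N 1%N 2%N 1%N isT isT isT isT.
have F01_22 := @flat 0%N 1%N 2%N 2%N isT isT isT isT.
have F02_01 := @flat 0%N 2%N 0%N 1%N isT isT isT isT.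
have F02_02 := @flat 0%N 2%N 0%N 2%N isT isT isT isT.
have F02_10 := @flat 0%N 2%N 1%N 0%N isT isT isT isT.
have F02_11 := @flat 0%N 2%N 1%N 1%N isT isT isT isT.
have F02_12 := @flat 0%N 2%N 1%N 2%N isT isT isT isT.
have F02_20 := @flat 0%N 2%N 2%N 0%N isT isT isT isT.
have F02_21 := @flat 0%N 2%N 2%N 1%N isT isT isT isT.
have F02_22 := @flat 0%N 2%N 2%N 2%N isT isT isT isT.
have F12_01 := @flat 1%N 2%N 0%N 1%N isT isT isT isT.
have F12_02 := @flat 1%N 2%N 0%N 2%N isT isT isT isT.
have F12_10 := @flat 1%N 2%N 1%N 0%N isT isT isT isT.
have F12_11 := @flat 1%N 2%N 1%N 1%N isT isT isT isT.
have F12_12 := @flat 1%N 2%N 1%N 2%N isT isT isT isT.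
have F12_20 := @flat 1%N 2%N 2%N 0%N isT isT isT isT.
have F12_21 := @flat 1%N 2%N 2%N 1%N isT isT isT isT.
have F12_22 := @flat 1%N 2%N 2%N 2%N isT isT isT isT.
rewrite /sum3 /= in F01_01 F01_02 F01_10 F01_11 F01_12 F01_20 F01_21 F01_22
  F02_01 F02_02 F02_10 F02_11 F02_12 F02_20 F02_21 F02_22
  F12_01 F12_10 F12_11 F12_12 F12_20 F12_21 F12_02 F12_22.
(* Each algebraic relation appears with the factor [a], which [a0] allows to cancel. *)
have e1 : a * x 0%N = 0.
  by clear -F01_01 F01_10 F02_01 F02_10 F01_02 F01_20 F02_02 F02_20; lra.
have e2 : a * y 0%N = 0.
  by clear -F01_01 F01_10 F02_01 F02_10 F01_02 F01_20 F02_02 F02_20; lra.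
have e3 : a * (x 2%N + y 1%N) = 0 by clear -F12_01 F12_10 F12_02 F12_20; lra.
have e4 : a * (y 2%N - x 1%N) = 0 by clear -F12_01 F12_10 F12_02 F12_20; lra.
have x0 : x 0%N = 0 by move/eqP: e1; rewrite mulf_eq0 (negbTE a0) => /eqP.
have y0 : y 0%N = 0 by move/eqP: e2; rewrite mulf_eq0 (negbTE a0) => /eqP.
have x2 : x 2%N = - y 1%N by move/eqP: e3; rewrite mulf_eq0 (negbTE a0) /= addr_eq0 => /eqP.
have y2 : y 2%N = x 1%N by move/eqP: e4; rewrite mulf_eq0 (negbTE a0) /= subr_eq0 => /eqP.
split=> //.
rewrite x2 y2 x0 y0 in F01_11 F01_12 F01_21 F01_22 F02_11 F02_12 F02_21 F02_22.
have e5 : a * (3 * z 0%N - y 1%N) = 0.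
  by clear -F01_11 F01_12 F01_21 F01_22 F02_11 F02_12 F02_21 F02_22; lra.
have z0 : z 0%N = y 1%N / 3 by move/eqP: e5; rewrite mulf_eq0 (negbTE a0) /= => /eqP; lra.
have d0 : Da 0%N = - x 1%N * a.
  rewrite z0 in F01_11 F01_12 F01_21 F01_22 F02_11 F02_12 F02_21 F02_22.
  by clear -F01_11 F01_12 F01_21 F01_22 F02_11 F02_12 F02_21 F02_22; lra.
rewrite x2 y2 in F12_11 F12_12 F12_21 F12_22.
have d1 : Da 1%N = - 3 * a * z 2%N by clear -F12_11 F12_12 F12_21 F12_22; lra.
have d2 : Da 2%N = 3 * a * z 1%N by clear -F12_11 F12_12 F12_21 F12_22; lra.
by [].
Qed.

(** The h-skew part of flatness is the Gauss equation; the term [- 2 * a * a] is the commutator of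
    the [V] and [W] matrices of [K]. The differentiated first-order identities are a hypothesis
    because differentiating needs them on a neighbourhood, while this section lives at a point. *)
Lemma flat_cent_second_order :
  (forall d, (d < 3)%N -> X d 0%N = 0 /\ Y d 0%N = 0 /\ X d 2%N = - Y d 1%N /\
     Y d 2%N = X d 1%N /\ Z d 0%N = Y d 1%N / 3) ->
  let p := x 1%N in let q := y 1%N in
  (X 0%N 1%N = q * q - p * p /\ Y 0%N 1%N = - 2 * p * q) /\
  (X 1%N 1%N = Y 2%N 1%N /\ Y 1%N 1%N = - X 2%N 1%N) /\
  Z 1%N 2%N - Z 2%N 1%N + z 1%N * z 1%N + z 2%N * z 2%N
    = p * p + q * q + 2 / 3 * (q * q) - 2 * a * a.
Proof.
move=> H p q.
have [[x0 [y0 [x2 y2]]] [z0 [d0 [d1 d2]]]] := flat_cent_first_order.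
have [X00 [Y00 [X02 [Y02 Z00]]]] := H 0%N isT.
have [X10 [Y10 [X12 [Y12 Z10]]]] := H 1%N isT.
have [X20 [Y20 [X22 [Y22 Z20]]]] := H 2%N isT.
rewrite /p /q.
have F01_01 := @flat 0%N 1%N 0%N 1%N isT isT isT isT.
have F01_02 := @flat 0%N 1%N 0%N 2%N isT isT isT isT.
have F12_01 := @flat 1%N 2%N 0%N 1%N isT isT isT isT.
have F12_02 := @flat 1%N 2%N 0%N 2%N isT isT isT isT.
have F12_12 := @flat 1%N 2%N 1%N 2%N isT isT isT isT.
have F12_21 := @flat 1%N 2%N 2%N 1%N isT isT isT isT.
rewrite /sum3 /= in F01_01 F01_02 F12_01 F12_02 F12_12 F12_21.
rewrite ?x0 ?y0 ?x2 ?y2 ?z0 ?X00 ?Y00 ?X02 ?Y02 ?Z00 ?X10 ?Y10 ?X12 ?Y12 ?Z10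
  ?X20 ?Y20 ?X22 ?Y22 ?Z20 in F01_01 F01_02 F12_01 F12_02 F12_12 F12_21.
split; first by split; lra.
split; first by split; lra.
lra.
Qed.
End FlatTable.

(** * The structure equations *)

Section Coordinates.
Variables (R : realType) (U : set 'rV[R]_3) (phi xi : 'rV[R]_3 -> 'rV[R]_4).
Hypotheses (oU : open U) (Cphi : Cinf_on U phi) (Cxi : Cinf_on U xi).
Hypothesis detF : forall x, U x -> \det (frameM phi xi x) != 0.
Hypothesis detH : forall x, U x -> \det (Hmat phi xi x) != 0.
Hypothesis dxi : forall i x, U x -> pd i xi x = 0.

Local Notation hf := (hf phi xi).
Local Notation Gam := (Gam phi xi).
Local Notation LC := (LC phi xi).
Local Notation Kt := (Kt phi xi).
Local Notation H := (Hmat phi xi).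
Local Notation happ := (happ phi xi).

(** Arranged for row vectors: [w *m LCm v x] is the Christoffel part of the derivative of [w] along
    [v]. *)
Definition LCm (v : 'rV[R]_3) x : 'M[R]_3 := \matrix_(j, k) \sum_i v 0 i * LC k i j x.
Definition Km (v : 'rV[R]_3) x : 'M[R]_3 := \matrix_(j, k) \sum_i v 0 i * Kt k i j x.
Definition hv (v : 'rV[R]_3) x : 'cV[R]_3 := \col_j \sum_i v 0 i * hf i j x.

Lemma happE x (X Y : 'rV[R]_3) : happ x X Y = (X *m H x *m Y^T) 0 0.
Proof.
rewrite [RHS]mxE /Defs.happ exchange_big /=; apply: eq_bigr => j _.
rewrite [Y^T j 0]mxE [(X *m _) 0 j]mxE mulr_suml; apply: eq_bigr => i _.
by rewrite [H x i j]mxE [X 0 i * _]mulrC.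
Qed.

Lemma happ_sym x X Y : U x -> happ x X Y = happ x Y X.
Proof.
move=> Ux; rewrite /Defs.happ exchange_big /=; apply: eq_bigr => i _.
apply: eq_bigr => j _.
by rewrite (hf_sym xi oU Cphi i j Ux) mulrAC.
Qed.

Lemma KappE x (X Y : 'rV[R]_3) : Kapp phi xi x X Y = Y *m Km X x.
Proof.
apply/rowP => k; rewrite [LHS]mxE [RHS]mxE exchange_big /=; apply: eq_bigr => j _.
rewrite [Km X x j k]mxE mulr_sumr; apply: eq_bigr => i _.
by rewrite mulrC [Kt _ _ _ _ * _]mulrC.
Qed.

Lemma Kapp_sym x (X Y : 'rV[R]_3) : U x -> Kapp phi xi x X Y = Kapp phi xi x Y X.
Proof.
move=> Ux; apply/rowP => k; rewrite [LHS]mxE [RHS]mxE exchange_big /=.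
apply: eq_bigr => i _; apply: eq_bigr => j _.
by rewrite (Kt_sym xi oU Cphi k j i Ux) mulrAC.
Qed.

Lemma nablahatE X Y x :
  nablahat phi xi X Y x = Dmx X Y x + Y x *m LCm (X x) x.
Proof.
apply/rowP => k; rewrite [LHS]mxE [RHS]mxE [Dmx X Y x 0 k]mxE; congr (_ + _).
rewrite [RHS]mxE exchange_big /=; apply: eq_bigr => j _.
rewrite [LCm _ _ j k]mxE mulr_sumr; apply: eq_bigr => i _.
by rewrite mulrC [LC _ _ _ _ * _]mulrC.
Qed.

Lemma LCm_sym (v w : 'rV[R]_3) x : U x -> w *m LCm v x = v *m LCm w x.
Proof.
move=> Ux; apply/rowP => k; rewrite [LHS]mxE [RHS]mxE.
under eq_bigr do rewrite mxE mulr_sumr.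
under [RHS]eq_bigr do rewrite mxE mulr_sumr.
rewrite exchange_big /=; apply: eq_bigr => i _; apply: eq_bigr => j _.
by rewrite (LC_sym xi oU Cphi k i j Ux) mulrCA.
Qed.

(** This is [gauss_formula] contracted with [X], after writing [Gam] as [LC + Kt]. *)
Lemma Dmx_dphi X x : U x ->
  Dmx X (dphi phi) x = (LCm (X x) x + Km (X x) x) *m dphi phi x + hv (X x) x *m xi x.
Proof.
move=> Ux; apply/matrixP => j l.
rewrite [LHS]mxE [RHS]mxE [(hv _ _ *m _) j l]mxE big_ord1.
rewrite [hv _ _ j 0]mxE [((_ + _) *m _) j l]mxE.
have pE i : pd i (fun y => dphi phi y j l) x =
    \sum_k Gam k i j x * dphi phi x k l + hf i j x * xi x 0 l.
  have -> : (fun y => dphi phi y j l) = (fun y => pd j phi y 0 l).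
    by apply/funext => y; rewrite mxE.
  rewrite -pd_coord; last exact ((Cphi [:: j] Ux).2 i).
  rewrite (gauss_formula detF i j Ux) [LHS]mxE summxE [X in _ + X]mxE.
  by congr (_ + _); apply: eq_bigr => k _; rewrite [LHS]mxE [dphi phi x k l]mxE.
rewrite /Dvec; under eq_bigr do rewrite pE mulrDr mulr_sumr.
rewrite big_split /= exchange_big /= mulr_suml; congr (_ + _); last first.
  by apply: eq_bigr => i _; rewrite mulrA.
have addE (A B : 'M[R]_3) a b : (A + B) a b = A a b + B a b by rewrite mxE.
apply: eq_bigr => k _; rewrite addE [LCm _ _ j k]mxE [Km _ _ j k]mxE.
rewrite -big_split /= mulr_suml; apply: eq_bigr => i _.
by rewrite -mulrDr /Defs.Kt addrC subrK mulrA.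
Qed.

Lemma Dmx_H X x : U x ->
  Dmx X H x = LCm (X x) x *m H x + H x *m (LCm (X x) x)^T.
Proof.
move=> Ux; apply/matrixP => i j.
rewrite [LHS]mxE [RHS]mxE [(LCm _ _ *m _) i j]mxE [(H x *m _) i j]mxE.
have -> : (fun y => H y i j) = hf i j by apply/funext => y; rewrite mxE.
have LE a b : LCm (X x) x a b = \sum_l X x 0 l * LC b l a x by rewrite mxE.
have HE a b : H x a b = hf a b x by rewrite mxE.
rewrite /Dvec.
have pE l : X x 0 l * pd l (hf i j) x =
    \sum_k X x 0 l * (LC k l i x * hf k j x) + \sum_k X x 0 l * (hf i k x * LC k l j x).
  by rewrite (metric_compat oU Cphi detH l i j Ux) mulrDr !mulr_sumr.
under eq_bigr do rewrite pE.
rewrite big_split /=; congr (_ + _).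
  rewrite exchange_big /=; apply: eq_bigr => k _; rewrite LE HE mulr_suml.
  by apply: eq_bigr => l _; rewrite mulrA.
rewrite exchange_big /=; apply: eq_bigr => k _; rewrite [_^T k j]mxE LE HE mulr_sumr.
by apply: eq_bigr => l _; rewrite mulrCA.
Qed.

Lemma dphi_indep m (Z : 'M[R]_(m, 3)) (y : 'cV[R]_m) x : U x ->
  Z *m dphi phi x + y *m xi x = 0 -> Z = 0.
Proof.
move=> Ux E; have uF : frameM phi xi x \in unitmx by rewrite unitmxE unitfE detF.
have : row_mx Z y *m frameM phi xi x = 0 by rewrite mul_row_col.
move/(congr1 (mulmx ^~ (invmx (frameM phi xi x)))); rewrite mulmxK// mul0mx.
by rewrite -[0 in RHS]row_mx0 => /eq_row_mx [].
Qed.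

End Coordinates.

(** With [p], [q] for [alpha22], [alpha23], the functions [z1] and [z2] are the [W]-components of
    the [hat nabla] derivatives of [V] along [V] and along [W]. After the brackets come the Codazzi
    equations for [a], a complex Riccati equation along [T], Cauchy-Riemann equations for [p + i q],
    and the Gauss equation in the [V], [W] plane. *)
Definition structure_eqs (R : realType) (U : set 'rV[R]_3)
    (T V W : 'rV[R]_3 -> 'rV[R]_3) (p q z1 z2 a : 'rV[R]_3 -> R) : Prop :=
  (forall f x, Cinf_on U f -> U x ->
    [/\ Dvec T (Dvec V f) x - Dvec V (Dvec T f) x
          = - p x * Dvec V f x - 2 / 3 * q x * Dvec W f x,
        Dvec T (Dvec W f) x - Dvec W (Dvec T f) x
          = 2 / 3 * q x * Dvec V f x - p x * Dvec W f x &
        Dvec V (Dvec W f) x - Dvec W (Dvec V f) x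
          = 2 * q x * Dvec T f x - z1 x * Dvec V f x - z2 x * Dvec W f x]) /\
  forall x, U x ->
    [/\ Dvec T a x = - p x * a x, Dvec V a x = - 3 * a x * z2 x &
        Dvec W a x = 3 * a x * z1 x] /\
    [/\ Dvec T p x = q x * q x - p x * p x, Dvec T q x = - 2 * p x * q x,
        Dvec V p x = Dvec W q x & Dvec V q x = - Dvec W p x] /\
    Dvec V z2 x - Dvec W z1 x + z1 x * z1 x + z2 x * z2 x
      = p x * p x + q x * q x + 2 / 3 * (q x * q x) - 2 * a x * a x.

Section FrameTable.
Variables (R : realType) (n : nat) (U : set 'rV[R]_n).
Hypothesis oU : open U.

Lemma Dvec_cent X (f g h k : 'rV[R]_n -> R) (b i j : nat) x :
  Cinf_on U f -> Cinf_on U g -> Cinf_on U h -> Cinf_on U k -> U x ->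
  Dvec X (fun y => cent (f y) (g y) (h y) (k y) b i j) x =
  cent (Dvec X f x) (Dvec X g x) (Dvec X h x) (Dvec X k x) b i j.
Proof.
move=> Cf Cg Ch Ck Ux.
have C0 := Cinf_cst oU (0 : R).
have Dhk := DvecB oU X Ch Ck Ux.
have Dh0 := etrans (DvecB oU X Ch C0 Ux) (congr1 (fun c => _ - c) (Dvec_cst X 0 x)).
have DNh := DvecN oU X Ch Ux.
have DNhk := etrans (DvecB oU X (CinfN oU Ch) Ck Ux) (congr1 (fun c => c - _) DNh).
have DNh0 := etrans (DvecB oU X (CinfN oU Ch) C0 Ux)
  (congr2 (fun c d => c - d) DNh (Dvec_cst X 0 x)).
have DNk := DvecN oU X Ck Ux.
have D0 := Dvec_cst X (0 : R) x.
rewrite /cent; case: (b == 2%N); case: (b == 1%N);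
  move: i j => [|[|[|i]]] [|[|[|j]]] /=;
  solve [exact D0 | reflexivity | exact Dhk | exact Dh0 | exact DNhk | exact DNh0 | exact DNk].
Qed.

End FrameTable.

(** Total on [nat], with every index from 2 on sent to [i2]; indices are guarded by [< 3] where it
    matters. *)
Definition ord3 (k : nat) : 'I_3 :=
  match k with 0%N => i0 | 1%N => i1 | _ => i2 end.

Lemma ord3P (P : 'I_3 -> Prop) : P i0 -> P i1 -> P i2 -> forall a, P a.
Proof.
move=> P0 P1 P2 [[|[|[|k]]] hk] //.
- by have -> : Ordinal hk = i0 by exact: val_inj.
- by have -> : Ordinal hk = i1 by exact: val_inj.
- by have -> : Ordinal hk = i2 by exact: val_inj.
Qed.

Lemma sum_ord3 (V : nmodType) (F : 'I_3 -> V) : \sum_i F i = F i0 + F i1 + F i2.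
Proof.
rewrite !big_ord_recl big_ord0 addr0 addrA.
by congr (F _ + F _ + F _); exact: val_inj.
Qed.

Definition Dg3 (R : realType) : 'M[R]_3 :=
  \matrix_(i, j) (if i == j :> nat then if i == 0%N :> nat then -1 else 1 else 0).

Lemma skew_cent (R : realType) (M : 'M[R]_3) (b i j : nat) :
  M *m Dg3 R + Dg3 R *m M^T = 0 -> (i < 3)%N -> (j < 3)%N ->
  M (ord3 i) (ord3 j) = cent (M i0 i1) (M i0 i2) (M i1 i2) 0 b i j.
Proof.
move=> sk.
have ent k l : M k l * Dg3 R l l + Dg3 R k k * M l k = 0.
  have := congr1 (fun A : 'M_3 => A k l) sk; rewrite !mxE !sum_ord3 !mxE => <-.
  by move: k l; apply: ord3P; apply: ord3P => /=; rewrite ?(mulr0, mul0r, addr0, add0r).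
have m00 := ent i0 i0; have m11 := ent i1 i1; have m22 := ent i2 i2.
have m01 := ent i0 i1; have m02 := ent i0 i2; have m12 := ent i1 i2.
rewrite !mxE /= in m00 m11 m22 m01 m02 m12.
have z : (if b == 2%N then 0 else 0) = 0 :> R by case: ifP.
have z1 : (if b == 1%N then 0 else 0) = 0 :> R by case: ifP.
have z2 : (if b == 1%N then - 0 else 0) = 0 :> R by case: ifP; rewrite ?oppr0.
by move: i j => [|[|[|i]]] [|[|[|j]]] //= _ _; rewrite ?z ?z1 ?z2; lra.
Qed.

(** Passes from the matrix identity of [frame_flat] to numerical tables indexed by [nat], where all
    entries compute and linear arithmetic applies. *)
Lemma curvature_entry (R : realType) (P Q : 'M[R]_3) (M : 'I_3 -> 'M[R]_3)
    (s : 'I_3 -> R) (Pv Qv : R) (Mv : nat -> nat -> nat -> R) (sv : nat -> R) b c i j :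
  P - Q + M (ord3 c) *m M (ord3 b) - M (ord3 b) *m M (ord3 c) = \sum_d s d *: M d ->
  P (ord3 i) (ord3 j) = Pv -> Q (ord3 i) (ord3 j) = Qv ->
  (forall b i j, (b < 3)%N -> (i < 3)%N -> (j < 3)%N -> M (ord3 b) (ord3 i) (ord3 j) = Mv b i j) ->
  (forall d, (d < 3)%N -> s (ord3 d) = sv d) ->
  (b < 3)%N -> (c < 3)%N -> (i < 3)%N -> (j < 3)%N ->
  Pv - Qv + sum3 (fun m => Mv c i m * Mv b m j) - sum3 (fun m => Mv b i m * Mv c m j)
  = sum3 (fun d => sv d * Mv d i j).
Proof.
move=> F <- <- HM Hs hb hc hi hj.
have := congr1 (fun A : 'M_3 => A (ord3 i) (ord3 j)) F.
have addE (A B : 'M[R]_3) k l : (A + B) k l = A k l + B k l by rewrite mxE.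
have oppE (A : 'M[R]_3) k l : (- A) k l = - A k l by rewrite mxE.
have mulE (A B : 'M[R]_3) k l : (A *m B) k l =
    A k (ord3 0) * B (ord3 0) l + A k (ord3 1) * B (ord3 1) l + A k (ord3 2) * B (ord3 2) l.
  by rewrite mxE sum_ord3.
have sclE (a : R) (A : 'M[R]_3) k l : (a *: A) k l = a * A k l by rewrite mxE.
rewrite sum_ord3 -[i0]/(ord3 0) -[i1]/(ord3 1) -[i2]/(ord3 2) !addE !oppE !mulE !sclE.
by rewrite !HM// !Hs.
Qed.

Lemma mulmx_tr_entry (F : comPzRingType) m n (A B : 'M[F]_(m, n)) (M : 'M[F]_n) a b :
  (A *m M *m B^T) a b = (row a A *m M *m (row b B)^T) 0 0.
Proof.
rewrite -row_mul [LHS]mxE [RHS]mxE; apply: eq_bigr => j _.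
by rewrite [row a _ 0 j]mxE; congr (_ * _); rewrite !mxE.
Qed.

(** * Structure equations of the adapted frame *)

Section StructureEquations.
Variables (R : realType) (U : set 'rV[R]_3) (phi xi : 'rV[R]_3 -> 'rV[R]_4).
Variables (T V W : 'rV[R]_3 -> 'rV[R]_3) (a6 : 'rV[R]_3 -> R).
Hypotheses (oU : open U) (Cphi : Cinf_on U phi) (Cxi : Cinf_on U xi).
Hypothesis detF : forall x, U x -> \det (frameM phi xi x) != 0.
Hypothesis detH : forall x, U x -> \det (Hmat phi xi x) != 0.
Hypothesis dxi : forall i x, U x -> pd i xi x = 0.
Hypothesis frame : S3_frame phi xi U T V W a6.

Local Notation H := (Hmat phi xi).
Local Notation happ := (happ phi xi).
Local Notation Kapp := (Kapp phi xi).

Let E x : 'M[R]_3 := \matrix_(a < 3) nth 0 [:: T x; V x; W x] a.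
Let e a x := row a (E x).
Let lc a x := LCm phi xi (e a x) x.
Let kk a x := Km phi xi (e a x) x.
Let hh a x := hv phi xi (e a x) x.

Let e0 x : e i0 x = T x. Proof. by rewrite /e rowK. Qed.
Let e1 x : e i1 x = V x. Proof. by rewrite /e rowK. Qed.
Let e2 x : e i2 x = W x. Proof. by rewrite /e rowK. Qed.

Let CE : Cmx U E.
Proof.
have [CT [CV [CW _]]] := frame.
move=> a j; under eq_fun do rewrite mxE.
by move: a; apply: ord3P => /=; exact: (Cinf_on_coordP _ oU).1.
Qed.

Let Ce a i : Cinf_on U (fun x => e a x 0 i).
Proof. by under eq_fun do rewrite mxE; exact: CE. Qed.

Let CH : Cmx U H.
Proof.
by move=> i j; under eq_fun do rewrite mxE; exact: Cinf_hf.
Qed.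

Let Clc a : Cmx U (lc a).
Proof.
move=> j k; under eq_fun do rewrite mxE.
exact (Cinf_sum oU _ _ (fun i => CinfM oU (Ce a i) (Cinf_LC oU Cphi Cxi detF detH k i j))).
Qed.

Let Ckk a : Cmx U (kk a).
Proof.
have CK k i j : Cinf_on U (Kt phi xi k i j).
  exact (CinfD oU (Cinf_Gam oU Cphi Cxi detF k i j) (CinfN oU (Cinf_LC oU Cphi Cxi detF detH k i j))).
move=> j k; under eq_fun do rewrite mxE.
exact (Cinf_sum oU _ _ (fun i => CinfM oU (Ce a i) (CK k i j))).
Qed.

Let Cdphi : Cmx U (dphi phi).
Proof.
move=> i l; under eq_fun do rewrite mxE.
exact ((Cinf_on_coordP _ oU).1 (Cinf_on_pd i Cphi) l).
Qed.

Let Cxim : Cmx U xi.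
Proof. by move=> i l; rewrite ord1; exact ((Cinf_on_coordP _ oU).1 Cxi l). Qed.

Let happ_e a b x : U x -> happ x (e a x) (e b x) = Dg3 R a b.
Proof.
move=> Ux; have [_ [_ [_ [_ /(_ x Ux) [[h00 [h11 [h22 [h01 [h02 h12]]]]] _]]]]] := frame.
have sy := happ_sym xi oU Cphi.
by move: a b; apply: ord3P; apply: ord3P; rewrite mxE /= ?e0 ?e1 ?e2 //; rewrite sy.
Qed.

Let ortho x : U x -> E x *m H x *m (E x)^T = Dg3 R.
Proof.
move=> Ux; apply/matrixP => a b; rewrite -(happ_e a b Ux) happE.
exact: mulmx_tr_entry.
Qed.

(** [Dg3] is its own inverse, and vectors with an invertible Gram matrix are independent. *)
Let uE x : U x -> E x \in unitmx.
Proof.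
move=> Ux; have uD : Dg3 R \in unitmx.
  have DD : Dg3 R *m Dg3 R = 1%:M.
    apply/matrixP => i j; rewrite mxE sum_ord3 !mxE.
    by move: i j; apply: ord3P; apply: ord3P => /=; ring.
  by have [] := mulmx1_unit DD.
by move: uD; rewrite -(ortho Ux) -mulmxA unitmx_mul => /andP[].
Qed.

Let hhE a x : U x -> E x *m hh a x = col a (Dg3 R).
Proof.
move=> Ux; apply/matrixP => b c; rewrite ord1 [RHS]mxE.
have -> : Dg3 R b a = Dg3 R a b by rewrite !mxE; case: eqVneq => [->|]; rewrite ?eqxx.
rewrite -(happ_e a b Ux) [LHS]mxE /Defs.happ exchange_big /=.
apply: eq_bigr => j _; rewrite [hh a x j 0]mxE mulr_sumr; apply: eq_bigr => i _.
by rewrite [e b x 0 j]mxE mulrC [e a x 0 i * _]mulrC.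
Qed.

Let Dxi a x : U x -> Dmx (e a) xi x = 0.
Proof.
move=> Ux; apply/matrixP => i l; rewrite ord1 [LHS]mxE [RHS]mxE /Dvec big1// => k _.
rewrite -pd_coord; last exact ((Cxi [::] Ux).2 k).
by rewrite dxi// [X in _ * X]mxE mulr0.
Qed.

Let om := frame_om E lc.
Let KK := frame_K E kk.

(** Rows are compared one frame vector at a time; symmetry of [K] supplies the pairs that the normal
    form does not list. *)
Let KKE a x : U x -> KK a x =
  \matrix_(i, j) cent 0 0 0 (a6 x) a i j.
Proof.
move=> Ux; set M := (X in _ = X).
have [_ [_ [_ [_ /(_ x Ux) [_ [_ [KT [KVV [KVW KWW]]]]]]]]] := frame.
suff kE : E x *m kk a x = M *m E x by exact: (frame_KE uE Ux kE).
apply/row_matrixP => b; rewrite row_mul -/(e b x) -KappE row_mul.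
have rM : row b M *m E x = M b i0 *: T x + M b i1 *: V x + M b i2 *: W x.
  rewrite mulmx_sum_row sum_ord3 -/(e i0 x) -/(e i1 x) -/(e i2 x) e0 e1 e2.
  by rewrite ![row b M _ _]mxE.
rewrite {}rM /M !mxE; clear M.
have KTr X : Kapp x X (T x) = 0 by rewrite (Kapp_sym xi oU Cphi _ _ Ux) KT.
have KWV : Kapp x (W x) (V x) = - a6 x *: W x by rewrite (Kapp_sym xi oU Cphi _ _ Ux) KVW.
move: a b; apply: ord3P; apply: ord3P; rewrite ?e0 ?e1 ?e2 ?KT ?KTr ?KVV ?KVW ?KWV ?KWW /= ?scale0r ?addr0 ?add0r ?sub0r ?subr0 //;
  by rewrite ?oppr0 ?sub0r ?scale0r ?addr0 ?add0r.
Qed.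

Let DQ a x : U x -> Dmx (e a) (dphi phi) x =
  (lc a x + kk a x) *m dphi phi x + hh a x *m xi x.
Proof. exact (Dmx_dphi Cphi detF (e a) (x := x)). Qed.

Let DH a x : U x -> Dmx (e a) H x = lc a x *m H x + H x *m (lc a x)^T.
Proof. exact (Dmx_H oU Cphi detH (e a) (x := x)). Qed.

Let tors a b x : U x -> e b x *m lc a x = e a x *m lc b x.
Proof. exact (LCm_sym xi oU Cphi (e a x) (e b x) (x := x)). Qed.

Let indep m (Z : 'M[R]_(m, 3)) (y : 'cV[R]_m) x : U x ->
  Z *m dphi phi x + y *m xi x = 0 -> Z = 0.
Proof. exact (dphi_indep detF (Z := Z) (y := y) (x := x)). Qed.

Let Com a : Cmx U (om a) := Cmx_frame_om oU CE Clc uE a.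

Let om_skew a x : U x -> om a x *m Dg3 R + Dg3 R *m (om a x)^T = 0.
Proof. exact (frame_om_skew oU CE CH uE DH ortho a (x := x)). Qed.

Let o (b : nat) i j x := om (ord3 b) x i j.

Let omE (b : nat) x i j : U x -> (i < 3)%N -> (j < 3)%N ->
  om (ord3 b) x (ord3 i) (ord3 j) =
  cent (o b i0 i1 x) (o b i0 i2 x) (o b i1 i2 x) 0 b i j.
Proof.
by move=> Ux; exact: skew_cent (om_skew (ord3 b) Ux).
Qed.

Let C a x := om a x + KK a x.

Let CentE (b : nat) x i j : U x -> (b < 3)%N -> (i < 3)%N -> (j < 3)%N ->
  C (ord3 b) x (ord3 i) (ord3 j) =
  cent (o b i0 i1 x) (o b i0 i2 x) (o b i1 i2 x) (a6 x) b i j.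
Proof.
move=> Ux hb hi hj.
have addE (A B : 'M[R]_3) k l : (A + B) k l = A k l + B k l by rewrite mxE.
rewrite /C addE (omE b Ux hi hj) (KKE (ord3 b) Ux) [X in _ + X]mxE.
have -> : nat_of_ord (ord3 b) = b by move: b hb => [|[|[|b]]].
have -> : nat_of_ord (ord3 i) = i by move: i hi => [|[|[|b']]].
have -> : nat_of_ord (ord3 j) = j by move: j hj => [|[|[|b']]].
rewrite /cent; move: i j hi hj => [|[|[|i]]] [|[|[|j]]] //= _ _;
  by case: (b == 2%N); case: (b == 1%N); lra.
Qed.

Let Co b i j : Cinf_on U (o b i j) := Com (ord3 b) i j.

Let Ca : Cinf_on U a6.
Proof. by have [_ [_ [_ [? _]]]] := frame. Qed.

Let dX d b i j x := Dvec (e (ord3 d)) (o b i j) x.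

Let DCentE d (b : nat) x i j : U x -> (b < 3)%N -> (i < 3)%N -> (j < 3)%N ->
  Dmx (e (ord3 d)) (C (ord3 b)) x (ord3 i) (ord3 j) =
  cent (dX d b i0 i1 x) (dX d b i0 i2 x) (dX d b i1 i2 x)
    (Dvec (e (ord3 d)) a6 x) b i j.
Proof.
move=> Ux hb hi hj; rewrite [LHS]mxE.
have E1 := Dvec_eq oU (e (ord3 d)) (fun y Uy => CentE Uy hb hi hj) Ux.
exact (etrans E1 (Dvec_cent oU _ b i j (Co b i0 i1) (Co b i0 i2) (Co b i1 i2) Ca Ux)).
Qed.

Let flat x : U x -> forall b c i j,
  (b < 3)%N -> (c < 3)%N -> (i < 3)%N -> (j < 3)%N ->
  cent (dX b c i0 i1 x) (dX b c i0 i2 x) (dX b c i1 i2 x) (Dvec (e (ord3 b)) a6 x) c i j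
  - cent (dX c b i0 i1 x) (dX c b i0 i2 x) (dX c b i1 i2 x) (Dvec (e (ord3 c)) a6 x) b i j
  + sum3 (fun m => cent (o c i0 i1 x) (o c i0 i2 x) (o c i1 i2 x) (a6 x) c i m
      * cent (o b i0 i1 x) (o b i0 i2 x) (o b i1 i2 x) (a6 x) b m j)
  - sum3 (fun m => cent (o b i0 i1 x) (o b i0 i2 x) (o b i1 i2 x) (a6 x) b i m
      * cent (o c i0 i1 x) (o c i0 i2 x) (o c i1 i2 x) (a6 x) c m j)
  = sum3 (fun d => (cent (o b i0 i1 x) (o b i0 i2 x) (o b i1 i2 x) 0 b c d
      - cent (o c i0 i1 x) (o c i0 i2 x) (o c i1 i2 x) 0 c b d)
      * cent (o d i0 i1 x) (o d i0 i2 x) (o d i1 i2 x) (a6 x) d i j).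
Proof.
move=> Ux b c i j hb hc hi hj.
have F : Dmx (e (ord3 b)) (C (ord3 c)) x - Dmx (e (ord3 c)) (C (ord3 b)) x
    + C (ord3 c) x *m C (ord3 b) x - C (ord3 b) x *m C (ord3 c) x
    = \sum_d struct_const E lc (ord3 b) (ord3 c) x d *: C d x.
  exact (frame_flat oU CE Cdphi Cxim Clc Ckk uE DQ Dxi tors indep hhE (ord3 b) (ord3 c) Ux).
have HM b' i' j' hb' hi' hj' := @CentE b' x i' j' Ux hb' hi' hj'.
have Hs d : (d < 3)%N -> struct_const E lc (ord3 b) (ord3 c) x (ord3 d) =
    cent (o b i0 i1 x) (o b i0 i2 x) (o b i1 i2 x) 0 b c d
    - cent (o c i0 i1 x) (o c i0 i2 x) (o c i1 i2 x) 0 c b d.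
  move=> hd; exact (congr2 (fun u v => u - v) (omE b Ux hc hd) (omE c Ux hb hd)).
exact (curvature_entry F (DCentE b Ux hc hi hj) (DCentE c Ux hb hi hj)
  (Mv := fun b i j => cent (o b i0 i1 x) (o b i0 i2 x) (o b i1 i2 x) (a6 x) b i j) HM Hs hb hc hi hj).
Qed.

Let a6_neq0 x : U x -> a6 x != 0.
Proof.
move=> Ux; have [_ [_ [_ [_ /(_ x Ux) [_ [a0 _]]]]]] := frame.
by rewrite lt0r_neq0.
Qed.

Let s1 x (Ux : U x) := flat_cent_first_order (x := fun b => o b i0 i1 x) (y := fun b => o b i0 i2 x)
  (z := fun b => o b i1 i2 x) (Da := fun d => Dvec (e (ord3 d)) a6 x)
  (X := fun d b => dX d b i0 i1 x) (Y := fun d b => dX d b i0 i2 x)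
  (Z := fun d b => dX d b i1 i2 x) (a6_neq0 Ux) (flat Ux).

(** The first-order identities hold at every point of the open set [U], so both sides may be
    differentiated along the frame. *)
Let derived_identities x : U x -> forall d, (d < 3)%N ->
  dX d 0 i0 i1 x = 0 /\ dX d 0 i0 i2 x = 0 /\ dX d 2 i0 i1 x = - dX d 1 i0 i2 x /\
  dX d 2 i0 i2 x = dX d 1 i0 i1 x /\ dX d 0 i1 i2 x = dX d 1 i0 i2 x / 3.
Proof.
move=> Ux d _; rewrite /dX; set X := e (ord3 d).
have x0 y (Uy : U y) : o 0 i0 i1 y = 0 by exact (s1 Uy).1.1.
have y0 y (Uy : U y) : o 0 i0 i2 y = 0 by exact (s1 Uy).1.2.1.
have x2 y (Uy : U y) : o 2 i0 i1 y = - o 1 i0 i2 y by exact (s1 Uy).1.2.2.1.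
have y2 y (Uy : U y) : o 2 i0 i2 y = o 1 i0 i1 y by exact (s1 Uy).1.2.2.2.
have z0 y (Uy : U y) : o 0 i1 i2 y = o 1 i0 i2 y * 3^-1 by exact (s1 Uy).2.1.
split; first exact (etrans (Dvec_eq oU X x0 Ux) (Dvec_cst X 0 x)).
split; first exact (etrans (Dvec_eq oU X y0 Ux) (Dvec_cst X 0 x)).
split; first exact (etrans (Dvec_eq oU X x2 Ux) (DvecN oU X (Co 1 i0 i2) Ux)).
split; first exact (Dvec_eq oU X y2 Ux).
have dM := DvecM oU X (Co 1 i0 i2) (Cinf_cst oU (3^-1 : R)) Ux.
have E0 (u v w : R) : v = 0 -> u * 3^-1 + w * v = u / 3 by move=> ->; rewrite mulr0 addr0.
exact (etrans (Dvec_eq oU X z0 Ux) (etrans dM (E0 _ _ _ (Dvec_cst X (3^-1) x)))).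
Qed.

Let s2 x (Ux : U x) := flat_cent_second_order (x := fun b => o b i0 i1 x) (y := fun b => o b i0 i2 x)
  (z := fun b => o b i1 i2 x) (Da := fun d => Dvec (e (ord3 d)) a6 x)
  (X := fun d b => dX d b i0 i1 x) (Y := fun d b => dX d b i0 i2 x)
  (Z := fun d b => dX d b i1 i2 x) (a6_neq0 Ux) (flat Ux) (derived_identities Ux).

Let eT : e i0 = T. Proof. exact/funext/e0. Qed.
Let eV : e i1 = V. Proof. exact/funext/e1. Qed.
Let eW : e i2 = W. Proof. exact/funext/e2. Qed.

(** Pairing with a frame vector lowers the frame index, that is, multiplies by the Gram matrix; this
    reads the two invariant functions off the matrix [om i1]. *)
Let om_happ x b : U x -> happ x (nablahat phi xi V T x) (e b x) = (om i1 x *m Dg3 R) i0 b.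
Proof.
move=> Ux; rewrite nablahatE happE.
have -> : Dmx V T x + T x *m LCm phi xi (V x) x = row i0 (om i1 x *m E x).
  rewrite (frame_omE lc uE i1 Ux) linearD /= row_mul -/(e i0 x) e0 /lc e1.
  congr (_ + _); apply/rowP => k; rewrite [LHS]mxE [RHS]mxE [RHS]mxE.
  rewrite -[fun _ => row _ _]/(e i1) eV; congr (Dvec _ _ _).
  by apply/funext => y; rewrite mxE.
by rewrite -(ortho Ux) -mulmx_tr_entry !mulmxA.
Qed.

Let alpha22E x : U x -> alpha22 phi xi T V x = o 1 i0 i1 x.
Proof.
move=> Ux; rewrite /alpha22 -(e1 x) (om_happ i1 Ux).
have mulE (A B : 'M[R]_3) k l : (A *m B) k l = A k i0 * B i0 l + A k i1 * B i1 l + A k i2 * B i2 l.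
  by rewrite mxE sum_ord3.
rewrite mulE /o ![Dg3 R _ _]mxE /=; move: (om i1 x) => M.
by rewrite !mulr0 mulr1 add0r addr0.
Qed.

Let alpha23E x : U x -> alpha23 phi xi T V W x = o 1 i0 i2 x.
Proof.
move=> Ux; rewrite /alpha23 -(e2 x) (om_happ i2 Ux).
have mulE (A B : 'M[R]_3) k l : (A *m B) k l = A k i0 * B i0 l + A k i1 * B i1 l + A k i2 * B i2 l.
  by rewrite mxE sum_ord3.
rewrite mulE /o ![Dg3 R _ _]mxE /=; move: (om i1 x) => M.
by rewrite !mulr0 mulr1 !add0r.
Qed.

Lemma frame_unit x : U x ->
  (\matrix_(a < 3) nth 0 [:: T x; V x; W x] a : 'M[R]_3) \in unitmx.
Proof. exact: uE. Qed.

Lemma structure_equations : exists z1 z2 : 'rV[R]_3 -> R,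
  [/\ Cinf_on U (alpha22 phi xi T V), Cinf_on U (alpha23 phi xi T V W),
      Cinf_on U z1, Cinf_on U z2 &
      structure_eqs U T V W (alpha22 phi xi T V) (alpha23 phi xi T V W) z1 z2 a6].
Proof.
exists (o 1 i1 i2), (o 2 i1 i2); split.
- exact (Cinf_on_eq oU (fun x Ux => esym (alpha22E Ux)) (Co 1 i0 i1)).
- exact (Cinf_on_eq oU (fun x Ux => esym (alpha23E Ux)) (Co 1 i0 i2)).
- exact: Co.
- exact: Co.
split=> [f x Cf Ux|x Ux].
  rewrite (alpha22E Ux) (alpha23E Ux).
  have fc := frame_commutator oU CE uE tors _ _ Cf Ux.
  have c01 := fc i0 i1; have c02 := fc i0 i2; have c12 := fc i1 i2.
  have [[x0 [y0 [x2 y2]]] [z0 _]] := s1 Ux.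
  have sE (b c d : nat) : (b < 3)%N -> (c < 3)%N -> (d < 3)%N ->
      struct_const E lc (ord3 b) (ord3 c) x (ord3 d) =
      cent (o b i0 i1 x) (o b i0 i2 x) (o b i1 i2 x) 0 b c d
      - cent (o c i0 i1 x) (o c i0 i2 x) (o c i1 i2 x) 0 c b d.
    by move=> hb hc hd; exact (congr2 (fun u v => u - v) (omE b Ux hc hd) (omE c Ux hb hd)).
  move: c01 c02 c12; rewrite !sum_ord3.
  rewrite (sE 0 1 0)%N // (sE 0 1 1)%N // (sE 0 1 2)%N //.
  rewrite (sE 0 2 0)%N // (sE 0 2 1)%N // (sE 0 2 2)%N //.
  rewrite (sE 1 2 0)%N // (sE 1 2 1)%N // (sE 1 2 2)%N //.
  rewrite -[fun _ => row i0 _]/(e i0) -[fun _ => row i1 _]/(e i1) -[fun _ => row i2 _]/(e i2).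
  rewrite eT eV eW /= x0 y0 x2 y2 z0.
  move=> c01 c02 c12; split.
  - by rewrite c01; field.
  - by rewrite c02; field.
  - by rewrite c12; field.
have [[x0 [y0 [x2 y2]]] [z0 [d0 [d1 d2]]]] := s1 Ux.
have [[t1 t2] [[t3 t4] t5]] := s2 Ux.
have pE X := Dvec_eq oU X (fun y Uy => alpha22E Uy) Ux.
have qE X := Dvec_eq oU X (fun y Uy => alpha23E Uy) Ux.
rewrite (alpha22E Ux) (alpha23E Ux) !pE !qE.
rewrite /dX /= eT eV eW in d0 d1 d2 t1 t2 t3 t4 t5.
by [].
Qed.

End StructureEquations.

(** * Adapted coordinates *)

Section PolarDerivatives.
Variables (R : realType) (n : nat) (B : set 'rV[R]_n).
Hypothesis oB : open B.
Variables (p q a : 'rV[R]_n -> R) (c0 d0 : R).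
Hypotheses (Cp : Cinf_on B p) (Cq : Cinf_on B q) (Ca : Cinf_on B a).
Hypothesis c_gt0 : forall x, B x -> 0 < c0 * p x + d0 * q x.
Hypothesis a_gt0 : forall x, B x -> 0 < a x.
Implicit Type X : 'rV[R]_n -> 'rV[R]_n.

Definition pq_n2 x := p x * p x + q x * q x.
(** The real part [log |p + i q|] of the logarithm whose imaginary part, up to a constant, is
    [pq_arg]. *)
Definition pq_u x := 2^-1 * ln (pq_n2 x).
Definition pq_cos x := c0 * p x + d0 * q x.
Definition pq_sin x := c0 * q x + (- d0) * p x.
(* An argument of [p + i q] relative to [c0 + i d0]; [atan] suffices as
[pq_cos > 0]. *)
Definition pq_arg x := atan (pq_sin x * (pq_cos x)^-1).
Definition pq_t x := p x * (pq_n2 x)^-1.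
Definition pq_eta x := - (q x * (pq_n2 x)^-1).
(** Forced by the required form of [a6]: as [sqrt (t^2 + eta^2)] is [1 / |p + i q|], the exponential
    of [k] must be [a / |p + i q|]. *)
Definition pq_k x := ln (a x) - pq_u x.
(* [pq_m1 + i pq_m2] is a cube root of [a (p + i q)^2], up to a constant phase. *)
Definition pq_mod x := expR (3^-1 * ln (a x) + 2 / 3 * pq_u x).
Definition pq_m1 x := pq_mod x * cos (2 / 3 * pq_arg x).
Definition pq_m2 x := pq_mod x * sin (2 / 3 * pq_arg x).

Lemma pq_n2_gt0 x : B x -> 0 < pq_n2 x.
Proof.
move=> Bx; have := c_gt0 Bx; rewrite /pq_n2.
have [-> |p0 _] := eqVneq (p x) 0; last first.
  by rewrite ltr_pwDl// -expr2 ?sqr_ge0// exprn_even_gt0.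
have [-> |q0 _] := eqVneq (q x) 0; first by rewrite !mulr0 addr0 ltxx.
by rewrite mulr0 add0r -expr2 exprn_even_gt0.
Qed.

Let n2_neq0 x : B x -> pq_n2 x != 0.
Proof. by move=> Bx; rewrite lt0r_neq0// pq_n2_gt0. Qed.

Let cos_neq0 x : B x -> pq_cos x != 0.
Proof. by move=> Bx; rewrite lt0r_neq0// c_gt0. Qed.

Let a_neq0 x : B x -> a x != 0.
Proof. by move=> Bx; rewrite lt0r_neq0// a_gt0. Qed.

Let Cn2 : Cinf_on B pq_n2.
Proof. exact (CinfD oB (CinfM oB Cp Cp) (CinfM oB Cq Cq)). Qed.

Let Clnn2 : Cinf_on B (fun x => ln (pq_n2 x)).
Proof. exact (Cinf_ln oB Cn2 pq_n2_gt0). Qed.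

Let Clna : Cinf_on B (fun x => ln (a x)).
Proof. exact (Cinf_ln oB Ca a_gt0). Qed.

Lemma Cinf_pq_u : Cinf_on B pq_u.
Proof. exact (CinfM oB (Cinf_cst oB _) Clnn2). Qed.

Let Ccos : Cinf_on B pq_cos.
Proof. exact (CinfD oB (CinfM oB (Cinf_cst oB _) Cp) (CinfM oB (Cinf_cst oB _) Cq)). Qed.

Let Csin : Cinf_on B pq_sin.
Proof. exact (CinfD oB (CinfM oB (Cinf_cst oB _) Cq) (CinfM oB (Cinf_cst oB _) Cp)). Qed.

Let Ccosv := CinfV oB Ccos cos_neq0.
Let Cn2v := CinfV oB Cn2 n2_neq0.

Lemma Cinf_pq_arg : Cinf_on B pq_arg.
Proof. exact (Cinf_atan oB (CinfM oB Csin Ccosv)). Qed.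

Lemma Cinf_pq_t : Cinf_on B pq_t.
Proof. exact (CinfM oB Cp Cn2v). Qed.

Lemma Cinf_pq_eta : Cinf_on B pq_eta.
Proof. exact (CinfN oB (CinfM oB Cq Cn2v)). Qed.

Lemma Cinf_pq_k : Cinf_on B pq_k.
Proof. exact (CinfD oB Clna (CinfN oB Cinf_pq_u)). Qed.

Let Cexponent : Cinf_on B (fun x => 3^-1 * ln (a x) + 2 / 3 * pq_u x).
Proof.
exact (CinfD oB (CinfM oB (Cinf_cst oB _) Clna) (CinfM oB (Cinf_cst oB _) Cinf_pq_u)).
Qed.

Let Cmod : Cinf_on B pq_mod.
Proof. exact (Cinf_expR oB Cexponent). Qed.

Let Cang : Cinf_on B (fun x => 2 / 3 * pq_arg x).
Proof. exact (CinfM oB (Cinf_cst oB _) Cinf_pq_arg). Qed.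

Lemma Cinf_pq_m1 : Cinf_on B pq_m1.
Proof. exact (CinfM oB Cmod (Cinf_cos oB Cang)). Qed.

Lemma Cinf_pq_m2 : Cinf_on B pq_m2.
Proof. exact (CinfM oB Cmod (Cinf_sin oB Cang)). Qed.

Let DZ X (b : R) f x : Cinf_on B f -> B x ->
  Dvec X (fun y => b * f y) x = b * Dvec X f x.
Proof.
move=> Cf Bx; have := DvecM oB X (Cinf_cst oB b) Cf Bx.
by rewrite Dvec_cst mul0r add0r.
Qed.

Let Dn2 X x : B x -> Dvec X pq_n2 x = 2 * (p x * Dvec X p x + q x * Dvec X q x).
Proof.
move=> Bx; have E1 := DvecD oB X (CinfM oB Cp Cp) (CinfM oB Cq Cq) Bx.
have E2 := DvecM oB X Cp Cp Bx; have E3 := DvecM oB X Cq Cq Bx.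
apply: (etrans E1); rewrite E2 E3; ring.
Qed.

Lemma Dvec_pq_u X x : B x ->
  Dvec X pq_u x = (p x * Dvec X p x + q x * Dvec X q x) / pq_n2 x.
Proof.
move=> Bx; have n0 := n2_neq0 Bx.
have E1 := DZ X 2^-1 Clnn2 Bx.
have E2 := Dvec_comp1 oB X Cn2 Bx (is_derive1_ln (pq_n2_gt0 Bx)).
by apply: (etrans E1); rewrite E2 Dn2//; field.
Qed.

(** The sum of the squares of [pq_cos] and [pq_sin] is [(c0^2 + d0^2) |p + i q|^2], so the reference
    phase [c0 + i d0] drops out of the derivative. *)
Lemma Dvec_pq_arg X x : B x ->
  Dvec X pq_arg x = (p x * Dvec X q x - q x * Dvec X p x) / pq_n2 x.
Proof.
move=> Bx; have n0 := n2_neq0 Bx; have cn := cos_neq0 Bx.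
have E1 := Dvec_comp1 oB X (CinfM oB Csin Ccosv) Bx (is_derive1_atan _).
have E2 := DvecM oB X Csin Ccosv Bx.
have E3 := DvecV oB X Ccos cos_neq0 Bx.
have E4 : Dvec X pq_cos x = c0 * Dvec X p x + d0 * Dvec X q x.
  have e := DvecD oB X (CinfM oB (Cinf_cst oB c0) Cp) (CinfM oB (Cinf_cst oB d0) Cq) Bx.
  exact (etrans e (congr2 +%R (DZ X c0 Cp Bx) (DZ X d0 Cq Bx))).
have E5 : Dvec X pq_sin x = c0 * Dvec X q x + (- d0) * Dvec X p x.
  have e := DvecD oB X (CinfM oB (Cinf_cst oB c0) Cq) (CinfM oB (Cinf_cst oB (- d0)) Cp) Bx.
  exact (etrans e (congr2 +%R (DZ X c0 Cq Bx) (DZ X (- d0) Cp Bx))).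
apply: (etrans E1); rewrite E2 E3 E4 E5 /pq_sin.
move: cn n0; rewrite /pq_cos /pq_n2 => cn n0.
have S0 : (c0 * p x + d0 * q x) ^+ 2 + (c0 * q x + - d0 * p x) ^+ 2 != 0.
  by rewrite paddr_eq0 ?sqr_ge0// !sqrf_eq0 negb_and cn.
field.
by rewrite n0 cn S0.
Qed.

Lemma Dvec_pq_t X x : B x ->
  Dvec X pq_t x = ((q x * q x - p x * p x) * Dvec X p x - 2 * p x * q x * Dvec X q x) / (pq_n2 x * pq_n2 x).
Proof.
move=> Bx; have n0 := n2_neq0 Bx.
have E1 := DvecM oB X Cp Cn2v Bx; have E2 := DvecV oB X Cn2 n2_neq0 Bx.
apply: (etrans E1); rewrite E2 Dn2//.
by move: n0; rewrite /pq_n2 => n0; field.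
Qed.

Lemma Dvec_pq_eta X x : B x ->
  Dvec X pq_eta x = ((q x * q x - p x * p x) * Dvec X q x + 2 * p x * q x * Dvec X p x) / (pq_n2 x * pq_n2 x).
Proof.
move=> Bx; have n0 := n2_neq0 Bx.
have E0 := DvecN oB X (CinfM oB Cq Cn2v) Bx.
have E1 := DvecM oB X Cq Cn2v Bx; have E2 := DvecV oB X Cn2 n2_neq0 Bx.
apply: (etrans E0); rewrite E1 E2 Dn2//.
by move: n0; rewrite /pq_n2 => n0; field.
Qed.

Lemma Dvec_pq_k X x : B x -> Dvec X pq_k x = Dvec X a x / a x - Dvec X pq_u x.
Proof.
move=> Bx; have E0 := DvecB oB X Clna Cinf_pq_u Bx.
have E1 := Dvec_comp1 oB X Ca Bx (is_derive1_ln (a_gt0 Bx)).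
by apply: (etrans E0); rewrite E1 mulrC.
Qed.

Let Dmod X x : B x -> Dvec X pq_mod x =
  pq_mod x * (Dvec X a x / (3 * a x) + 2 / 3 * Dvec X pq_u x).
Proof.
move=> Bx; have a0 := a_neq0 Bx.
have E0 := Dvec_comp1 oB X Cexponent Bx (is_derive_expR _).
have E1 := DvecD oB X (CinfM oB (Cinf_cst oB 3^-1) Clna) (CinfM oB (Cinf_cst oB (2/3)) Cinf_pq_u) Bx.
have E2 := DZ X 3^-1 Clna Bx; have E3 := DZ X (2 / 3) Cinf_pq_u Bx.
have E4 := Dvec_comp1 oB X Ca Bx (is_derive1_ln (a_gt0 Bx)).
apply: (etrans E0); rewrite E1 E2 E3 E4 -/(pq_mod x); field.
exact: a0.
Qed.

Lemma Dvec_pq_m1 X x : B x -> Dvec X pq_m1 x =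
  pq_m1 x * (Dvec X a x / (3 * a x) + 2 / 3 * Dvec X pq_u x)
  - pq_m2 x * (2 / 3 * Dvec X pq_arg x).
Proof.
move=> Bx; have E0 := DvecM oB X Cmod (Cinf_cos oB Cang) Bx.
have E1 := Dvec_comp1 oB X Cang Bx (is_derive_cos _).
have E2 := DZ X (2 / 3) Cinf_pq_arg Bx.
apply: (etrans E0); rewrite E1 E2 Dmod// /pq_m1 /pq_m2.
move: (cos _) (sin _) (pq_mod x) => C S M.
ring.
Qed.

Lemma Dvec_pq_m2 X x : B x -> Dvec X pq_m2 x =
  pq_m2 x * (Dvec X a x / (3 * a x) + 2 / 3 * Dvec X pq_u x)
  + pq_m1 x * (2 / 3 * Dvec X pq_arg x).
Proof.
move=> Bx; have E0 := DvecM oB X Cmod (Cinf_sin oB Cang) Bx.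
have E1 := Dvec_comp1 oB X Cang Bx (is_derive_sin _).
have E2 := DZ X (2 / 3) Cinf_pq_arg Bx.
apply: (etrans E0); rewrite E1 E2 Dmod// /pq_m1 /pq_m2.
move: (cos _) (sin _) (pq_mod x) => C S M.
ring.
Qed.

Lemma pq_msqr x : pq_m1 x * pq_m1 x + pq_m2 x * pq_m2 x = pq_mod x * pq_mod x.
Proof.
have := cos2Dsin2 (2 / 3 * pq_arg x); rewrite /pq_m1 /pq_m2.
move: (cos _) (sin _) (pq_mod x) => C S M E.
have -> : M * C * (M * C) + M * S * (M * S) = M * M * (C ^+ 2 + S ^+ 2) by ring.
by rewrite E mulr1.
Qed.

Let expR_2u x : B x -> expR (2 * pq_u x) = pq_n2 x.
Proof. by move=> Bx; rewrite /pq_u mulrA divff// mul1r lnK// posrE pq_n2_gt0. Qed.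

(** In the exponent the logarithms of [a] cancel and [4/3 + 2/3 = 2] copies of [pq_u] remain.
    Dividing a rescaled Laplacian by the squared modulus of [m] thus introduces the factor
    [e^(-2k/3)]. *)
Lemma pq_mod_k x : B x -> pq_mod x * pq_mod x * expR (- (2 / 3) * pq_k x) = pq_n2 x.
Proof.
by move=> Bx; rewrite -expR_2u// -!expRD /pq_k; congr expR; field.
Qed.

Lemma pq_exp_k x : B x -> pq_n2 x * expR (2 * pq_k x) = a x * a x.
Proof.
move=> Bx; have lna : expR (ln (a x)) = a x by rewrite lnK// posrE a_gt0.
by rewrite -expR_2u// -expRD -lna -expRD /pq_k; congr expR; ring.
Qed.

Lemma pq_t_eta x : B x -> pq_t x ^+ 2 + pq_eta x ^+ 2 = (pq_n2 x)^-1.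
Proof.
by move=> Bx; have := n2_neq0 Bx; rewrite /pq_t /pq_eta /pq_n2 => n0; field.
Qed.

Lemma pq_sqrt x : B x -> a x = expR (pq_k x) / Num.sqrt (pq_t x ^+ 2 + pq_eta x ^+ 2).
Proof.
move=> Bx; have -> : Num.sqrt (pq_t x ^+ 2 + pq_eta x ^+ 2) = expR (- pq_u x).
  have -> : pq_t x ^+ 2 + pq_eta x ^+ 2 = expR (- pq_u x) ^+ 2.
    by rewrite pq_t_eta// -expR_2u// -expRN expr2 -expRD; congr expR; ring.
  by rewrite sqrtr_sqr ger0_norm ?expR_ge0.
by rewrite -expRN opprK -expRD /pq_k subrK lnK// posrE a_gt0.
Qed.

End PolarDerivatives.

Lemma Dvec_coord (R : realType) n (X : 'rV[R]_n -> 'rV[R]_n) k :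
  Dvec X (fun y : 'rV[R]_n => y 0 k) = fun x => X x 0 k.
Proof.
apply/funext => x; rewrite /Dvec (bigD1 k)//= pd_coordE eqxx mulr1.
by rewrite big1 ?addr0// => i ik; rewrite pd_coordE (negbTE ik) mulr0.
Qed.

(** * Closed one-forms prescribed on a frame *)

Section ClosedForms.
Variables (R : realType) (n : nat) (U : set 'rV[R]_n).
Hypothesis oU : open U.
Variables (E : 'rV[R]_n -> 'M[R]_n) (bb : 'I_n -> 'rV[R]_n -> R).
Hypotheses (CE : Cmx U E) (uE : forall x, U x -> E x \in unitmx).
Hypothesis Cbb : forall a, Cinf_on U (bb a).
Let e a x := row a (E x).
Hypothesis brackets : forall a b x, U x -> exists beta : 'I_n -> R,
  (forall f, Cinf_on U f ->
     Dvec (e a) (Dvec (e b) f) x - Dvec (e b) (Dvec (e a) f) x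
     = \sum_d beta d * Dvec (e d) f x) /\
  Dvec (e a) (bb b) x - Dvec (e b) (bb a) x = \sum_d beta d * bb d x.

(** The coordinate components of the one-form that takes the value [bb a] on the frame field
    [e a]. *)
Definition coord_form i x := \sum_a invmx (E x) i a * bb a x.

Lemma Cinf_coord_form i : Cinf_on U (coord_form i).
Proof.
have dE x : U x -> \det (E x) != 0 by move=> /uE; rewrite unitmxE unitfE.
exact (Cinf_sum oU _ _ (fun a => CinfM oU (Cinf_invmx oU i a CE dE) (Cbb a))).
Qed.

Lemma coord_form_frame a x : U x -> \sum_i E x a i * coord_form i x = bb a x.
Proof.
move=> Ux; pose v : 'cV[R]_n := \col_a bb a x.
have -> : bb a x = (E x *m (invmx (E x) *m v)) a 0 by rewrite mulKVmx ?uE// mxE.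
rewrite mxE; apply: eq_bigr => i _; congr (_ * _).
by rewrite mxE; apply: eq_bigr => d _; rewrite mxE.
Qed.

(* With [A] the antisymmetrized matrix of derivatives of the form, [E A E^T] is its
exterior derivative on pairs of frame fields, which vanishes by [brackets]. *)
Lemma coord_form_closed x i j : U x ->
  pd i (coord_form j) x = pd j (coord_form i) x.
Proof.
move=> Ux; set th := coord_form.
pose A : 'M[R]_n := \matrix_(i, j) (pd i (th j) x - pd j (th i) x).
suff A0 : A = 0.
  have := congr1 (fun M : 'M_n => M i j) A0; rewrite mxE mxE => /eqP.
  by rewrite subr_eq0 => /eqP.
have DE a b k : Dvec (e a) (fun y => E y b k) x = Dvec (e a) (Dvec (e b) (fun y => y 0 k)) x.
  by rewrite Dvec_coord; congr (Dvec _ _ _); apply/funext => y; rewrite mxE.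
have key a b : \sum_j E x b j * Dvec (e a) (th j) x =
    Dvec (e a) (bb b) x - \sum_j Dvec (e a) (fun y => E y b j) x * th j x.
  have h := Dvec_eq oU (e a) (fun y Uy => esym (coord_form_frame b Uy)) Ux.
  rewrite h (Dvec_sum oU (e a) _ (fun k => CinfM oU (CE b k) (Cinf_coord_form k)) Ux).
  rewrite -sumrB; apply: eq_bigr => k _.
  by rewrite (DvecM oU (e a) (CE b k) (Cinf_coord_form k) Ux) [X in _ = X - _]addrC addrK.
have EAE : E x *m A *m (E x)^T = 0.
  apply/matrixP => a b; rewrite [RHS]mxE.
  have -> : (E x *m A *m (E x)^T) a b =
      \sum_j E x b j * Dvec (e a) (th j) x - \sum_i E x a i * Dvec (e b) (th i) x.
    rewrite mxE; under eq_bigr do rewrite mxE mulr_suml.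
    have De c f : Dvec (e c) f x = \sum_k E x c k * pd k f x.
      by apply: eq_bigr => k _; rewrite mxE.
    under [X in _ = X - _]eq_bigr do rewrite De mulr_sumr.
    under [X in _ = _ - X]eq_bigr do rewrite De mulr_sumr.
    rewrite [X in _ = _ - X]exchange_big -sumrB /=; apply: eq_bigr => k _.
    rewrite -sumrB; apply: eq_bigr => l _; rewrite [A l k]mxE [_^T k b]mxE.
    ring.
  rewrite !key; have [beta [Hf Hb]] := brackets a b Ux.
  (* The bracket relation is applied to the coordinate functions, whose derivatives along [e b] are
     the entries of [E]. *)
  have Hsum : \sum_j Dvec (e a) (fun y => E y b j) x * th j x
      - \sum_j Dvec (e b) (fun y => E y a j) x * th j x = \sum_d beta d * bb d x.
    rewrite -sumrB.
    have step k : Dvec (e a) (fun y => E y b k) x * th k x - Dvec (e b) (fun y => E y a k) x * th k x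
        = \sum_d beta d * (E x d k * th k x).
      rewrite -mulrBl !DE (Hf _ (Cinf_coord oU k)) mulr_suml; apply: eq_bigr => d _.
      by rewrite Dvec_coord mxE mulrA.
    rewrite (eq_bigr _ (fun k _ => step k)) exchange_big /=; apply: eq_bigr => d _.
    by rewrite -mulr_sumr (coord_form_frame d Ux).
  have alg (u v s t w : R) : u - v = w -> s - t = w -> u - s - (v - t) = 0.
    by move=> h1 h2; lra.
  exact: alg Hb Hsum.
have := congr1 (fun M => invmx (E x) *m M *m invmx (E x)^T) EAE.
rewrite mulmx0 mul0mx -!mulmxA mulmxV ?unitmx_tr ?uE// mulmx1 mulmxA mulVmx ?uE//.
by rewrite mul1mx.
Qed.

End ClosedForms.

(** The ball is convex, so the mean value theorem applies on the segment from [y] to [y'], which is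
    parallel to the axis [k]. *)
Lemma constant_along_coordinate (R : realType) n (c y y' : 'rV[R]_n) (r : R) k
    (f : 'rV[R]_n -> R) :
  Cinf_on [set x | `|x - c| < r] f ->
  (forall x, `|x - c| < r -> pd k f x = 0) ->
  `|y - c| < r -> `|y' - c| < r -> (forall j, j != k -> y 0 j = y' 0 j) ->
  f y = f y'.
Proof.
move=> Cf df yr y'r E; set B := [set x | _] in Cf.
have oB : open B := @open_normball R n c r.
have [s s01|s s01 D] := @MVT_segment_unit R _ f y (y' - y).
  apply: diff_derivable; apply: (Cinf_differentiable oB Cf).
  exact: (ball_segment yr y'r s01).
have Bs : B (y + s *: (y' - y)) := ball_segment yr y'r s01.
move: D; rewrite subrKC (Cinf_deriveE _ oB Cf Bs) big1.
  by move/eqP; rewrite subr_eq0 => /eqP ->.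
move=> j _; have [->|jk] := eqVneq j k; first by rewrite df ?mulr0.
by rewrite [(y' - y) 0 j]mxE [X in _ + X]mxE (E j jk) subrr mul0r.
Qed.

(** * Transport of derivatives through a chart *)

Section Charts.
Variables (R : realType) (n : nat) (B O : set 'rV[R]_n) (psi chi : 'rV[R]_n -> 'rV[R]_n).
Hypotheses (oB : open B) (oO : open O) (Cpsi : Cinf_on B psi).
Hypothesis detJ : forall x, B x -> \det (Jac psi x) != 0.
Hypothesis chiB : forall y, O y -> B (chi y).
Hypothesis dchi : forall y k, O y -> differentiable (fun y => chi y 0 k) y.
Hypothesis pchi : forall y i k, O y ->
  pd i (fun y => chi y 0 k) y = invmx (Jac psi (chi y)) i k.

Lemma Cinf_chart g : Cinf_on B g -> Cinf_on O (fun y => g (chi y) : R).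
Proof.
have CJ i k : Cinf_on B (fun x => invmx (Jac psi x) i k).
  apply: (Cinf_invmx oB i k _ detJ) => i' j'.
  have -> : (fun x => Jac psi x i' j') = pd i' (fun y => psi y 0 j').
    by apply/funext => x; rewrite mxE.
  exact (Cinf_on_pd i' ((Cinf_on_coordP psi oB).1 Cpsi j')).
exact (Cinf_comp_pd (J := fun i k x => invmx (Jac psi x) i k) (g := g) oO oB chiB CJ dchi pchi).
Qed.

Lemma Cinf_chart_inv : Cinf_on O chi.
Proof. exact ((Cinf_on_coordP chi oO).2 (fun j => Cinf_chart (Cinf_coord oB j))). Qed.

Definition push (X : 'rV[R]_n -> 'rV[R]_n) (y : 'rV[R]_n) : 'rV[R]_n :=
  \row_k Dvec X (fun x => psi x 0 k) (chi y).

(** The chain rule for [chi], with the Jacobian and its inverse inserted to express [X] in the new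
    coordinates. *)
Lemma Dvec_chart X g y : Cinf_on B g -> O y ->
  Dvec X g (chi y) = Dvec (push X) (fun y => g (chi y)) y.
Proof.
move=> Cg Oy; pose J := Jac psi (chi y).
have uJ : J \in unitmx by rewrite unitmxE unitfE; exact (detJ (chiB Oy)).
pose G : 'cV[R]_n := \col_i pd i g (chi y).
have pdg k : pd k (fun y => g (chi y)) y = (invmx J *m G) k 0.
  rewrite (pd_chain k oB Cg (chiB Oy) (fun j => dchi j Oy)) mxE.
  by apply: eq_bigr => j _; rewrite (pchi k j Oy) [G j 0]mxE.
transitivity (\sum_i X (chi y) 0 i * (J *m (invmx J *m G)) i 0).
  by apply: eq_bigr => i _; rewrite (mulKVmx uJ) [G i 0]mxE.
under eq_bigr do rewrite mxE mulr_sumr.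
rewrite exchange_big; apply: eq_bigr => k _.
rewrite pdg [push X y 0 k]mxE /Dvec mulr_suml; apply: eq_bigr => i _.
by rewrite mulrA [J i k]mxE.
Qed.

End Charts.

(** * The Laplacian in a conformal frame *)

Section ConformalFrame.
Variables (R : realType) (O : set 'rV[R]_3) (X Y : 'rV[R]_3 -> 'rV[R]_3).
Variables (m1 m2 F : 'rV[R]_3 -> R).
Hypotheses (oO : open O) (C1 : Cinf_on O m1) (C2 : Cinf_on O m2) (CF : Cinf_on O F).
Hypotheses (X1 : forall y, O y -> X y 0 i1 = m1 y) (X2 : forall y, O y -> X y 0 i2 = m2 y).
Hypotheses (Y1 : forall y, O y -> Y y 0 i1 = - m2 y) (Y2 : forall y, O y -> Y y 0 i2 = m1 y).
Hypothesis F0 : forall y, O y -> pd i0 F y = 0.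

(** Since [pd i0] commutes with [pd i], the first derivatives of [F] are again killed by [pd i0], so
    the uncontrolled first components of [X] and [Y] stay invisible in second derivatives as
    well. *)
Let F0i i y : O y -> pd i0 (pd i F) y = 0.
Proof.
move=> Oy; rewrite (pd_comm i0 i oO CF Oy).
by rewrite (pd_open_eq (g := fun=> 0) i oO F0 Oy) pd_cst.
Qed.

Lemma Dvec_conformal y : O y ->
  Dvec X F y = m1 y * pd i1 F y + m2 y * pd i2 F y /\
  Dvec Y F y = - m2 y * pd i1 F y + m1 y * pd i2 F y.
Proof.
move=> Oy; rewrite /Dvec !sum_ord3 (F0 Oy) (X1 Oy) (X2 Oy) (Y1 Oy) (Y2 Oy).
by rewrite !mulr0 !add0r.
Qed.

(** Modulo the first coordinate, [X] and [Y] are a rotation and dilation of the coordinate fields,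
    so the mixed second derivatives cancel between the two squares. *)
Lemma conformal_laplacian y : O y ->
  Dvec X (Dvec X F) y + Dvec Y (Dvec Y F) y =
  (Dvec X m1 y - Dvec Y m2 y) * pd i1 F y + (Dvec X m2 y + Dvec Y m1 y) * pd i2 F y
  + (m1 y * m1 y + m2 y * m2 y) * (pd i1 (pd i1 F) y + pd i2 (pd i2 F) y).
Proof.
move=> Oy.
have CF1 := Cinf_on_pd i1 CF; have CF2 := Cinf_on_pd i2 CF.
have CN2 := CinfN oO C2.
have EX := Dvec_eq oO X (fun y Oy => (Dvec_conformal Oy).1) Oy.
have EY := Dvec_eq oO Y (fun y Oy => (Dvec_conformal Oy).2) Oy.
have EX' := DvecD oO X (CinfM oO C1 CF1) (CinfM oO C2 CF2) Oy.
have EY' := DvecD oO Y (CinfM oO CN2 CF1) (CinfM oO C1 CF2) Oy.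
have X11 := DvecM oO X C1 CF1 Oy; have X22 := DvecM oO X C2 CF2 Oy.
have Y21 := DvecM oO Y CN2 CF1 Oy; have Y12 := DvecM oO Y C1 CF2 Oy.
have YN := DvecN oO Y C2 Oy.
have -> := etrans EX (etrans EX' (congr2 +%R X11 X22)).
have -> := etrans EY (etrans EY' (congr2 +%R Y21 Y12)).
rewrite YN.
have D f : pd i0 f y = 0 ->
    Dvec X f y = m1 y * pd i1 f y + m2 y * pd i2 f y /\
    Dvec Y f y = - m2 y * pd i1 f y + m1 y * pd i2 f y.
  move=> f0; rewrite [Dvec X f y]/Dvec [Dvec Y f y]/Dvec !sum_ord3 f0.
  by rewrite (X1 Oy) (X2 Oy) (Y1 Oy) (Y2 Oy) !mulr0 !add0r.
have [-> ->] := D _ (F0i i1 Oy); have [-> ->] := D _ (F0i i2 Oy).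
move: (Dvec X m1 y) (Dvec X m2 y) (Dvec Y m1 y) (Dvec Y m2 y) => A1 A2 A3 A4.
move: (pd i1 (pd i1 F) y) (pd i1 (pd i2 F) y) (pd i2 (pd i1 F) y) (pd i2 (pd i2 F) y) => B1 B2 B3 B4.
move: (pd i1 F y) (pd i2 F y) (m1 y) (m2 y) => F1 F2 M1 M2.
ring.
Qed.

End ConformalFrame.

(** The lower right block is multiplication by a complex number of squared modulus [N], inverted by
    its conjugate over [N]; the first column of [M'] clears [s] and [s']. *)
Lemma conformal_block_unit (F : fieldType) (s s' m1 m2 : F) :
  m1 * m1 + m2 * m2 != 0 ->
  (\matrix_(i < 3, j < 3) nth 0 (nth [::] [:: [:: 1; 0; 0]; [:: s; m1; m2]; [:: s'; - m2; m1]] i) j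
    : 'M[F]_3) \in unitmx.
Proof.
move=> N0; set N := _ + _ in N0; set M := (X in X \in _).
pose M' : 'M[F]_3 := \matrix_(i < 3, j < 3) nth 0 (nth [::]
  [:: [:: 1; 0; 0]; [:: (m2 * s' - m1 * s) / N; m1 / N; - m2 / N];
      [:: (- m2 * s - m1 * s') / N; m2 / N; m1 / N]] i) j.
suff : M *m M' = 1%:M by move/mulmx1_unit => -[].
apply/matrixP; apply: ord3P; apply: ord3P; rewrite [LHS]mxE sum_ord3 !mxE /=.
all: by rewrite ?mulr1n ?mulr0n /N; field.
Qed.

(** * Construction of the chart by [t] and two potentials *)

Section AdaptedCoordinates.
Variables (R : realType) (c : 'rV[R]_3) (r : R).
Variables (T V W : 'rV[R]_3 -> 'rV[R]_3) (p q z1 z2 a : 'rV[R]_3 -> R).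
Let B := [set x : 'rV[R]_3 | `|x - c| < r].
Hypothesis r_gt0 : 0 < r.
Hypotheses (CT : Cinf_on B T) (CV : Cinf_on B V) (CW : Cinf_on B W).
Hypotheses (Cp : Cinf_on B p) (Cq : Cinf_on B q) (Ca : Cinf_on B a).
Hypotheses (Cz1 : Cinf_on B z1) (Cz2 : Cinf_on B z2).
Hypothesis a_gt0 : forall x, B x -> 0 < a x.
Hypothesis pos : forall x, B x -> 0 < p c * p x + q c * q x.
Let E x : 'M[R]_3 := \matrix_(i < 3) nth 0 [:: T x; V x; W x] i.
Hypothesis uE : forall x, B x -> E x \in unitmx.
Hypothesis S : structure_eqs B T V W p q z1 z2 a.

Let oB : open B := @open_normball R 3 c r.
Let Bc : B c. Proof. by rewrite /B /= subrr normr0. Qed.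

Let n2 := pq_n2 p q.
Let t := pq_t p q.
Let eta := pq_eta p q.
Let k := pq_k p q a.
Let u := pq_u p q.
Let arg := pq_arg p q (p c) (q c).
Let m1 := pq_m1 p q a (p c) (q c).
Let m2 := pq_m2 p q a (p c) (q c).
Let rho := pq_mod p q a.

Let n2_neq0 x : B x -> n2 x != 0.
Proof. by move=> Bx; rewrite lt0r_neq0// (pq_n2_gt0 pos). Qed.

Let a_neq0 x : B x -> a x != 0.
Proof. by move=> Bx; rewrite lt0r_neq0// a_gt0. Qed.

Let Ct : Cinf_on B t := Cinf_pq_t oB Cp Cq pos.
Let Ceta : Cinf_on B eta := Cinf_pq_eta oB Cp Cq pos.
Let Ck : Cinf_on B k := Cinf_pq_k oB Cp Cq Ca pos a_gt0.
Let Cu : Cinf_on B u := Cinf_pq_u oB Cp Cq pos.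
Let Carg : Cinf_on B arg := Cinf_pq_arg oB Cp Cq pos.
Let Cm1 : Cinf_on B m1 := Cinf_pq_m1 oB Cp Cq Ca pos a_gt0.
Let Cm2 : Cinf_on B m2 := Cinf_pq_m2 oB Cp Cq Ca pos a_gt0.

Let Dt X x (Bx : B x) := Dvec_pq_t oB Cp Cq pos X Bx.
Let Deta X x (Bx : B x) := Dvec_pq_eta oB Cp Cq pos X Bx.
Let Du X x (Bx : B x) := Dvec_pq_u oB Cp Cq pos X Bx.
Let Darg X x (Bx : B x) := Dvec_pq_arg oB Cp Cq pos X Bx.
Let Dk X x (Bx : B x) := Dvec_pq_k oB Cp Cq Ca pos a_gt0 X Bx.
Let Dm1 X x (Bx : B x) := Dvec_pq_m1 oB Cp Cq Ca pos a_gt0 X Bx.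
Let Dm2 X x (Bx : B x) := Dvec_pq_m2 oB Cp Cq Ca pos a_gt0 X Bx.

Let DTt x : B x -> Dvec T t x = 1.
Proof.
move=> Bx; have n0 := n2_neq0 Bx; have [_ [[Tp Tq _ _] _]] := S.2 x Bx.
rewrite Dt// Tp Tq; move: n0; rewrite /n2 /pq_n2 => n0.
by field.
Qed.

Let DTeta x : B x -> Dvec T eta x = 0.
Proof.
move=> Bx; have n0 := n2_neq0 Bx; have [_ [[Tp Tq _ _] _]] := S.2 x Bx.
rewrite Deta// Tp Tq; move: n0; rewrite /n2 /pq_n2 => n0.
by field.
Qed.

(** With [DWeta], this is the Cauchy-Riemann equation [(V + i W)(t + i eta) = 0], inherited from
    [p + i q] through inversion. *)
Let DVeta x : B x -> Dvec V eta x = - Dvec W t x.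
Proof.
move=> Bx; have n0 := n2_neq0 Bx; have [_ [[_ _ Vp Vq] _]] := S.2 x Bx.
rewrite Deta// Dt// Vp Vq; move: n0; rewrite /n2 /pq_n2 => n0.
by field.
Qed.

Let DWeta x : B x -> Dvec W eta x = Dvec V t x.
Proof.
move=> Bx; have n0 := n2_neq0 Bx; have [_ [[_ _ Vp Vq] _]] := S.2 x Bx.
rewrite Deta// Dt// Vp Vq; move: n0; rewrite /n2 /pq_n2 => n0.
by field.
Qed.

Let DTarg x : B x -> Dvec T arg x = - q x.
Proof.
move=> Bx; have n0 := n2_neq0 Bx; have [_ [[Tp Tq _ _] _]] := S.2 x Bx.
rewrite Darg// Tp Tq; move: n0; rewrite /n2 /pq_n2 => n0.
by field.
Qed.

Let DTu x : B x -> Dvec T u x = - p x.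
Proof.
move=> Bx; have n0 := n2_neq0 Bx; have [_ [[Tp Tq _ _] _]] := S.2 x Bx.
rewrite Du// Tp Tq; move: n0; rewrite /n2 /pq_n2 => n0.
by field.
Qed.

(** With [DWu], the Cauchy-Riemann equation for the logarithm of [p + i q]. *)
Let DVu x : B x -> Dvec V u x = Dvec W arg x.
Proof.
move=> Bx; have [_ [[_ _ Vp Vq] _]] := S.2 x Bx.
rewrite Du// Darg// Vp Vq; congr (_ / _); ring.
Qed.

Let DWu x : B x -> Dvec W u x = - Dvec V arg x.
Proof.
move=> Bx; have [_ [[_ _ Vp Vq] _]] := S.2 x Bx.
rewrite Du// Darg// Vp Vq -mulNr; congr (_ / _); ring.
Qed.

Let DTk x : B x -> Dvec T k x = 0.
Proof.
move=> Bx; have a0 := a_neq0 Bx; have [[Ta _ _] _] := S.2 x Bx.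
rewrite Dk// -/u DTu// Ta; by field.
Qed.

Let DVk x : B x -> Dvec V k x = - 3 * z2 x - Dvec W arg x.
Proof.
move=> Bx; have a0 := a_neq0 Bx; have [[_ Va _] _] := S.2 x Bx.
rewrite Dk// -/u DVu// Va; by field.
Qed.

Let DWk x : B x -> Dvec W k x = 3 * z1 x + Dvec V arg x.
Proof.
move=> Bx; have a0 := a_neq0 Bx; have [[_ _ Wa] _] := S.2 x Bx.
rewrite Dk// -/u DWu// Wa; by field.
Qed.

Let DTm1 x : B x -> Dvec T m1 x = - p x * m1 x + 2 / 3 * q x * m2 x.
Proof.
move=> Bx; have a0 := a_neq0 Bx; have [[Ta _ _] _] := S.2 x Bx.
rewrite Dm1// -/u -/arg -/m1 -/m2 DTu// DTarg// Ta; by field.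
Qed.

Let DTm2 x : B x -> Dvec T m2 x = - p x * m2 x - 2 / 3 * q x * m1 x.
Proof.
move=> Bx; have a0 := a_neq0 Bx; have [[Ta _ _] _] := S.2 x Bx.
rewrite Dm2// -/u -/arg -/m1 -/m2 DTu// DTarg// Ta; by field.
Qed.

(** With [Dm_im], this says [(V + i W) m = i (z1 + i z2) m]: the power of [p + i q] is annihilated,
    and only the derivative of [log a] contributes, a third of [3 i (z1 + i z2)]. It yields the
    closedness of the forms and removes the first-order terms of the Laplacian. *)
Let Dm_re x : B x -> Dvec V m1 x - Dvec W m2 x = - z2 x * m1 x - z1 x * m2 x.
Proof.
move=> Bx; have a0 := a_neq0 Bx; have [[_ Va Wa] _] := S.2 x Bx.
rewrite Dm1// Dm2// -/u -/arg -/m1 -/m2 DVu// DWu// Va Wa; by field.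
Qed.

Let Dm_im x : B x -> Dvec V m2 x + Dvec W m1 x = z1 x * m1 x - z2 x * m2 x.
Proof.
move=> Bx; have a0 := a_neq0 Bx; have [[_ Va Wa] _] := S.2 x Bx.
rewrite Dm1// Dm2// -/u -/arg -/m1 -/m2 DVu// DWu// Va Wa; by field.
Qed.

(** By Cauchy-Riemann [V V eta + W W eta] is minus the bracket of [V] and [W] on [t]; since
    [T t = 1] its [T] component gives [- 2 q], and its other components cancel the [z1], [z2]
    terms. *)
Let lap_eta x : B x -> Dvec V (Dvec V eta) x + Dvec W (Dvec W eta) x
  + z2 x * Dvec V eta x - z1 x * Dvec W eta x = - 2 * q x.
Proof.
move=> Bx.
have E1 := Dvec_eq oB V (fun y By => DVeta By) Bx.
have E2 := Dvec_eq oB W (fun y By => DWeta By) Bx.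
have E3 := DvecN oB V (Cinf_Dvec oB CW Ct) Bx.
have [_ _ br] := S.1 t x Ct Bx.
rewrite E1 E2 E3 (DVeta Bx) (DWeta Bx).
move: br; rewrite (DTt Bx) mulr1.
move: (Dvec V (Dvec W t) x) (Dvec W (Dvec V t) x) => A1 A2.
move=> br; have -> : A1 = A1 - A2 + A2 by ring.
rewrite br; ring.
Qed.

(** Derivatives of [k] involve [z1], [z2] and the argument: the Gauss equation settles the former,
    the bracket on [arg] with [T arg = - q] the latter. The [2 q^2] from the bracket cancels the
    excess [2/3 q^2] of the Gauss equation, taken three times. *)
Let lap_k x : B x -> Dvec V (Dvec V k) x + Dvec W (Dvec W k) x
  + z2 x * Dvec V k x - z1 x * Dvec W k x = 6 * a x * a x - 3 * n2 x.
Proof.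
move=> Bx.
have CWarg := Cinf_Dvec oB CW Carg; have CVarg := Cinf_Dvec oB CV Carg.
have C3z2 := CinfM oB (Cinf_cst oB (- 3)) Cz2.
have C3z1 := CinfM oB (Cinf_cst oB 3) Cz1.
have E1 := etrans (Dvec_eq oB V (fun y By => DVk By) Bx) (DvecB oB V C3z2 CWarg Bx).
have E2 := etrans (Dvec_eq oB W (fun y By => DWk By) Bx) (DvecD oB W C3z1 CVarg Bx).
have E3 := DvecM oB V (Cinf_cst oB (- 3)) Cz2 Bx.
have E4 := DvecM oB W (Cinf_cst oB 3) Cz1 Bx.
have [_ _ br] := S.1 arg x Carg Bx.
have [_ [_ gauss]] := S.2 x Bx.
rewrite E1 E2 E3 E4 !Dvec_cst (DVk Bx) (DWk Bx).
move: br gauss; rewrite (DTarg Bx) /n2 /pq_n2.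
move: (Dvec V (Dvec W arg) x) (Dvec W (Dvec V arg) x) (Dvec V z2 x) (Dvec W z1 x) => A1 A2 A3 A4.
move=> br gauss.
have -> : A1 = 2 * q x * - q x - z1 x * Dvec V arg x - z2 x * Dvec W arg x + A2 by rewrite -br; ring.
have -> : A3 = p x * p x + q x * q x + 2 / 3 * (q x * q x) - 2 * a x * a x
  - z2 x * z2 x - z1 x * z1 x + A4 by rewrite -gauss; ring.
by field.
Qed.

(** The three conditions say that the form with values [bb] on [T], [V], [W] has zero exterior
    derivative, evaluated through the brackets of [structure_eqs]. Antisymmetry handles the
    remaining pairs of frame fields. *)
Let frame_potential (bb : 'I_3 -> 'rV[R]_3 -> R) :
  (forall a, Cinf_on B (bb a)) ->
  (forall x, B x ->
    [/\ Dvec T (bb i1) x - Dvec V (bb i0) x = - p x * bb i1 x - 2 / 3 * q x * bb i2 x,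
        Dvec T (bb i2) x - Dvec W (bb i0) x = 2 / 3 * q x * bb i1 x - p x * bb i2 x &
        Dvec V (bb i2) x - Dvec W (bb i1) x =
          2 * q x * bb i0 x - z1 x * bb i1 x - z2 x * bb i2 x]) ->
  exists2 F, Cinf_on B F & forall x, B x ->
    [/\ Dvec T F x = bb i0 x, Dvec V F x = bb i1 x & Dvec W F x = bb i2 x].
Proof.
move=> Cbb Hbb.
have rE0 : (fun x => row i0 (E x)) = T by apply/funext => x; rewrite rowK.
have rE1 : (fun x => row i1 (E x)) = V by apply/funext => x; rewrite rowK.
have rE2 : (fun x => row i2 (E x)) = W by apply/funext => x; rewrite rowK.
have CE : Cmx B E.
  apply: ord3P => j.
  - have -> : (fun x => E x i0 j) = (fun x => T x 0 j) by apply/funext => x; rewrite mxE.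
    exact ((Cinf_on_coordP T oB).1 CT j).
  - have -> : (fun x => E x i1 j) = (fun x => V x 0 j) by apply/funext => x; rewrite mxE.
    exact ((Cinf_on_coordP V oB).1 CV j).
  - have -> : (fun x => E x i2 j) = (fun x => W x 0 j) by apply/funext => x; rewrite mxE.
    exact ((Cinf_on_coordP W oB).1 CW j).
pose e a x := row a (E x).
pose P a b x := exists beta : 'I_3 -> R,
  (forall f, Cinf_on B f ->
     Dvec (e a) (Dvec (e b) f) x - Dvec (e b) (Dvec (e a) f) x
     = \sum_d beta d * Dvec (e d) f x) /\
  Dvec (e a) (bb b) x - Dvec (e b) (bb a) x = \sum_d beta d * bb d x.
have Prefl a0 x : P a0 a0 x.
  exists (fun=> 0); split=> [f Cf|]; rewrite subrr big1// => d _; exact: mul0r.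
have Psym a0 b x : P a0 b x -> P b a0 x.
  move=> [beta [H1 H2]]; exists (fun d => - beta d); split=> [f Cf|].
    by rewrite -opprB (H1 f Cf) -sumrN; apply: eq_bigr => d _; rewrite mulNr.
  by rewrite -opprB H2 -sumrN; apply: eq_bigr => d _; rewrite mulNr.
have P01 x : B x -> P i0 i1 x.
  move=> Bx; exists (fun d => nth 0 [:: 0; - p x; - (2 / 3 * q x)] d); have [h _ _] := Hbb x Bx.
  split=> [f Cf|]; rewrite sum_ord3 /e /= rE0 rE1 ?rE2; last by rewrite h; ring.
  have [-> _ _] := S.1 f x Cf Bx; ring.
have P02 x : B x -> P i0 i2 x.
  move=> Bx; exists (fun d => nth 0 [:: 0; 2 / 3 * q x; - p x] d); have [_ h _] := Hbb x Bx.
  split=> [f Cf|]; rewrite sum_ord3 /e /= rE0 rE2 ?rE1; last by rewrite h; ring.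
  have [_ -> _] := S.1 f x Cf Bx; ring.
have P12 x : B x -> P i1 i2 x.
  move=> Bx; exists (fun d => nth 0 [:: 2 * q x; - z1 x; - z2 x] d); have [_ _ h] := Hbb x Bx.
  split=> [f Cf|]; rewrite sum_ord3 /e /= rE1 rE2 ?rE0; last by rewrite h; ring.
  have [_ _ ->] := S.1 f x Cf Bx; ring.
have br a0 b x : B x -> P a0 b x.
  move=> Bx; move: a0 b; apply: ord3P; apply: ord3P.
  - exact: Prefl.
  - exact (P01 x Bx).
  - exact (P02 x Bx).
  - exact (Psym _ _ _ (P01 x Bx)).
  - exact: Prefl.
  - exact (P12 x Bx).
  - exact (Psym _ _ _ (P02 x Bx)).
  - exact (Psym _ _ _ (P12 x Bx)).
  - exact: Prefl.
have [F CF HF] := poincare (Cinf_coord_form oB CE uE Cbb)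
  (fun x i j => @coord_form_closed R 3 B oB E bb CE uE Cbb br x i j).
exists F => // x Bx.
have key a0 : Dvec (e a0) F x = bb a0 x.
  rewrite -(coord_form_frame bb uE a0 Bx); apply: eq_bigr => i _.
  by rewrite (HF x i Bx) mxE.
by rewrite -!key /e rE0 rE1 rE2.
Qed.

(** In complex form [T (v + i w) = 0], [V (v + i w) = m] and [W (v + i w) = i m], so [v + i w] is
    holomorphic for [V + i W]. Integrability uses [DTm1] and [DTm2] on pairs with [T], and [Dm_re]
    and [Dm_im] on [V], [W]. *)
Let potentials : exists v w,
  [/\ Cinf_on B v, Cinf_on B w,
     forall x, B x -> [/\ Dvec T v x = 0, Dvec V v x = m1 x & Dvec W v x = - m2 x] &
     forall x, B x -> [/\ Dvec T w x = 0, Dvec V w x = m2 x & Dvec W w x = m1 x]].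
Proof.
have C0 : Cinf_on B (fun=> 0 : R) := Cinf_cst oB 0.
have [|x Bx|v Cv Hv] := @frame_potential
  (fun a => nth (fun=> 0) [:: fun=> 0; m1; fun x => - m2 x] a).
- apply: ord3P => /=; [exact C0 | exact Cm1 | exact (CinfN oB Cm2)].
- rewrite /= !Dvec_cst (DvecN oB T Cm2 Bx) (DvecN oB V Cm2 Bx) (DTm1 Bx) (DTm2 Bx).
  split; [by ring | by ring |].
  have -> : - Dvec V m2 x - Dvec W m1 x = - (Dvec V m2 x + Dvec W m1 x) by ring.
  by rewrite (Dm_im Bx); ring.
have [|x Bx|w Cw Hw] := @frame_potential
  (fun a => nth (fun=> 0) [:: fun=> 0; m2; m1] a).
- apply: ord3P => /=; [exact C0 | exact Cm2 | exact Cm1].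
- rewrite /= !Dvec_cst (DTm1 Bx) (DTm2 Bx).
  split; [by ring | by ring |].
  by rewrite (Dm_re Bx); ring.
by exists v, w.
Qed.

(* The functions [eta] and [k] do not depend on [t]; as functions of two variables
they are read off on the slice through the image of [c]. *)
Lemma adapted_chart :
  exists (O : set 'rV[R]_3) (chi psi : 'rV[R]_3 -> 'rV[R]_3) (eta k : R -> R -> R),
    [/\ open O, open (chi @` O), chi @` O `<=` B & (chi @` O) c] /\
    [/\ Cinf_on O chi, Cinf_on (chi @` O) psi,
        (forall y, O y -> psi (chi y) = y) &
        (forall x, (chi @` O) x -> chi (psi x) = x)] /\
    Cinf_on O (fun y => eta (y 0 i1) (y 0 i2)) /\
    Cinf_on O (fun y => k (y 0 i1) (y 0 i2)) /\
    forall y, O y ->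
      let t := y 0 i0 in let v := y 0 i1 in let w := y 0 i2 in
      let etaf := fun z : 'rV[R]_3 => eta (z 0 i1) (z 0 i2) in
      let kf := fun z : 'rV[R]_3 => k (z 0 i1) (z 0 i2) in
      [/\ p (chi y) = t / (t ^+ 2 + eta v w ^+ 2),
          q (chi y) = - eta v w / (t ^+ 2 + eta v w ^+ 2),
          a (chi y) = expR (k v w) / Num.sqrt (t ^+ 2 + eta v w ^+ 2),
          pd i1 (pd i1 etaf) y + pd i2 (pd i2 etaf) y
            = 2 * expR (- (2 / 3) * k v w) * eta v w &
          pd i1 (pd i1 kf) y + pd i2 (pd i2 kf) y
            = 3 * expR (- (2 / 3) * k v w) * (2 * expR (2 * k v w) - 1)].
Proof.
have [v [w [Cv Cw Hv Hw]]] := potentials.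
pose psi x : 'rV[R]_3 := \row_j nth 0 [:: t x; v x; w x] j.
have psi0 : (fun x => psi x 0 i0) = t by apply/funext => x; rewrite mxE.
have psi1 : (fun x => psi x 0 i1) = v by apply/funext => x; rewrite mxE.
have psi2 : (fun x => psi x 0 i2) = w by apply/funext => x; rewrite mxE.
have Cpsi : Cinf_on B psi.
  apply: (Cinf_on_coordP psi oB).2; apply: ord3P.
  - rewrite psi0; exact Ct.
  - rewrite psi1; exact Cv.
  - rewrite psi2; exact Cw.
have N_gt0 x : 0 < m1 x * m1 x + m2 x * m2 x.
  have -> : m1 x * m1 x + m2 x * m2 x = rho x * rho x := pq_msqr p q a (p c) (q c) x.
  by rewrite mulr_gt0 ?expR_gt0.
(* Read in the frame, the Jacobian is block triangular: [T] sends [(t, v, w)] to [(1, 0, 0)], and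
   [V], [W] contribute the conformal block of determinant [|m|^2]. *)
have detJ x : B x -> \det (Jac psi x) != 0.
  move=> Bx; have EJ : E x *m Jac psi x = \matrix_(i < 3, j < 3) nth 0 (nth [::]
      [:: [:: 1; 0; 0]; [:: Dvec V t x; m1 x; m2 x]; [:: Dvec W t x; - m2 x; m1 x]] i) j.
    have [v0 v1 v2] := Hv x Bx; have [w0 w1 w2] := Hw x Bx.
    have ent i j : (E x *m Jac psi x) i j =
        Dvec (fun x => row i (E x)) (fun x => psi x 0 j) x.
      rewrite mxE; apply: eq_bigr => l _; rewrite [Jac psi x l j]mxE.
      by congr (_ * _); rewrite [RHS]mxE.
    have rE0 : (fun x => row i0 (E x)) = T by apply/funext => y; rewrite rowK.
    have rE1 : (fun x => row i1 (E x)) = V by apply/funext => y; rewrite rowK.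
    have rE2 : (fun x => row i2 (E x)) = W by apply/funext => y; rewrite rowK.
    apply/matrixP => i j; rewrite ent [RHS]mxE; move: i j.
    apply: ord3P; apply: ord3P; rewrite ?rE0 ?rE1 ?rE2 ?psi0 ?psi1 ?psi2 //=.
    exact (DTt Bx).
  have := conformal_block_unit (Dvec V t x) (Dvec W t x) (lt0r_neq0 (N_gt0 x)).
  by rewrite -EJ unitmxE unitfE det_mulmx mulf_eq0 negb_or => /andP[].
have [r' [chi]] := inverse_function oB Bc Cpsi detJ.
set O := [set y | _].
move=> [[r'0 oI chic] [chiBpsi dchi pchi]].
have oO : open O := @open_normball R 3 (psi c) r'.
have chiB y : O y -> B (chi y) by move=> Oy; exact: (chiBpsi y Oy).1.
have psichi y : O y -> psi (chi y) = y by move=> Oy; exact: (chiBpsi y Oy).2.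
have Oc : O (psi c) by rewrite /O /= subrr normr0.
have Cchart := Cinf_chart oB oO Cpsi detJ chiB dchi pchi.
have Dchart X g y := @Dvec_chart R 3 B O psi chi oB detJ chiB dchi pchi X g y.
have pushV y : O y -> push psi chi V y 0 i1 = m1 (chi y) /\ push psi chi V y 0 i2 = m2 (chi y).
  by move=> Oy; have [_ hv _] := Hv _ (chiB y Oy); have [_ hw _] := Hw _ (chiB y Oy); rewrite !mxE psi1 psi2.
have pushW y : O y -> push psi chi W y 0 i1 = - m2 (chi y) /\ push psi chi W y 0 i2 = m1 (chi y).
  by move=> Oy; have [_ _ hv] := Hv _ (chiB y Oy); have [_ _ hw] := Hw _ (chiB y Oy); rewrite !mxE psi1 psi2.
(* In the chart [T] is the first coordinate field, as it sends [(t, v, w)] to [(1, 0, 0)]. *)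
have pd0 f y : Cinf_on B f -> (forall x, B x -> Dvec T f x = 0) -> O y ->
    pd i0 (fun y => f (chi y)) y = 0.
  move=> Cf Tf Oy; rewrite -(Tf _ (chiB y Oy)) (Dchart T f y Cf Oy) /Dvec sum_ord3 !mxE.
  have [v0 _ _] := Hv _ (chiB y Oy); have [w0 _ _] := Hw _ (chiB y Oy).
  by rewrite psi0 psi1 psi2 v0 w0 (DTt (chiB y Oy)) mul1r !mul0r !addr0.
pose slice b d : 'rV[R]_3 := \row_j nth 0 [:: psi c 0 i0; b; d] j.
(* [O] is a ball for the sup norm, hence a cube: replacing the first coordinate by that of the
   centre stays inside it. *)
have sliceO y : O y -> O (slice (y 0 i1) (y 0 i2)).
  move=> Oy; apply: rV_norm_lt => // j; rewrite mxE [X in _ + X]mxE mxE; move: j.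
  have yc j : `|y 0 j - psi c 0 j| < r'.
    have := rV_coord_le (y - psi c) j; rewrite mxE [X in _ + X]mxE => h.
    exact (le_lt_trans h Oy).
  by apply: ord3P; rewrite /= ?subrr ?normr0.
(* For [f] killed by [T], the first-order terms of [conformal_laplacian], evaluated by [Dm_re] and
   [Dm_im], are exactly offset by [z2 V f - z1 W f]. *)
have flat f : Cinf_on B f -> (forall x, B x -> Dvec T f x = 0) ->
    let ff := fun z : 'rV[R]_3 => f (chi (slice (z 0 i1) (z 0 i2))) in
    [/\ forall y, O y -> ff y = f (chi y), Cinf_on O ff &
      forall y, O y -> (rho (chi y) * rho (chi y)) * (pd i1 (pd i1 ff) y + pd i2 (pd i2 ff) y)
       = Dvec V (Dvec V f) (chi y) + Dvec W (Dvec W f) (chi y)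
         + z2 (chi y) * Dvec V f (chi y) - z1 (chi y) * Dvec W f (chi y)].
  move=> Cf Tf ff; have Cg := Cchart f Cf.
  have ffE y : O y -> ff y = f (chi y).
    move=> Oy; apply: (@constant_along_coordinate R 3 (psi c) _ _ r' i0 (fun y => f (chi y)) Cg).
    - by move=> z Oz; exact (pd0 f z Cf Tf Oz).
    - exact (sliceO y Oy).
    - exact Oy.
    - by apply: ord3P => //= _; rewrite mxE.
  split=> [//||y Oy]; first exact (Cinf_on_eq oO (fun y Oy => esym (ffE y Oy)) Cg).
  have CVf := Cinf_Dvec oB CV Cf; have CWf := Cinf_Dvec oB CW Cf.
  set g := fun y => f (chi y) in Cg.
  have pdff i z : O z -> pd i ff z = pd i g z := fun Oz => pd_open_eq i oO ffE Oz.
  rewrite (pd_open_eq i1 oO (pdff i1) Oy) (pd_open_eq i2 oO (pdff i2) Oy).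
  have Cm1' := Cchart m1 Cm1; have Cm2' := Cchart m2 Cm2.
  have X1 z Oz := (pushV z Oz).1; have X2 z Oz := (pushV z Oz).2.
  have Y1 z Oz := (pushW z Oz).1; have Y2 z Oz := (pushW z Oz).2.
  have g0 z : O z -> pd i0 g z = 0 := fun Oz => pd0 f z Cf Tf Oz.
  have EV := Dchart V (Dvec V f) y CVf Oy; have EW := Dchart W (Dvec W f) y CWf Oy.
  rewrite EV EW.
  have -> := Dvec_eq oO (push psi chi V) (fun z Oz => Dchart V f z Cf Oz) Oy.
  have -> := Dvec_eq oO (push psi chi W) (fun z Oz => Dchart W f z Cf Oz) Oy.
  have -> := conformal_laplacian oO Cm1' Cm2' Cg X1 X2 Y1 Y2 g0 Oy.
  have -> := Dchart V f y Cf Oy; have -> := Dchart W f y Cf Oy.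
  have [-> ->] := Dvec_conformal X1 X2 Y1 Y2 g0 Oy.
  have By := chiB y Oy.
  have re := Dm_re By; have im := Dm_im By.
  rewrite -(Dchart V m1 y Cm1 Oy) -(Dchart V m2 y Cm2 Oy).
  rewrite -(Dchart W m1 y Cm1 Oy) -(Dchart W m2 y Cm2 Oy) re im.
  have <- : m1 (chi y) * m1 (chi y) + m2 (chi y) * m2 (chi y) = rho (chi y) * rho (chi y).
    exact: pq_msqr.
  move: (pd i1 g y) (pd i2 g y) (pd i1 (pd i1 g) y) (pd i2 (pd i2 g) y).
  move: (m1 (chi y)) (m2 (chi y)) (z1 (chi y)) (z2 (chi y)) => M1 M2 Z1 Z2 F1 F2 F11 F22.
  ring.
have [etaE Ceta2 lapeta] := flat eta Ceta (fun x Bx => DTeta Bx).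
have [kE Ck2 lapk] := flat k Ck (fun x Bx => DTk Bx).
exists O, chi, psi, (fun b d => eta (chi (slice b d))), (fun b d => k (chi (slice b d))).
have IB : chi @` O `<=` B by move=> _ [y Oy <-]; exact: chiB.
split; first by split=> //; exists (psi c).
split.
  split=> //.
  - exact (Cinf_chart_inv oB oO Cpsi detJ chiB dchi pchi).
  - exact (Cinf_on_sub IB Cpsi).
  - by move=> _ [y Oy <-]; rewrite psichi.
split; [exact Ceta2 | split; [exact Ck2 |]].
move=> y Oy t' v' w' etaf kf.
have By := chiB y Oy; have n0 := n2_neq0 By.
have tE : t' = t (chi y) by rewrite /t' -[in LHS](psichi y Oy) mxE.
have eE : eta (chi (slice v' w')) = eta (chi y) := etaE y Oy.
have kE' : k (chi (slice v' w')) = k (chi y) := kE y Oy.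
have le := lapeta y Oy; have lk := lapk y Oy.
rewrite (lap_eta By) in le; rewrite (lap_k By) in lk.
rewrite eE kE' tE.
have mk : rho (chi y) * rho (chi y) * expR (- (2 / 3) * k (chi y)) = n2 (chi y).
  exact: (pq_mod_k a pos By).
have ek : n2 (chi y) * expR (2 * k (chi y)) = a (chi y) * a (chi y) := pq_exp_k pos a_gt0 By.
have te : t (chi y) ^+ 2 + eta (chi y) ^+ 2 = (n2 (chi y))^-1 := pq_t_eta pos By.
have N0 : rho (chi y) * rho (chi y) != 0 by rewrite mulf_neq0 ?expR_eq0 ?gt_eqF ?expR_gt0.
split.
- by rewrite te invrK /t /pq_t -/n2 divfK.
- by rewrite te invrK /eta /pq_eta opprK -/n2 divfK.
- exact: (pq_sqrt pos a_gt0 By).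
(* After multiplication by [|m|^2], the identity [mk] reduces the equation to [- 2 q = 2 n2 eta],
   which is the definition of [eta]. *)
- apply: (mulfI N0); rewrite le.
  rewrite mulrA [_ * (2 * _)]mulrCA mk /eta /pq_eta -/n2.
  by move: n0; move: (n2 (chi y)) (q (chi y)) => n qq n0; field.
(* Writing [6 a^2] as [6 n2 e^(2k)] by [ek] lets [3 n2] factor out, and [mk] produces the same [n2]
   on the right. *)
- apply: (mulfI N0); rewrite lk -[6 * _ * _]mulrA -ek.
  rewrite [RHS]mulrA [_ * (3 * _)]mulrCA mk.
  ring.
Qed.

End AdaptedCoordinates.

Theorem theorem7p28 (R : realType) (U : set 'rV[R]_3)
  (phi xi : 'rV[R]_3 -> 'rV[R]_4)
  (T V W : 'rV[R]_3 -> 'rV[R]_3) (a6 : 'rV[R]_3 -> R) :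
  improper_affine_hypersphere phi xi U ->
  indefinite_on phi xi U ->
  (forall x, U x -> S3_symmetric_at phi xi x) ->
  S3_frame phi xi U T V W a6 ->
  (forall x, U x -> (alpha22 phi xi T V x, alpha23 phi xi T V W x) != (0, 0)) ->
  forall p, U p ->
  exists (O : set 'rV[R]_3) (chi psi : 'rV[R]_3 -> 'rV[R]_3)
         (eta k : R -> R -> R),
    [/\ open O, open (chi @` O), chi @` O `<=` U & (chi @` O) p] /\
    [/\ Cinf_on O chi, Cinf_on (chi @` O) psi,
        (forall y, O y -> psi (chi y) = y) &
        (forall x, (chi @` O) x -> chi (psi x) = x)] /\
    Cinf_on O (fun y => eta (y 0 i1) (y 0 i2)) /\
    Cinf_on O (fun y => k (y 0 i1) (y 0 i2)) /\
    forall y, O y ->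
      let t := y 0 i0 in let v := y 0 i1 in let w := y 0 i2 in
      let etaf := fun z : 'rV[R]_3 => eta (z 0 i1) (z 0 i2) in
      let kf := fun z : 'rV[R]_3 => k (z 0 i1) (z 0 i2) in
      [/\ alpha22 phi xi T V (chi y) = t / (t ^+ 2 + eta v w ^+ 2),
          alpha23 phi xi T V W (chi y) = - eta v w / (t ^+ 2 + eta v w ^+ 2),
          a6 (chi y) = expR (k v w) / Num.sqrt (t ^+ 2 + eta v w ^+ 2),
          pd i1 (pd i1 etaf) y + pd i2 (pd i2 etaf) y
            = 2 * expR (- (2 / 3) * k v w) * eta v w &
          pd i1 (pd i1 kf) y + pd i2 (pd i2 kf) y
            = 3 * expR (- (2 / 3) * k v w) * (2 * expR (2 * k v w) - 1)].
Proof.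
move=> [oU [Cphi [Cxi [detF [detH [_ dxi]]]]]] _ _ frame nz p Up.
(* This first use, on all of [U], supplies the smoothness of the two invariant functions, from which
   the ball is chosen; the equations are then derived again on that ball. *)
have [_ [_ [Cal Cbe _ _ _]]] := structure_equations oU Cphi Cxi detF detH dxi frame.
set al := alpha22 phi xi T V in Cal nz *; set be := alpha23 phi xi T V W in Cbe nz *.
(* The real part of [p + i q] times the conjugate of its value at the centre. It is positive at the
   centre because the pair does not vanish there, hence on a small ball, where the relative argument
   lies in the range of [atan]. *)
pose g x := al p * al x + be p * be x.
have Cg : Cinf_on U g := CinfD oU (CinfM oU (Cinf_cst oU _) Cal) (CinfM oU (Cinf_cst oU _) Cbe).
have gp : 0 < g p.
  rewrite /g -!expr2 lt0r addr_ge0 ?sqr_ge0// andbT paddr_eq0 ?sqr_ge0// !sqrf_eq0.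
  by have := nz p Up; rewrite xpair_eqE.
have [r r0 rB] : exists2 r : R, 0 < r & forall x, `|x - p| < r -> U x /\ 0 < g x.
  have [r1 r10 H1] := (open_normP U).1 oU p Up.
  have [r2 r20 H2] := (continuous_normP g p).1 (Cinf_continuous Cg Up) (g p) gp.
  exists (Num.min r1 r2) => [|x]; first by rewrite lt_min r10.
  rewrite lt_min => /andP[/H1 Ux /H2]; rewrite distrC => h; split=> //.
  by have := ler_norm (g p - g x); lra.
set B := [set x : 'rV[R]_3 | `|x - p| < r].
have oB : open B := @open_normball R 3 p r.
have BU : B `<=` U by move=> x /rB[].
have [CT [CV [CW [Ca Hframe]]]] := frame.
have frameB : S3_frame phi xi B T V W a6.
  split; [exact (Cinf_on_sub BU CT) | split; [exact (Cinf_on_sub BU CV) |]].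
  split; [exact (Cinf_on_sub BU CW) | split; [exact (Cinf_on_sub BU Ca) |]].
  by move=> x /BU; exact: Hframe.
have CphiB := Cinf_on_sub BU Cphi; have CxiB := Cinf_on_sub BU Cxi.
have [z1 [z2 [CalB CbeB Cz1 Cz2 S]]] := structure_equations oB CphiB CxiB
  (fun x Bx => detF x (BU x Bx)) (fun x Bx => detH x (BU x Bx))
  (fun i x Bx => dxi i x (BU x Bx)) frameB.
have a_gt0 x : B x -> 0 < a6 x by move=> /BU /Hframe[_ []].
have gB x : B x -> 0 < al p * al x + be p * be x by move=> /rB[].
have uE x : B x -> (\matrix_(i < 3) nth 0 [:: T x; V x; W x] i : 'M[R]_3) \in unitmx.
  exact: (frame_unit oB CphiB frameB).
have [ O [chi [psi [eta [k [[oO oI IB Ip] H]]]]]] := adapted_chart r0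
  (Cinf_on_sub BU CT) (Cinf_on_sub BU CV) (Cinf_on_sub BU CW) CalB CbeB (Cinf_on_sub BU Ca)
  Cz1 Cz2 a_gt0 gB uE S.
exists O, chi, psi, eta, k; split; last exact: H.
by split=> // x /IB /BU.
Qed.
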